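(* Let $\ell\in\mathbb{N}$ and let $A=(A_{11},A_{12},A_{22})$ be an elliptic tuple of real $\ell\times\ell$ matrices. For $0<\alpha\le 2\pi$ let $$\Lambda_\alpha:=\{\lambda\in\mathbb{C}:\ \text{there exists } r^\lambda v\neq 0 \text{ solving the model problem for } A \text{ with angle } \alpha \text{ and mixed boundary conditions}\}.$$ 1. If $A$ is contractive Neumann well-posed, then: - (i) $\Lambda_\alpha\subset\{\lambda\in\mathbb{C}: |\operatorname{Re}\lambda|>\tfrac12\}$ for $0<\alpha<\pi$; - (ii) $\Lambda_\pi\subset\{\lambda\in\mathbb{C}:\operatorname{Re}\lambda\in\tfrac12+\mathbb{Z}\}$; - (iii) $\Lambda_\alpha\subset\{\lambda\in\mathbb{C}: |\operatorname{Re}\lambda|>\tfrac14\}$ for $\pi<\alpha<2\pi$; - (iv) $\Lambda_{2\pi}\subset\{\lambda\in\mathbb{C}:\operatorname{Re}\lambda\in\tfrac14+\tfrac12\mathbb{Z}\}$. 2. If $A$ is not assumed to be contractive Neumann well-posed, then any $\lambda\in\Lambda_\alpha$ not satisfying the corresponding condition in (i)–(iv) is of the following form: - (a) $\operatorname{Re}\lambda=0$ in the cases $0<\alpha<\pi$ and $\pi<\alpha<2\pi$; - (b) $\operatorname{Re}\lambda\in\tfrac12\mathbb{Z}$ in the case $\alpha=\pi$; - (c) $\operatorname{Re}\lambda\in\tfrac14\mathbb{Z}$ in the case $\alpha=2\pi$.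
   Context: **Elliptic tuples.** For a triple $A=(A_{11},A_{12},A_{22})$ of symmetric matrices in $\operatorname{Mat}_\ell(\mathbb{R})$ put $A_{21}:=A_{12}$, $L_A(\xi_1,\xi_2):=A_{11}\xi_1^2+2A_{12}\xi_1\xi_2+A_{22}\xi_2^2$ and $L_A(\partial_{x_1},\partial_{x_2}):=\sum_{i,j=1}^2A_{ij}\partial_{x_i}\partial_{x_j}$. $A$ is an *elliptic tuple* if moreover $A_{11},A_{22}$ are positive definite and $\det L_A(\xi)\ne0$ for all $\xi\in\mathbb{R}^2\setminus\{0\}$. **Standard root.** The standard root of an elliptic tuple $A$ is the unique $V\in\operatorname{Mat}_\ell(\mathbb{C})$ with $\sigma(V)\subset\{z:\operatorname{Im}z>0\}$ and $L_A(\xi_1,\xi_2)=A_{22}^{1/2}(V^*\xi_1-\mathrm{Id}_\ell\,\xi_2)(V\xi_1-\mathrm{Id}_\ell\,\xi_2)A_{22}^{1/2}$ for all $(\xi_1,\xi_2)\in\mathbb{C}^2$. Write $V=C+iD$ with $C,D\in\operatorname{Mat}_\ell(\mathbb{R})$ (entrywise real and imaginary parts); $D$ is positive definite. $A$ is *contractive Neumann well-posed* if $\rho([D^{-1},C])<2$, where $\rho$ is the spectral radius and $[X,Y]=XY-YX$. **Model problem.** Use polar coordinates $x_1=r\cos\varphi$, $x_2=r\sin\varphi$. For $0<\alpha\le2\pi$ let $\mathcal{K}_\alpha$ be the angle $\{r>0,\ 0\le\varphi\le\alpha\}$ with sides $\Gamma^-=\{\varphi=0\}$, $\Gamma^+=\{\varphi=\alpha\}$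 (for $\alpha=2\pi$ the sides are distinguished by the value of $\varphi\in[0,2\pi]$). The conormal derivatives on $\Gamma^-$ ($\varphi=0$) and $\Gamma^+$ ($\varphi=\alpha$) are $N_A^\mp=\sum_{i,j=1}^2A_{ij}n_i\partial_{x_j}$ with $n=(-\sin\varphi,\cos\varphi)$. A solution $r^\lambda v$ ($\lambda\in\mathbb{C}$) of the model problem with mixed boundary conditions is a function $u(r,\varphi)=r^\lambda v(\varphi)$ with $v:[0,\alpha]\to\mathbb{C}^\ell$ smooth such that $L_A(\partial_{x_1},\partial_{x_2})u=0$ on $\mathcal{K}_\alpha$, $N_A^-u=0$ on $\Gamma^-$ (Neumann) and $u=0$ on $\Gamma^+$ (Dirichlet). Equivalently, in terms of $v$ on $[0,\alpha]$: $b_2v''+(\lambda-1)b_1v'+\lambda(\lambda-1)b_0v+\lambda b_2v=0$, $\ b_2(0)v'(0)+\tfrac{\lambda}{2}b_1(0)v(0)=0$, $\ v(\alpha)=0$, where $b_0=A_{11}\cos^2\varphi+A_{22}\sin^2\varphi+2A_{12}\sin\varphi\cos\varphi$, $b_1=2(A_{22}-A_{11})\sin\varphi\cos\varphi+2A_{12}(\cos^2\varphi-\sin^2\varphi)$, $b_2=A_{11}\sin^2\varphi+A_{22}\cos^2\varphi-2A_{12}\cos\varphi\sin\varphi$. *)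

(* Defs.v *)
From HB Require Import structures.
From mathcomp Require Import all_boot all_order all_algebra.
From mathcomp Require Import complex.
From mathcomp Require Import all_classical all_reals all_analysis.
Set Implicit Arguments.
Unset Strict Implicit.
Unset Printing Implicit Defensive.
Import Order.TTheory GRing.Theory Num.Theory numFieldNormedType.Exports.

Local Open Scope classical_set_scope.
Local Open Scope complex_scope.
Local Open Scope ring_scope.

Notation cRe := (@complex.Re _) (only parsing).
Notation cIm := (@complex.Im _) (only parsing).

Section Matrices.
Context {R : realType} {l : nat}.

Definition mxC {m n : nat} (M : 'M[R]_(m, n)) : 'M[R[i]]_(m, n) :=
  map_mx (real_complex R) M.

Definition symmetric_mx (M : 'M[R]_l) : Prop := M^T = M.

Definition posdef_mx (M : 'M[R]_l) : Prop :=
  symmetric_mx M /\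
  forall x : 'cV[R]_l, x != 0 -> 0 < (x^T *m M *m x) 0 0.

(* [S] is the positive definite square root of [M] *)
Definition is_sqrt_mx (M S : 'M[R]_l) : Prop := posdef_mx S /\ S *m S = M.

Definition adjoint_mx (V : 'M[R[i]]_l) : 'M[R[i]]_l := (map_mx conjc V)^T.

Definition Re_mx (V : 'M[R[i]]_l) : 'M[R]_l := map_mx cRe V.
Definition Im_mx (V : 'M[R[i]]_l) : 'M[R]_l := map_mx cIm V.

(* The set is finite; for [l = 0] it is empty and the value is [0]. *)
Definition spectral_radius (M : 'M[R[i]]_l) : R :=
  sup [set ComplexField.Normc.normc z | z in [set z | eigenvalue M z]].

Definition commutator_mx (X Y : 'M[R]_l) : 'M[R]_l := X *m Y - Y *m X.

End Matrices.

Record mx_triple (R : realType) (l : nat) :=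
  MxTriple { A11 : 'M[R]_l; A12 : 'M[R]_l; A22 : 'M[R]_l }.

Section Elliptic.
Context {R : realType} {l : nat}.
Implicit Types (A : mx_triple R l) (V : 'M[R[i]]_l).

Definition symbolR A (x1 x2 : R) : 'M[R]_l :=
  x1 ^+ 2 *: A11 A + (2 * x1 * x2) *: A12 A + x2 ^+ 2 *: A22 A.

Definition symbolC A (x1 x2 : R[i]) : 'M[R[i]]_l :=
  x1 ^+ 2 *: mxC (A11 A) + (2 * x1 * x2) *: mxC (A12 A)
  + x2 ^+ 2 *: mxC (A22 A).

Definition elliptic A : Prop :=
  [/\ symmetric_mx (A12 A), posdef_mx (A11 A), posdef_mx (A22 A)
    & forall x1 x2 : R, (x1, x2) != (0, 0) -> \det (symbolR A x1 x2) != 0].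

Definition is_standard_root A V : Prop :=
  (forall z : R[i], eigenvalue V z -> 0 < cIm z) /\
  exists2 S : 'M[R]_l, is_sqrt_mx (A22 A) S &
    forall x1 x2 : R[i],
      symbolC A x1 x2 =
      mxC S *m (x1 *: adjoint_mx V - x2%:M) *m (x1 *: V - x2%:M) *m mxC S.

(* An elliptic tuple has exactly one standard root. *)
Definition contractive_neumann_wellposed A : Prop :=
  exists2 V, is_standard_root A V &
    spectral_radius (mxC (commutator_mx (invmx (Im_mx V)) (Re_mx V))) < 2.

End Elliptic.

Section ModelProblem.
Context {R : realType} {l : nat}.
Implicit Types (A : mx_triple R l).

Definition cpowR (r : R) (lam : R[i]) : R[i] :=
  (expR (cRe lam * ln r) * cos (cIm lam * ln r))
  +i* (expR (cRe lam * ln r) * sin (cIm lam * ln r)).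

(* Derivative of a [C^l]-valued function of a real variable, taken
   separately on the real and imaginary parts of the components. *)
Definition vderive (f : R -> 'cV[R[i]]_l) (t : R) : 'cV[R[i]]_l :=
  \col_k ((fun s => cRe (f s k 0))^`()%classic t
          +i* (fun s => cIm (f s k 0))^`()%classic t).

Definition vsmooth (f : R -> 'cV[R[i]]_l) : Prop :=
  forall (k : 'I_l) (n : nat) (t : R),
    derivable ((fun s => cRe (f s k 0))^`(n)%classic) t 1 /\
    derivable ((fun s => cIm (f s k 0))^`(n)%classic) t 1.

(* Functions on the angle are given in the polar coordinates [(r, phi)], so
   that the two sides of the angle [2 pi] stay distinct; [dx1] and [dx2] are the
   Cartesian derivatives written in these coordinates by the chain rule. *)
Definition polar_fun := R -> R -> 'cV[R[i]]_l.

Definition dr (u : polar_fun) : polar_fun :=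
  fun r phi => vderive (fun s => u s phi) r.
Definition dphi (u : polar_fun) : polar_fun :=
  fun r phi => vderive (fun s => u r s) phi.

Definition dx1 (u : polar_fun) : polar_fun := fun r phi =>
  (cos phi)%:C *: dr u r phi - (sin phi / r)%:C *: dphi u r phi.
Definition dx2 (u : polar_fun) : polar_fun := fun r phi =>
  (sin phi)%:C *: dr u r phi + (cos phi / r)%:C *: dphi u r phi.

Definition elliptic_op A (u : polar_fun) : polar_fun := fun r phi =>
  mxC (A11 A) *m dx1 (dx1 u) r phi + mxC (A12 A) *m dx1 (dx2 u) r phi
  + mxC (A12 A) *m dx2 (dx1 u) r phi + mxC (A22 A) *m dx2 (dx2 u) r phi.

(* conormal derivative, with normal [n = (- sin phi, cos phi)] *)
Definition conormal A (u : polar_fun) : polar_fun := fun r phi =>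
  let n1 := - sin phi in let n2 := cos phi in
  mxC (n1 *: A11 A + n2 *: A12 A) *m dx1 u r phi
  + mxC (n1 *: A12 A + n2 *: A22 A) *m dx2 u r phi.

Definition homogeneous_fun (lam : R[i]) (v : R -> 'cV[R[i]]_l) : polar_fun :=
  fun r phi => cpowR r lam *: v phi.

(* Smoothness on the closed interval [[0, alpha]] means being the restriction of
   a smooth function on the line, here [v]; derivatives at the endpoints are
   then the one-sided ones, and the values of [v] outside of [[0, alpha]] are
   irrelevant. *)
Definition solves_mixed A (alpha : R) (lam : R[i]) (v : R -> 'cV[R[i]]_l) :
    Prop :=
  let u := homogeneous_fun lam v in
  [/\ vsmooth v,
      forall r phi : R, 0 < r -> 0 <= phi <= alpha -> elliptic_op A u r phi = 0,
      forall r : R, 0 < r -> conormal A u r 0 = 0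
    & forall r : R, 0 < r -> u r alpha = 0].

Definition mixed_exponents A (alpha : R) : set R[i] :=
  [set lam | exists2 v : R -> 'cV[R[i]]_l, solves_mixed A alpha lam v &
     exists r phi : R,
       [/\ 0 < r, 0 <= phi <= alpha & homogeneous_fun lam v r phi != 0]].

End ModelProblem.

(* Main.v *)
Require Import Defs.
From HB Require Import structures.
From mathcomp Require Import all_boot all_order all_algebra.
From mathcomp Require Import complex ring lra zify.
From mathcomp Require Import all_classical all_reals all_analysis.
Set Implicit Arguments.
Unset Strict Implicit.
Unset Printing Implicit Defensive.
Import Order.TTheory GRing.Theory Num.Theory numFieldNormedType.Exports.

(** Write a, b, G for A11, A12, A22. Instead of the standard root, the proof
    uses its conjugate V by the square root of G. It is characterized by
    [G V + hc V G = - 2 b], [hc V G V = a] and a spectrum in the upper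
    half-plane ([root_of]). The matrix E = G Im V is real, symmetric and positive
    definite ([imE_pos]), and M = (G V - hc V G) / 2i is hermitian with
    M + conj M = 2 E. Both signs come from the theorem of Lyapunov: E is positive
    for every elliptic tuple, M as soon as the eigenvalues of the commutator
    [D^-1, C] have imaginary part above -2, hence in the contractive case
    ([commutator_pos]). For part 2, where no root is given, V is built from the
    companion matrix of the symbol ([root_exists]): the symbol has no real
    characteristic value, so half of the spectrum of that matrix lies in the
    upper half-plane, and the corresponding invariant subspace is a graph.

    The gradient of [r^lam v] is [r^(lam - 1)] times a pair (p, q) of
    functions of the angle. For (p, q) = (P, V P) + conj (Q, V Q) the elliptic
    system becomes, with T = cos + sin V, [T P' = (lam - 1) T' P] and [T Q' =
    (conj lam - 1) T' Q] ([radial_parts]). The row x = (T Q)^T E and the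
    column y = T P then follow the flows x' = conj lam x N and y' = lam N y, N
    = T^-1 T'. With s = 2 Re lam, formally x = x0 T^(conj lam), y = T^lam y0,
    and x T^-s y is constant. At the Dirichlet side x = - hc c E with c = y
    alpha, which is nonzero because the flows have unique solutions. At the
    Neumann side T = 1, and x y is a real number m, nonnegative when M is
    positive ([mixed_pairing]). So, formally,

      m = - hc c E T(alpha)^-s c,

    and the theorem is read off from the argument of the right hand side: V is
    dissipative for the form E, that is, Im (hc c E V c) > 0 ([dform_gt0]).

    For 0 < s < 1 the power T^-s is replaced by the integral of t^-s (t +
    T)^-1 over t > 0, cut at t = exp (- L) and t = exp L. If W moves with W' =
    K W, where K commutes with W, and x, y follow flows whose generators add
    up to s K, the derivative of the integrand along the motion is a
    derivative in log t. By Green's formula the cut integral then changes by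
    O(1/L) only ([mellin_transport]). One deformation follows W = exp (- i
    phi) T(phi) from phi = 0, where W = 1, to phi = alpha; another one rotates
    T(alpha) to exp (- i tau) T(alpha) with sin tau = 0, where the sign of the
    imaginary part is known. The inverse of t + W exists all along because of
    the dissipativity. Replacing y by T y or T^-1 y shifts s by one, which
    gives access to the other values of s.

    - If alpha < pi, the choice tau = 0 is contradictory for 0 < |s| < 1, since
      it makes m sin (s tau) both zero and of a strict sign; at |s| = 1 the pairing
      itself has a nonzero imaginary part ([no_exponent_convex]).
    - If pi < alpha < 2 pi, the choices tau = pi and tau = 2 pi give incompatible
      signs of m for 0 < |s| <= 1/2 ([no_exponent_reentrant]).
    - If alpha is pi or 2 pi, then exp (- i alpha) T(alpha) = 1 and
      m = - exp (- i s alpha) hc c E c for every s ([monodromy]). As m is real,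
      sin (s alpha) = 0; if m >= 0, moreover cos (s alpha) = -1.
    - If s = 0, then m = - hc c E c < 0, which excludes m >= 0
      ([pairing_s0]). *)

Local Open Scope classical_set_scope.
Local Open Scope ring_scope.
Local Open Scope complex_scope.

(** * Hermitian forms and the theorem of Lyapunov *)

Section ConjugateTranspose.
Context {R : rcfType}.
Local Notation C := R[i].

(** [hc] stands for hermitian conjugate. *)
Definition hc m n (M : 'M[C]_(m, n)) : 'M[C]_(n, m) := (map_mx conjc M)^T.

Lemma hcM m n p (A : 'M[C]_(m, n)) (B : 'M[C]_(n, p)) :
  hc (A *m B) = hc B *m hc A.
Proof. by rewrite /hc map_mxM trmx_mul. Qed.

Lemma hcK m n (A : 'M[C]_(m, n)) : hc (hc A) = A.
Proof. by apply/matrixP=> i j; rewrite !mxE conjcK. Qed.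

Lemma hcD m n (A B : 'M[C]_(m, n)) : hc (A + B) = hc A + hc B.
Proof. by rewrite /hc map_mxD linearD. Qed.

Lemma hcN m n (A : 'M[C]_(m, n)) : hc (- A) = - hc A.
Proof. by rewrite /hc map_mxN linearN. Qed.

Lemma hcB m n (A B : 'M[C]_(m, n)) : hc (A - B) = hc A - hc B.
Proof. by rewrite hcD hcN. Qed.

Lemma hcZ m n (c : C) (A : 'M[C]_(m, n)) : hc (c *: A) = conjc c *: hc A.
Proof. by rewrite /hc map_mxZ linearZ. Qed.

Lemma hc_inv n (A : 'M[C]_n) : hc (invmx A) = invmx (hc A).
Proof. by rewrite /hc map_invmx trmx_inv. Qed.

Definition pos_form n (H : 'M[C]_n) : Prop :=
  forall x : 'cV[C]_n, x != 0 -> 0 < (hc x *m H *m x) 0 0.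

Definition upper_spectrum n (V : 'M[C]_n) : Prop :=
  forall z, eigenvalue V z -> 0 < cIm z.

Lemma eigenvalueT n (V : 'M[C]_n) z : eigenvalue V^T z = eigenvalue V z.
Proof.
rewrite /eigenvalue /eigenspace !kermx_eq0 !row_free_unit -[in RHS]unitmx_tr.
by rewrite linearB /= tr_scalar_mx.
Qed.

Lemma col_eigenvector n (V : 'M[C]_n) z (e : 'cV[C]_n) :
  e != 0 -> V *m e = z *: e -> eigenvalue V z.
Proof.
move=> e0 Ve; rewrite -eigenvalueT; apply/eigenvalueP; exists e^T.
  by rewrite -trmx_mul Ve linearZ.
by rewrite trmx_eq0.
Qed.

Lemma exists_col_eigenvector n (V : 'M[C]_n) : (0 < n)%N ->
  exists z, exists2 e : 'cV[C]_n, e != 0 & V *m e = z *: e.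
Proof.
move=> n0; have [z /eigenvalueP[v vV v0]] := eigenvalue_closed V^T n0.
exists z, v^T; first by rewrite trmx_eq0.
by rewrite -[V]trmxK -trmx_mul vV linearZ.
Qed.

Lemma mx11_mul (a b : 'M[C]_1) : (a *m b) 0 0 = a 0 0 * b 0 0.
Proof. by rewrite !mxE big_ord1. Qed.

(** By induction on the size. On an eigenvector [e] of [V] for [z], the
    identity gives [2 Im z (hc e H e) = hc e P e], so [H] is positive on [e]. The
    [H]-orthogonal complement of [e] carries a smaller instance: [V] acts there
    modulo [e], and its eigenvalues there are eigenvalues of [V]. *)
Lemma lyapunov n (H V P : 'M[C]_n) : hc H = H ->
  H *m V - hc V *m H = 'i *: P -> pos_form P -> upper_spectrum V ->
  pos_form H.
Proof.
have [m] := ubnP n; elim: m n H V P => // m IH [|n] H V P.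
  by move=> _ _ _ _ _ x /eqP[]; apply/matrixP=> -[].
rewrite ltnS => nm hH HV posP upV.
have [z [e e0 Ve]] := exists_col_eigenvector V (ltn0Sn n).
have zup : 0 < cIm z by apply: upV; exact: col_eigenvector Ve.
pose g := hc e *m H; pose h := (g *m e) 0 0.
have ge : g *m e = h%:M by rewrite [LHS]mx11_scalar.
have hE : 2 * (cIm z)%:C * h = (hc e *m P *m e) 0 0.
  have : (hc e *m (H *m V - hc V *m H) *m e) 0 0
       = ('i *: (hc e *m P *m e)) 0 0 by rewrite HV -!scalemxAr -scalemxAl.
  have -> : hc e *m (H *m V - hc V *m H) *m e = (z - conjc z) *: (g *m e).
    rewrite mulmxBr mulmxBl scalerBl; congr (_ - _).
      by rewrite -!mulmxA Ve -!scalemxAr /g mulmxA.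
    by rewrite mulmxA -hcM Ve hcZ -!scalemxAl.
  rewrite ge !mxE eqxx mulr1n subcJ => E.
  apply: (@mulfI _ 'i%C); first by rewrite eq_complex /= oner_eq0 andbF.
  by rewrite -E; ring.
have h0 : 0 < h.
  have := posP e e0; rewrite -hE pmulr_rgt0 //.
  by rewrite pmulr_rgt0 // ?ltcR // ltr0Sn.
have hn0 : h != 0 by rewrite gt_eqF.
(* The columns of B are a basis of the H-orthogonal complement of e. *)
pose K := row_base (kermx g^T); pose B := K^T.
have gB : g *m B = 0.
  apply: trmx_inj; rewrite (trmx_mul g B) [B^T]trmxK [RHS]trmx0; apply/sub_kermxP.
  by rewrite eq_row_base.
have kerB p (X : 'M[C]_(n.+1, p)) : g *m X = 0 -> exists Y, X = B *m Y.
  move=> gX; have : (X^T <= kermx g^T)%MS.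
    by apply/sub_kermxP; rewrite -(trmx_mul g X) gX trmx0.
  rewrite -(eq_row_base (kermx g^T)) => /submxP[Y E]; exists Y^T.
  by rewrite -[X]trmxK E (trmx_mul Y).
have hhE : hc h%:M = h%:M :> 'M[C]_1.
  by rewrite -ge hcM /g !hcM hcK hH mulmxA.
have dec p (X : 'M[C]_(n.+1, p)) :
    exists Y, X = e *m (h^-1 *: (g *m X)) + B *m Y.
  have [|Y E] := kerB _ (X - e *m (h^-1 *: (g *m X))).
    rewrite mulmxBr mulmxA ge mul_scalar_mx scalerA mulfV // scale1r subrr //.
  by exists Y; rewrite -E addrC subrK.
have [V1 VB] := dec _ (V *m B).
set gam := h^-1 *: _ in VB.
have BHe : hc B *m H *m e = 0.
  by apply: (can_inj (@hcK _ _)); rewrite !hcM hcK hH mulmxA gB /hc map_mx0 trmx0.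
have k_lt : (\rank (kermx g^T) < m)%N.
  apply: leq_trans nm; rewrite mxrank_ker ltn_subrL lt0n mxrank_eq0 andbT.
  by rewrite trmx_eq0; apply: contraNneq hn0 => g0; rewrite /h g0 mul0mx mxE.
have [L KL] : exists L, K *m L = 1%:M.
  by apply/row_freeP; exact: row_base_free.
have LB : L^T *m B = 1%:M by rewrite -trmx_mul KL trmx1.
(* The H-orthogonal projection along e; it carries the eigenvectors of the
   compression V1 to eigenvectors of V. *)
pose Pi := 1%:M - h^-1 *: (e *m g).
have PiB : Pi *m B = B.
  by rewrite mulmxBl mul1mx -scalemxAl -mulmxA gB mulmx0 scaler0 subr0.
have Pie : Pi *m e = 0.
  rewrite mulmxBl mul1mx -scalemxAl -mulmxA ge mul_mx_scalar scalerA mulVf //.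
  by rewrite scale1r subrr.
have posW : pos_form (hc B *m H *m B).
  apply: (IH _ _ V1 (hc B *m P *m B)) => //.
  - by rewrite !hcM hcK hH mulmxA.
  - have BV1 : B *m V1 = V *m B - e *m gam by rewrite VB addrC addKr.
    have -> : hc B *m H *m B *m V1 = hc B *m (H *m V) *m B.
      by rewrite -mulmxA BV1 mulmxBr !mulmxA BHe mul0mx subr0.
    have -> : hc V1 *m (hc B *m H *m B) = hc B *m (hc V *m H) *m B.
      have BV1h : hc V1 *m hc B = hc B *m hc V - hc gam *m hc e.
        by rewrite -!hcM -hcB BV1.
      rewrite mulmxA mulmxA BV1h !mulmxBl -(mulmxA (hc gam)) -(mulmxA (hc gam)).
      by rewrite -/g gB mulmx0 subr0 !mulmxA.
    by rewrite -mulmxBl -mulmxBr HV -scalemxAr -scalemxAl.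
  - move=> b b0; have := posP (B *m b).
    rewrite hcM !mulmxA => -> //.
    apply: contraNneq b0 => Bb; have : L^T *m (B *m b) = 0 by rewrite Bb mulmx0.
    by rewrite mulmxA LB mul1mx => ->.
  - move=> z' /eigenvalueP[w wV1 w0]; apply: upV; apply/eigenvalueP.
    pose f := w *m L^T *m Pi.
    have fB : f *m B = w by rewrite /f -mulmxA PiB -mulmxA LB mulmx1.
    have fe : f *m e = 0 by rewrite /f -mulmxA Pie mulmx0.
    exists f; last by apply: contraNneq w0 => f0; rewrite -fB f0 mul0mx.
    have fVe : f *m V *m e = 0 by rewrite -mulmxA Ve -scalemxAr fe scaler0.
    have fVB : f *m V *m B = z' *: w.
      by rewrite -mulmxA VB mulmxDr !mulmxA fe mul0mx add0r fB wV1.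
    have [Y] := dec _ 1%:M; set u := _ *: _ => E1.
    rewrite -[f *m V]mulmx1 -[f in RHS]mulmx1 E1 !mulmxDr !mulmxA.
    by rewrite fVe fVB fe fB !mul0mx !add0r scalemxAl.
move=> x x0; have [b E] := dec _ x; set a := h^-1 *: _ in E.
have -> : hc x *m H *m x = hc a *m (g *m e) *m a + hc b *m (hc B *m H *m B) *m b.
  have xH : hc x *m H = hc a *m g + hc b *m (hc B *m H).
    by rewrite {1}E hcD !hcM mulmxDl /g !mulmxA.
  rewrite xH {1}E mulmxDr !mulmxDl.
  rewrite -(mulmxA (hc a) g (B *m b)) (mulmxA g B) gB mul0mx mulmx0.
  rewrite -(mulmxA (hc b) (hc B *m H) (e *m a)) (mulmxA (hc B *m H) e) BHe.
  by rewrite mul0mx mulmx0 addr0 add0r !mulmxA.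
have ah : (hc a *m (g *m e) *m a) 0 0 = h * (a 0 0 * conjc (a 0 0)).
  by rewrite ge mul_mx_scalar -scalemxAl mxE mx11_mul !mxE; ring.
rewrite mxE ah; have [b0|b0] := eqVneq b 0.
  rewrite b0 mulmx0 [X in _ + X]mxE addr0 mulr_gt0 // lt_def mulcJ_ge0 andbT.
  have a0 : a 0 0 != 0.
    apply: contraNneq x0 => a0; rewrite E b0 mulmx0 addr0.
    by rewrite [a]mx11_scalar a0 -scalemx1 scale0r mulmx0.
  by rewrite mulf_neq0 // conjc_eq0.
by rewrite ltr_wpDl ?posW // mulr_ge0 ?(ltW h0) ?mulcJ_ge0.
Qed.

End ConjugateTranspose.

(** * Roots of the quadratic symbol *)

Section Sylvester.
Context {R : rcfType}.
Local Notation C := R[i].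

Lemma eigenvalue_conj n (V : 'M[C]_n) z :
  eigenvalue (map_mx conjc V) z = eigenvalue V (conjc z).
Proof. by rewrite -[z in LHS]conjcK eigenvalue_map. Qed.

Lemma eigenvalue_hc n (V : 'M[C]_n) z : eigenvalue (hc V) z = eigenvalue V (conjc z).
Proof. by rewrite /hc eigenvalueT eigenvalue_conj. Qed.

(** [V] preserves the row space of [X], [Z] its column space, and both act
    on a rank factorization of [X] by the same matrix, whose eigenvalues they would
    share. *)
Lemma sylvester_eq0 m n (Z : 'M[C]_m) (V : 'M[C]_n) (X : 'M[C]_(m, n)) :
  Z *m X = X *m V -> (forall z, eigenvalue V z -> ~~ eigenvalue Z z) -> X = 0.
Proof.
move=> ZX disj; apply/eqP; apply/negPn; rewrite -mxrank_eq0 -lt0n; apply/negP.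
move=> rX.
have : (row_base X *m V <= row_base X)%MS.
  by rewrite eq_row_base (eqmxMr _ (eq_row_base X)) -ZX submxMl.
case/submxP=> Y rV; set r := row_base X in rV.
have [z [u u0 Yu]] := exists_col_eigenvector Y rX.
have eYz : eigenvalue Y z by exact: col_eigenvector Yu.
have eVz : eigenvalue V z.
  have /eigenvalueP[w wY w0] := eYz; apply/eigenvalueP; exists (w *m r).
    by rewrite -mulmxA rV mulmxA wY -scalemxAl.
  by rewrite mulmx_free_eq0 ?row_base_free.
suff : eigenvalue Z z by apply/negP/disj.
have ZC : Z *m col_base X = col_base X *m Y.
  apply: (row_free_inj (row_base_free X)).
  rewrite -(mulmxA Z) mulmx_base -(mulmxA (col_base X) Y) -rV.
  by rewrite (mulmxA (col_base X)) mulmx_base.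
apply: (@col_eigenvector _ _ _ _ (col_base X *m u)).
  have /row_fullP[B BC] := col_base_full X.
  by apply: contraNneq u0 => Cu; rewrite -[u]mul1mx -BC -mulmxA Cu mulmx0.
by rewrite mulmxA ZC -mulmxA Yu -scalemxAr.
Qed.

Lemma pos_unit n (P : 'M[C]_n) : pos_form P -> P \in unitmx.
Proof.
move=> posP; rewrite -unitmx_tr -row_free_unit -kermx_eq0; apply/negPn/negP.
case/rowV0Pn=> v /sub_kermxP vP v0; have v0' : v^T != 0 by rewrite trmx_eq0.
have Pv : P *m v^T = 0 by apply: trmx_inj; rewrite trmx_mul trmxK vP trmx0.
by have := posP _ v0'; rewrite -mulmxA Pv mulmx0 mxE ltxx.
Qed.

End Sylvester.

Section RootTheory.
Context {R : rcfType} {l : nat}.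
Local Notation C := R[i].
Local Notation cj := (map_mx conjc).

Definition real_mx (M : 'M[C]_l) : Prop := cj M = M.

Lemma map_conjK m n (M : 'M[C]_(m, n)) : cj (cj M) = M.
Proof. by apply/matrixP=> i j; rewrite !mxE conjcK. Qed.

Lemma cjZ m n (c : C) (M : 'M[C]_(m, n)) : cj (c *: M) = conjc c *: cj M.
Proof. exact: map_mxZ. Qed.

Lemma conj_trmx (M : 'M[C]_l) : cj (M^T) = hc M.
Proof. by rewrite -map_trmx. Qed.

(** Here [a], [b], [G] are the coefficients A11, A12, A22 of the symbol, and the
    two identities say that [(hc V - xi) G (V - xi) = a + 2 xi b + xi^2 G]. Compared
    with the standard root, the factor [G] in the middle avoids the square
    root of A22. *)
Record root_of (a b G V : 'M[C]_l) : Prop := RootOf {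
  root_realG : real_mx G; root_symG : G^T = G; root_posG : pos_form G;
  root_reala : real_mx a; root_realb : real_mx b;
  root_sum : G *m V + hc V *m G = - (2 *: b);
  root_prod : hc V *m G *m V = a;
  root_upper : upper_spectrum V }.

Variables (a b G V : 'M[C]_l).
Hypothesis rV : root_of a b G V.

(** This is 2i Im V; the factor is divided out in [imE]. *)
Definition imW : 'M[C]_l := V - cj V.
(** G times the entrywise imaginary part of V. *)
Definition imE : 'M[C]_l := (2 * 'i)^-1 *: (G *m imW).
(** The form of the Dirichlet-to-Neumann map of a half-plane, in the sense that
    [b + G V = 'i dtnM]. *)
Definition dtnM : 'M[C]_l := (2 * 'i)^-1 *: (G *m V - hc V *m G).

Local Notation W := imW.
Local Notation E := imE.
Local Notation M := dtnM.

Lemma conj_hc m n (X : 'M[C]_(m, n)) : cj (hc X) = X^T.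
Proof. by rewrite /hc -map_trmx map_conjK. Qed.

Lemma conjW : cj W = - W.
Proof. by rewrite /W map_mxB map_conjK opprB. Qed.

Lemma conjI2 : conjc ((2 * 'i)^-1 : C) = - (2 * 'i)^-1.
Proof. by rewrite conjc_inv -invrN; congr (_^-1); simpc. Qed.

Lemma i_neq0 : 'i%C != 0 :> C.
Proof. by rewrite eq_complex /= oner_eq0 andbF. Qed.

Lemma iV : ('i%C)^-1 = - 'i%C :> C.
Proof.
apply: (mulIf i_neq0); rewrite mulVf ?i_neq0 // mulNr -expr2 sqr_i.
by rewrite opprK.
Qed.

(** [G V + hc V G] is real, so it agrees with its conjugate [G (conj V) + V^T G]. *)
Lemma GW_sym : G *m W = W^T *m G.
Proof.
have := root_sum rV => S.
have : cj (G *m V + hc V *m G) = G *m V + hc V *m G.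
  rewrite S map_mxN map_mxZ (root_realb rV); congr (- (_ *: _)).
  exact: (conjc_nat R 2).
rewrite map_mxD !map_mxM conj_hc (root_realG rV) /W mulmxBr => H.
rewrite linearB /= mulmxBl -/(hc V).
by apply/eqP; rewrite subr_eq addrAC eq_sym subr_eq eq_sym addrC -H addrC.
Qed.

(** [hc V G V] is real, so it agrees with its conjugate [V^T G (conj V)]. *)
Lemma WGV : G *m W *m V = V^T *m (G *m W).
Proof.
have H : V^T *m G *m cj V = hc V *m G *m V.
  have : cj (hc V *m G *m V) = hc V *m G *m V.
    by rewrite (root_prod rV) (root_reala rV).
  by rewrite !map_mxM conj_hc (root_realG rV).
rewrite GW_sym {1}/W linearB /= !mulmxBl -/(hc V) -H.
by rewrite -mulmxBr -mulmxA -/W GW_sym /W linearB /= mulmxBl.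
Qed.

Lemma root_solvent : G *m V *m V + 2 *: b *m V + a = 0.
Proof.
have -> : 2 *: b = - (G *m V + hc V *m G) by rewrite (root_sum rV) opprK.
by rewrite mulNmx mulmxDl opprD addrA subrr add0r (root_prod rV) addNr.
Qed.

(** By [WGV], [V] preserves the kernel of [V - conj V]. A nonzero kernel would
    contain a common eigenvector of [V] and [conj V], whose eigenvalue would lie in
    the upper and in the lower half-plane. *)
Lemma imW_unit : W \in unitmx.
Proof.
rewrite -unitmx_tr -row_free_unit -kermx_eq0; apply/negPn.
rewrite -mxrank_eq0 -lt0n; apply/negP => rk.
(* The columns of K are a basis of the kernel of W. *)
set r := row_base (kermx W^T); pose K := r^T.
have WK : W *m K = 0.
  apply: trmx_inj; rewrite (trmx_mul W K) [K^T]trmxK [RHS]trmx0; apply/sub_kermxP.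
  by rewrite eq_row_base.
have Gu := pos_unit (root_posG rV).
have WVK : W *m (V *m K) = 0.
  rewrite -[LHS](mulKmx Gu) (mulmxA G) (mulmxA (G *m W)) WGV.
  by rewrite -(mulmxA V^T) -(mulmxA G) WK !mulmx0.
have [Y VK] : exists Y, V *m K = K *m Y.
  have : ((V *m K)^T <= kermx W^T)%MS.
    by apply/sub_kermxP; rewrite -(trmx_mul W) WVK trmx0.
  rewrite -(eq_row_base (kermx W^T)) => /submxP[Y E1]; exists Y^T.
  by rewrite -[LHS]trmxK E1 (trmx_mul Y).
have [z [u u0 Yu]] := exists_col_eigenvector Y rk.
have [L KL] : exists L, r *m L = 1%:M by apply/row_freeP; exact: row_base_free.
have Ku : K *m u != 0.
  apply: contraNneq u0 => Ku; have : L^T *m (K *m u) = 0 by rewrite Ku mulmx0.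
  by rewrite mulmxA -[L^T *m K]trmx_mul KL trmx1 mul1mx => ->.
have Vz : V *m (K *m u) = z *: (K *m u).
  by rewrite mulmxA VK -(mulmxA K) Yu scalemxAr.
have Vcz : cj V *m (K *m u) = z *: (K *m u).
  have -> : cj V = V - W by rewrite /W subKr.
  by rewrite mulmxBl Vz (mulmxA W) WK mul0mx subr0.
have := root_upper rV (col_eigenvector Ku Vz).
have := col_eigenvector Ku Vcz; rewrite eigenvalue_conj => /(root_upper rV).
by case: (z) => x y /=; lra.
Qed.

Lemma imE_sym : E^T = E.
Proof. by rewrite /E linearZ /= trmx_mul (root_symG rV) -GW_sym. Qed.

Lemma imE_real : cj E = E.
Proof.
by rewrite /E cjZ conjI2 map_mxM conjW (root_realG rV) mulmxN scalerN scaleNr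
  opprK.
Qed.

Lemma imE_hc : hc E = E.
Proof. by rewrite /hc imE_real imE_sym. Qed.

Lemma imE_V : E *m V = V^T *m E.
Proof. by rewrite /E -scalemxAl WGV scalemxAr. Qed.

Lemma imE_Vc : E *m cj V = hc V *m E.
Proof.
by rewrite -{1}imE_real -map_mxM imE_V map_mxM imE_real conj_trmx.
Qed.

Lemma trW : W^T = - hc W.
Proof. by rewrite /hc conjW linearN opprK. Qed.

(** With the positivity of the right hand side, this is the hypothesis of
    [lyapunov] for [E], and later the source of all signs. *)
Lemma imE_dissip : E *m V - hc V *m E = 'i *: (2^-1 *: (hc W *m G *m W)).
Proof.
rewrite imE_V -mulmxBl -[V^T - _]linearB /= -/W trW /E -scalemxAr mulNmx mulmxA.
rewrite scalerN -scaleNr scalerA; congr (_ *: _).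
by rewrite invfM iV mulrN opprK mulrC.
Qed.

Lemma pos_hWGW : pos_form (2^-1 *: (hc W *m G *m W)).
Proof.
move=> x x0; rewrite -scalemxAr -scalemxAl mxE mulr_gt0 ?invr_gt0 ?ltr0Sn //.
have Wx : W *m x != 0.
  by apply: contraNneq x0 => Wx; rewrite -[x](mulKmx imW_unit) Wx mulmx0.
by have := root_posG rV Wx; rewrite hcM !mulmxA.
Qed.

Lemma imE_pos : pos_form E.
Proof. exact: lyapunov imE_hc imE_dissip pos_hWGW (root_upper rV). Qed.

Lemma dtnM_hc : hc M = M.
Proof.
have hG : hc G = G by rewrite /hc (root_realG rV) (root_symG rV).
by rewrite /M hcZ conjI2 hcB !hcM hcK hG scaleNr -scalerN opprB.
Qed.

Lemma dtnM_conj : M + cj M = 2 *: E.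
Proof.
rewrite /M cjZ conjI2 scaleNr -scalerBr map_mxB !map_mxM conj_hc.
rewrite (root_realG rV) opprB [V^T *m G - _]addrC addrACA [- _ + _]addrC.
have -> : V^T *m G - hc V *m G = W^T *m G by rewrite -mulmxBl -linearB.
by rewrite -mulmxBr -/W -GW_sym /E -mulr2n -(scaler_nat 2 (G *m W)) !scalerA mulrC.
Qed.

(** Put [Y = E^-1 M]. Then [lyapunov] applies to [H = M] and the matrix
    [i Y^-1]: the identity reads [M (i Y^-1) - hc (i Y^-1) M = 2i E], and [i / y] lies
    in the upper half-plane when [Re y > 0]. *)
Lemma dtnM_pos : (forall y, eigenvalue (invmx E *m M) y -> 0 < cRe y) ->
  pos_form M.
Proof.
move=> specY; have Eu := pos_unit imE_pos.
pose Y := invmx E *m M.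
have EY : E *m Y = M by rewrite mulKVmx.
have Yu : Y \in unitmx.
  rewrite -row_free_unit -kermx_eq0; apply/negPn/negP.
  move=> k0; have : eigenvalue Y 0 by rewrite /eigenvalue /eigenspace raddf0 subr0.
  by move/specY; rewrite ltxx.
have MYi : M *m invmx Y = E by rewrite -EY mulmxK.
apply: (lyapunov (V := 'i *: invmx Y) (P := 2 *: E) dtnM_hc).
- rewrite -scalemxAr MYi hcZ -scalemxAl -{1}dtnM_hc -hcM MYi imE_hc.
  rewrite -scalerBl [RHS]scalerA; congr (_ *: _).
  have -> : conjc 'i%C = - 'i%C :> C by simpc.
  by rewrite opprK -complexiE mulr_natr mulr2n.
- move=> x x0; rewrite -scalemxAr -scalemxAl mxE mulr_gt0 ?ltr0Sn //.
  exact: imE_pos.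
move=> z /eigenvalueP[v]; rewrite -scalemxAr => viY v0.
have vY : v = (z / 'i) *: (v *m Y).
  have := congr1 (fun t => 'i^-1 *: (t *m Y)) viY.
  rewrite -!scalemxAl scalerA mulVf ?scale1r ?mulmxKV //; last first.
    by rewrite eq_complex /= oner_eq0 andbF.
  by move=> vE; rewrite {1}vE scalerA mulrC.
have z0 : z != 0.
  by apply: contraNneq v0 => z0; rewrite vY z0 mul0r scale0r.
have /specY : eigenvalue Y ('i / z).
  apply/eigenvalueP; exists v => //; rewrite [in RHS]vY scalerA mulrA divfK //.
  by rewrite -complexiE divff ?i_neq0 // scale1r.
case: z z0 {viY vY} => x y z0 /=; rewrite !(mul0r, mul1r, mulrN, opprK, add0r).
rewrite pmulr_lgt0 // invr_gt0 lt_def addr_ge0 ?sqr_ge0 // andbT.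
by rewrite paddr_eq0 ?sqr_ge0 // !sqrf_eq0 ; move: z0; rewrite eq_complex.
Qed.

End RootTheory.

(** * Factorization of real polynomials and kernels of matrix polynomials *)

Section PolynomialTools.
Context {R : rcfType}.
Local Notation C := R[i].

(** The roots come in conjugate pairs, and [q] collects those of the upper
    half-plane. *)
Lemma real_poly_split (p : {poly C}) : p \is monic -> map_poly conjc p = p ->
  (forall x : R, ~~ root p x%:C) ->
  exists q : {poly C}, [/\ p = q * map_poly conjc q, q \is monic &
    forall z, root q z -> 0 < cIm z].
Proof.
move=> pm pc nor; have [rs] := closed_field_poly_normal p.
rewrite (monicP pm) scale1r => pE.
have cE s : map_poly conjc (\prod_(z <- s) ('X - z%:P))
          = \prod_(z <- map conjc s) ('X - z%:P) :> {poly C}.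
  rewrite big_map rmorph_prod; apply: eq_bigr => z _.
  by rewrite rmorphB /= map_polyX map_polyC.
have rsc : perm_eq (map conjc rs) rs.
  by apply: prod_XsubC_eq; rewrite -cE -pE pc.
pose up := [pred z : C | 0 < cIm z].
have upN z : z \in rs -> ~~ up z = up (conjc z).
  case: z => x y; rewrite -root_prod_XsubC -pE /= oppr_gt0 => rt.
  rewrite -leNgt le_eqVlt; have [y0|//] := eqVneq y 0.
  by have := nor x; rewrite -[x%:C]/(x +i* 0) -y0 rt.
exists (\prod_(z <- [seq z <- rs | up z]) ('X - z%:P)); split.
- rewrite cE {1}pE (bigID up) /= big_filter; congr (_ * _).
  rewrite -big_filter; apply: perm_big.
  have := perm_filter [pred z | ~~ up z] rsc.
  rewrite perm_sym => /perm_trans; apply; rewrite filter_map.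
  apply/permP => a; congr (count a (map _ _)); apply: eq_in_filter => z zrs /=.
  have /= := upN z zrs.
  by case: z zrs => x y _ /=; rewrite !oppr_gt0 => <-; rewrite negbK.
- exact: monic_prod_XsubC.
- by move=> z; rewrite root_prod_XsubC mem_filter => /andP[].
Qed.

Variable k : nat.
Implicit Types (A : 'M[C]_k.+1) (v : 'rV[C]_k.+1).

Lemma horner_mx_eigen A v z (p : {poly C}) :
  v *m A = z *: v -> v *m horner_mx A p = p.[z] *: v.
Proof.
move=> vA; elim/poly_ind: p => [|p c IH].
  by rewrite rmorph0 mulmx0 horner0 scale0r.
rewrite rmorphD rmorphM /= horner_mx_X horner_mx_C mulmxDr hornerMXaddC.
by rewrite mulmxA IH -scalemxAl vA scalerA mul_mx_scalar scalerDl.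
Qed.

(** [w] is the polynomial [(p (xi) - p (A)) / (xi - A)] applied to
    [v]. Its leading coefficient is a multiple of [v], whence the drop of the degree
    in the entries where [v] vanishes. *)
Lemma horner_mx_quotient A v (p : {poly C}) :
  exists w : 'rV[{poly C}]_k.+1,
    (forall xi, map_mx (horner_eval xi) w *m (xi%:M - A)
              = p.[xi] *: v - v *m horner_mx A p) /\
    (forall j, v 0 j = 0 -> (size (w 0%R j) <= (size p).-2)%N).
Proof.
elim/poly_ind: p => [|p c [w [wE ws]]].
  exists 0; split=> [xi|j _]; last by rewrite mxE size_poly0.
  rewrite horner0 scale0r rmorph0 mulmx0 subr0.
  by rewrite (_ : map_mx _ _ = 0) ?mul0mx // map_mx0.
exists ('X *: w + map_mx polyC (v *m horner_mx A p)); split=> [xi|j vj].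
  have -> : map_mx (horner_eval xi) ('X *: w + map_mx polyC (v *m horner_mx A p))
      = xi *: map_mx (horner_eval xi) w + v *m horner_mx A p.
    by apply/matrixP => i j; rewrite !mxE /horner_eval hornerD hornerM hornerX
      hornerC.
  rewrite mulmxDl -scalemxAl wE hornerMXaddC rmorphD rmorphM /= horner_mx_X.
  rewrite horner_mx_C mulmxBr mul_mx_scalar mulmxDr mul_mx_scalar mulmxA.
  rewrite scalerBr scalerA [xi * _]mulrC addrA subrK scalerDl opprD addrACA.
  by rewrite subrr addr0.
rewrite size_MXaddC !mxE; have [p0|p0] /= := eqVneq p 0.
  have w0 : w 0 j = 0.
    by apply/eqP; rewrite -size_poly_leq0 (leq_trans (ws j vj)) // p0 size_poly0.
  rewrite w0 mulr0 add0r p0 rmorph0.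
  rewrite big1 ?polyC0 ?size_poly0 // => i _; by rewrite mxE mulr0.
have [sp|sp] := leqP (size p) 1.
  have w0 : w 0 j = 0.
    apply/eqP; rewrite -size_poly_leq0 (leq_trans (ws j vj)) //.
    by move: sp; case: (size p) => [|[]].
  rewrite w0 mulr0 add0r (size1_polyC sp) horner_mx_C.
  rewrite (eq_bigr (fun i => v 0 i * (p`_0 *+ (i == j)))) => [|i _]; last first.
    by rewrite mxE.
  rewrite (bigD1 j) //= big1 => [|i /negPf ij]; last by rewrite ij mulr0.
  by rewrite vj mul0r addr0 polyC0 size_poly0.
rewrite (leq_trans (size_polyD _ _)) // geq_max; apply/andP; split.
  have [->|w0] := eqVneq (w 0 j) 0; first by rewrite mulr0 size_poly0.
  rewrite mulrC size_mulX //; move: sp (ws j vj).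
  by case: (size p) => [|[|m]].
by rewrite (leq_trans (size_polyC_leq1 _)) //; move: sp; case: (size p) => [|[|m]].
Qed.

End PolynomialTools.

Section KernelPolynomial.
Context {R : rcfType} {N : nat}.
Local Notation C := R[i].
Implicit Types (A : 'M[C]_N) (v : 'rV[C]_N) (p : {poly C}).

Lemma kermxpoly_quotient A v p : (v <= kermxpoly A p)%MS ->
  exists w : 'rV[{poly C}]_N,
    (forall xi, map_mx (horner_eval xi) w *m (xi%:M - A) = p.[xi] *: v) /\
    (forall j, v 0 j = 0 -> (size (w 0%R j) <= (size p).-2)%N).
Proof.
case: N A v => [|k] A v vp.
  by exists 0; split=> [xi|[]//]; rewrite !thinmx0.
have [w [wE ws]] := horner_mx_quotient A v p; exists w; split=> // xi.
by rewrite wE (sub_kermxP vp) subr0.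
Qed.

Lemma kermxpoly_eigen A v p z :
  (v <= kermxpoly A p)%MS -> v *m A = z *: v -> v != 0 -> root p z.
Proof.
case: N A v => [|k] A v vp vA; first by rewrite thinmx0 eqxx.
apply: contraNT => rz; have := sub_kermxP vp.
by rewrite (horner_mx_eigen p vA) => /eqP; rewrite scaler_eq0 -rootE (negPf rz).
Qed.

End KernelPolynomial.

(** * Existence of a root *)

Section RootExistence.
Context {R : rcfType} {m : nat}.
Local Notation C := R[i].
Local Notation n := m.+1.
Local Notation cj := (map_mx conjc).
Variables (a b G : 'M[C]_n).
Hypotheses (realG : real_mx G) (symG : G^T = G) (posG : pos_form G).
Hypotheses (reala : real_mx a) (syma : a^T = a) (posa : pos_form a).
Hypotheses (realb : real_mx b) (symb : b^T = b).
Hypothesis ell : forall x : R, \det (a + (2 * x%:C) *: b + x%:C ^+ 2 *: G) != 0.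

Let Gu : G \in unitmx. Proof. exact: pos_unit. Qed.

(** Acting on rows: [(u, xi u)] is an eigenvector for [xi] exactly when
    [u (a + 2 xi b + xi^2 G) = 0]. *)
Definition companion : 'M[C]_(n + n) :=
  block_mx 0 (- (a *m invmx G)) 1%:M (- (2 *: (b *m invmx G))).

Local Notation Cm := companion.

Lemma row_companion p (u w : 'M[C]_(p, n)) :
  row_mx u w *m Cm = row_mx w (- ((u *m a + 2 *: (w *m b)) *m invmx G)).
Proof.
rewrite /Cm mul_row_block mulmx0 add0r mulmx1 !mulmxN -opprD mulmxDl.
by rewrite -!scalemxAr -!scalemxAl !mulmxA.
Qed.

Lemma companion_eigen xi (u w : 'rV[C]_n) (c y : 'rV[C]_n):
  row_mx u w *m (xi%:M - Cm) = row_mx c y ->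
  w = xi *: u - c /\
  u *m (a + (2 * xi) *: b + xi ^+ 2 *: G) = c *m (2 *: b + xi *: G) + y *m G.
Proof.
rewrite mulmxBr row_companion mul_mx_scalar scale_row_mx opp_row_mx add_row_mx.
move=> /eq_row_mx[uw wy]; have wE : w = xi *: u - c by rewrite -uw subKr.
split=> //.
have -> : y *m G = xi *: (w *m G) + (u *m a + 2 *: (w *m b)).
  by rewrite -wy opprK [LHS]mulmxDl mulmxKV // -scalemxAl.
rewrite wE !mulmxDr !mulmxBl -!scalemxAr -!scalemxAl.
move: (u *m a) (u *m b) (u *m G) (c *m b) (c *m G) => X1 X2 X3 X4 X5.
by apply/matrixP => i j; rewrite !mxE; ring.
Qed.

Lemma companion_real : cj Cm = Cm.
Proof.
rewrite /Cm map_block_mx map_mx0 map_mx1 !map_mxN cjZ !map_mxM !map_invmx.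
by rewrite realG reala realb (conjc_nat R 2).
Qed.

Lemma companion_no_real_root (x : R) : ~~ root (char_poly Cm) x%:C.
Proof.
rewrite -eigenvalue_root_char; apply/negP => /eigenvalueP[v vC v0].
have : row_mx (lsubmx v) (rsubmx v) *m ((x%:C)%:M - Cm) = row_mx 0 0.
  by rewrite hsubmxK mulmxBr vC mul_mx_scalar subrr row_mx0.
case/companion_eigen=> wE; rewrite !mul0mx addr0 => uL.
have u0 : lsubmx v = 0.
  have Lu : a + (2 * x%:C) *: b + x%:C ^+ 2 *: G \in unitmx.
    by rewrite unitmxE unitfE ell.
  by rewrite -[LHS](mulmxK Lu) uL mul0mx.
by case/eqP: v0; rewrite -[v]hsubmxK wE u0 scaler0 subr0 row_mx0.
Qed.

Lemma companion_split : exists q : {poly C},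
  [/\ char_poly Cm = q * map_poly conjc q, q \is monic, size q = n.+1 &
    forall z, root q z -> 0 < cIm z].
Proof.
have [|x|q [qE qm qr]] := real_poly_split (char_poly_monic Cm).
- by rewrite map_char_poly companion_real.
- exact: companion_no_real_root.
exists q; split=> //; have := size_char_poly Cm; rewrite qE.
have q0 := monic_neq0 qm.
rewrite size_mul ?map_poly_eq0 // size_map_poly.
by move: q0; rewrite -size_poly_eq0; case: (size q) => //= t _; lia.
Qed.

(** Let [w = q (xi - Cm)^-1 (0, y)], a polynomial in [xi] because
    [q (Cm)] kills [(0, y)]. Its first block [x] solves
    [x (a + 2 xi b + xi^2 G) = q y G], and the symbol is hermitian for real [xi], so
    that [h = x hc (y G)] satisfies [q conj h = conj q h]. As [q] and its conjugate are
    coprime and the size of [h] is below that of [q], [h = 0]. At [xi = 0] this gives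
    [x a hc x = 0], hence [x = 0] and [y = 0]. *)
Lemma companion_graph (q : {poly C}) (y : 'rV[C]_n) :
  size q = n.+1 -> (forall z, root q z -> 0 < cIm z) ->
  (row_mx 0 y <= kermxpoly Cm q)%MS -> y = 0.
Proof.
move=> sq qr /kermxpoly_quotient[w [wE ws]].
pose x xi := lsubmx (map_mx (horner_eval xi) w) : 'rV[C]_n.
have xE xi : x xi *m (a + (2 * xi) *: b + xi ^+ 2 *: G) = q.[xi] *: (y *m G).
  have := wE xi; rewrite -[map_mx _ w in LHS]hsubmxK scale_row_mx.
  by case/companion_eigen=> _ ->; rewrite scaler0 mul0mx add0r scalemxAl.
(* The size of h is at most m and not m.+1, because the first block of
   (0, y) vanishes. *)
pose h : {poly C} := \sum_j w 0 (lshift n j) * (conjc ((y *m G) 0 j))%:P.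
have hE xi : h.[xi] = (x xi *m hc (y *m G)) 0 0.
  rewrite /h horner_sum mxE; apply: eq_bigr => j _.
  by rewrite hornerM hornerC !mxE.
have hs : (size h <= m)%N.
  apply: leq_trans (size_sum _ _ _) _; apply/bigmax_leqP => j _.
  have := ws (lshift n j); rewrite row_mxEl mxE sq => /(_ erefl) /= sw.
  rewrite mulrC mul_polyC; exact: leq_trans (size_scale_leq _ _) sw.
have qh : q * map_poly conjc h = map_poly conjc q * h.
  apply/eqP; rewrite -subr_eq0; apply/eqP.
  (* An identity on real points; the natural numbers are enough of them. *)
  set d := _ - _; apply: (@roots_geq_poly_eq0 _ _ (map (fun i => i%:R) (iota 0 (size d)))).
  - apply/allP => z /mapP[i _ ->]; rewrite /d rootE hornerD hornerN !hornerM.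
    have cR (p : {poly C}) : (map_poly conjc p).[i%:R] = conjc p.[i%:R].
      by rewrite -[in LHS](conjc_nat R i) horner_map.
    rewrite !cR !hE; set t : C := i%:R.
    have herm : hc (a + (2 * t) *: b + t ^+ 2 *: G) = a + (2 * t) *: b + t ^+ 2 *: G.
      have ct : conjc t = t by exact: conjc_nat.
      have c2 : conjc (2 * t) = 2 * t by rewrite rmorphM /= ct; congr (_ * _); exact: (conjc_nat R 2).
      have ct2 : conjc (t ^+ 2) = t ^+ 2 by rewrite rmorphXn /= ct.
      by rewrite !hcD !hcZ c2 ct2 /hc realG reala realb symG syma symb.
    have E1 : (x t *m (a + (2 * t) *: b + t ^+ 2 *: G) *m hc (x t)) 0 0
            = q.[t] * conjc ((x t *m hc (y *m G)) 0 0).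
      rewrite xE -scalemxAl mxE; congr (_ * _).
      have -> : y *m G *m hc (x t) = hc (x t *m hc (y *m G)) by rewrite hcM hcK.
      by rewrite !mxE.
    have E2 : conjc ((x t *m (a + (2 * t) *: b + t ^+ 2 *: G) *m hc (x t)) 0 0)
            = (x t *m (a + (2 * t) *: b + t ^+ 2 *: G) *m hc (x t)) 0 0.
      have -> : conjc ((x t *m (a + (2 * t) *: b + t ^+ 2 *: G) *m hc (x t)) 0 0)
        = hc (x t *m (a + (2 * t) *: b + t ^+ 2 *: G) *m hc (x t)) 0 0.
        by rewrite !mxE.
      by rewrite !hcM hcK herm mulmxA.
    rewrite subr_eq0 -E1 -E2 E1 rmorphM /= conjcK; exact: eqxx.
  - rewrite map_inj_uniq ?iota_uniq // => i j /eqP; rewrite eqr_nat; exact: eqP.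
  - by rewrite size_map size_iota.
have cop : coprimep q (map_poly conjc q).
  apply/Pdiv.ClosedField.coprimepP => z /qr z0; apply/negP => /eqP rz.
  have : root q (conjc z).
    by rewrite rootE -[q.[_]]conjcK -horner_map /= conjcK rz conjc0.
  by move/qr; case: (z) z0 => r s /=; lra.
have h0 : h = 0.
  apply/eqP; apply/negPn/negP => hn0.
  have : q %| map_poly conjc q * h by rewrite -qh dvdp_mulr.
  rewrite Gauss_dvdpr // gtNdvdp // sq; exact: leq_trans hs _.
have x0 : x 0 = 0.
  apply/eqP/negPn/negP => xn0.
  have : hc (x 0) != 0 by apply: contra xn0 => /eqP xn0; rewrite -[x 0]hcK xn0 /hc map_mx0 trmx0.
  move/posa; rewrite hcK; have := xE 0.
  rewrite mulr0 scale0r addr0 expr0n scale0r addr0 => ->.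
  rewrite -scalemxAl mxE.
  have -> : y *m G *m hc (x 0) = hc (x 0 *m hc (y *m G)) by rewrite hcM hcK.
  by rewrite mxE mxE -hE h0 horner0 conjc0 mulr0 ltxx.
have := xE 0; rewrite x0 mul0mx => /esym/eqP; rewrite scaler_eq0.
case/orP => [/eqP q00|/eqP yG]; last by rewrite -[y](mulmxK Gu) yG mul0mx.
by have := qr 0; rewrite rootE q00 eqxx => /(_ isT); rewrite /= ltxx.
Qed.

(** The kernel of [q (Cm)] has half the dimension, since conjugation
    exchanges it with the kernel of [conj q (Cm)]. By [companion_graph] it is the
    graph of a matrix [Y] over the first block, and its stability is the
    equation for [Y]. *)
Lemma companion_solvent : exists Y : 'M[C]_n,
  a + 2 *: (Y *m b) + Y *m Y *m G = 0 /\ upper_spectrum Y.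
Proof.
have [q [qE qm sq qr]] := companion_split.
pose Ep := kermxpoly Cm q.
have cop : coprimep q (map_poly conjc q).
  apply/Pdiv.ClosedField.coprimepP => z /qr z0; apply/negP => /eqP rz.
  have : root q (conjc z).
    by rewrite rootE -[q.[_]]conjcK -horner_map /= conjcK rz conjc0.
  by move/qr; case: (z) z0 => r s /=; lra.
have rEp : (\rank Ep + \rank Ep = n + n)%N.
  have E2 : map_mx conjc Ep = kermxpoly Cm (map_poly conjc q).
    by rewrite map_kermxpoly companion_real.
  rewrite -[X in (_ + X)%N](mxrank_map conjc) E2.
  rewrite -mxrank_disjoint_sum; last exact: mxdirect_kermxpoly.
  rewrite -(kermxpolyM _ cop) -qE kermxpoly_min ?mxrank1 //.
  exact: mxminpoly_dvd_char.
have {}rEp : \rank Ep = n by lia.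
have stab : stablemx Ep Cm by exact: comm_mx_stable_kermxpoly.
pose P1 := lsubmx Ep; pose P2 := rsubmx Ep.
have EpE : Ep = row_mx P1 P2 by rewrite hsubmxK.
have ker12 : (kermx P1 <= kermx Ep)%MS.
  apply/rV_subP => v /sub_kermxP v1; apply/sub_kermxP.
  rewrite EpE mul_mx_row v1.
  rewrite (companion_graph sq qr (y := v *m P2)) ?row_mx0 //.
  by rewrite -v1 -mul_mx_row -EpE submxMl.
have rP1 : row_full P1.
  have := mxrankS ker12; rewrite (mxrank_ker P1) (mxrank_ker Ep) rEp /row_full => h.
  have := rank_leq_col P1; have := rank_leq_row P1; lia.
have /row_fullP[B BP1] := rP1.
pose Y := B *m P2; exists Y.
have KE : row_mx 1%:M Y = B *m Ep by rewrite EpE mul_mx_row BP1.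
have KEp : (row_mx 1%:M Y <= Ep)%MS by rewrite KE submxMl.
have solv : a + 2 *: (Y *m b) + Y *m Y *m G = 0.
  set Z := LHS.
  suff /(congr1 (mulmx^~ G)) : - (Z *m invmx G) = 0.
    by rewrite mulNmx mulmxKV // mul0mx => /eqP; rewrite oppr_eq0 => /eqP.
  apply/row_matrixP => i; rewrite row0; apply: (companion_graph sq qr).
  have -> : row_mx 0 (row i (- (Z *m invmx G)))
      = row i (row_mx 1%:M Y *m Cm - Y *m row_mx 1%:M Y).
    rewrite row_companion mul_mx_row mulmx1 opp_row_mx add_row_mx subrr.
    rewrite row_row_mx row0; congr (row_mx _ (row _ _)).
    by rewrite mul1mx -opprD [Z *m _]mulmxDl mulmxK.
  apply: submx_trans (row_sub _ _) _; apply: addmx_sub.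
    exact: submx_trans (submxMr _ KEp) stab.
  by rewrite eqmx_opp (submx_trans (submxMl _ _)).
split=> // z /eigenvalueP[w wY w0]; apply: qr.
apply: (@kermxpoly_eigen _ _ Cm (w *m row_mx 1%:M Y)).
- exact: submx_trans (submxMl _ _) KEp.
- rewrite -mulmxA row_companion mul1mx.
  have -> : a + 2 *: (Y *m b) = - (Y *m Y *m G).
    by apply/eqP; rewrite -addr_eq0 solv.
  rewrite mulNmx opprK mulmxK ?Gu // !mul_mx_row mulmx1 (mulmxA w Y Y) wY scale_row_mx.
  by rewrite -scalemxAl wY.
- apply: contra w0 => /eqP; rewrite mul_mx_row mulmx1 -(@row_mx0 _ 1 n n).
  by case/eq_row_mx=> ->.
Qed.

(** The transpose of the solvent is a candidate [V]. Then
    [X = G V + hc V G + 2 b] is hermitian with [hc V X = X V], and it vanishes by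
    [sylvester_eq0], the spectra of [V] and [hc V] being disjoint. *)
Theorem root_exists : exists V, root_of a b G V.
Proof.
have [Y [solv upY]] := companion_solvent.
pose V := Y^T.
have upV : upper_spectrum V by move=> z; rewrite eigenvalueT; exact: upY.
have solvV : G *m V *m V + 2 *: (b *m V) + a = 0.
  have := congr1 trmx solv; rewrite !linearD /= linearZ /= !trmx_mul.
  by rewrite symG symb syma trmx0 -/V mulmxA => <-; rewrite addrC addrA addrAC.
have hG : hc G = G by rewrite /hc realG symG.
have ha : hc a = a by rewrite /hc reala syma.
have hb : hc b = b by rewrite /hc realb symb.
pose X := G *m V + hc V *m G + 2 *: b.
have XV : X *m V = hc V *m G *m V - a.
  have -> : a = - (G *m V *m V + 2 *: (b *m V)).
    by apply/eqP; rewrite -addr_eq0 addrC solvV.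
  rewrite /X !mulmxDl -scalemxAl.
  move: (G *m V *m V) (hc V *m G *m V) (b *m V) => X1 X2 X3.
  by apply/matrixP => i j; rewrite !mxE; ring.
have hX : hc X = X.
  rewrite /X !hcD !hcM hcZ hcK hG hb (conjc_nat R 2); congr (_ + _).
  exact: addrC.
have X0 : X = 0.
  apply: (@sylvester_eq0 _ _ _ (hc V) V).
    by rewrite -{1}hX -hcM XV hcB !hcM hcK hG ha mulmxA.
  move=> z zV; apply/negP; rewrite eigenvalue_hc => /upV.
  by have := upV _ zV; case: (z) => r s /=; lra.
exists V; split=> //.
- by apply/eqP; rewrite -addr_eq0; apply/eqP.
- by apply/eqP; rewrite -subr_eq0 -XV X0 mul0mx.
Qed.

End RootExistence.

(** * Integrals over a growing segment that depend on a parameter *)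

Section RectangleTransport.
Context {R : realType}.
Notation mu := (@lebesgue_measure R).
Implicit Types (f g h : R -> R -> R).

(** This bound and [segment_integrable] are the hypotheses under which
    one differentiates under the integral sign in [rectangle_transport]. *)
Lemma bounded_on_rectangle (G : R * R -> R) (a b c d : R) : continuous G ->
  exists2 M, 0 <= M &
    forall x y, a <= x <= b -> c <= y <= d -> `|G (x, y)| <= M.
Proof.
move=> cG.
have cK : compact (`[a, b]%classic `*` `[c, d]%classic : set (R * R)).
  by apply: compact_setX; exact: segment_compact.
have : compact (G @` (`[a, b]%classic `*` `[c, d]%classic)).
  by apply: continuous_compact => //; apply: continuous_subspaceT.
move/compact_bounded => [M [_ HM]].
exists (Num.max 0 (M + 1)); first by rewrite le_max lexx.
move=> x y xab ycd; rewrite le_max; apply/orP; right.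
apply: (HM (M + 1)); first by rewrite ltrDl.
by exists (x, y) => //=; split => /=; rewrite in_itv.
Qed.

Lemma derivable_continuous_R (f df : R -> R) :
  (forall x : R, is_derive x 1 f (df x)) -> continuous f.
Proof.
by move=> fd x; apply/differentiable_continuous/derivable1_diffP; case: (fd x).
Qed.

Lemma slice_continuous (G : R * R -> R) x : continuous G ->
  continuous (fun y => G (x, y)).
Proof.
move=> cG y; apply: (@continuous_comp _ _ _ (fun y => (x, y)) G); last exact: cG.
exact: (@cvg_pair _ _ _ (nbhs y) (nbhs x) (nbhs y) _ _ _ (fun=> x) id
  (cvg_cst x) cvg_id).
Qed.

Lemma segment_integrable (f : R -> R) a b : continuous f ->
  mu.-integrable `[a, b] (EFin \o f).
Proof.
move=> cf; apply: continuous_compact_integrable; first exact: segment_compact.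
exact: continuous_subspaceT.
Qed.

(** Green's formula on a rectangle: the field is closed, so the integrals
    of [f] over the two sides [t = t0] and [t = t1] differ by the flux of [h] through the
    other two. *)
Lemma rectangle_transport f g h :
  (forall t o : R, is_derive t 1 (fun t' => f t' o) (g t o)) ->
  (forall t o : R, is_derive o 1 (h t) (g t o)) ->
  continuous (fun z : R * R => f z.1 z.2) ->
  continuous (fun z : R * R => g z.1 z.2) ->
  forall t0 t1 L B : R, t0 < t1 -> 0 < L ->
  (forall t, t0 <= t <= t1 -> `|h t L| <= B /\ `|h t (- L)| <= B) ->
  `| \int[mu]_(o in `[- L, L]) f t1 o - \int[mu]_(o in `[- L, L]) f t0 o |
     <= 2 * B * (t1 - t0).
Proof.
move=> fd hd cf cg t0 t1 L B t01 L0 hB.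
pose F t := \int[mu]_(o in `[- L, L]) f t o.
have cfs t : continuous (f t) by exact: (slice_continuous (G := fun z => f z.1 z.2)).
have cgs t : continuous (g t) by exact: (slice_continuous (G := fun z => g z.1 z.2)).
have FTC t : \int[mu]_(o in `[- L, L]) g t o = h t L - h t (- L).
  have LL : - L < L by lra.
  have ch : continuous (h t) by apply: derivable_continuous_R; exact: hd.
  rewrite /Rintegral (@continuous_FTC2 _ (g t) (h t)) //.
  - exact: continuous_subspaceT.
  - split.
    + by move=> x _; case: (hd t x).
    + by apply: cvg_at_right_filter; exact: ch.
    + by apply: cvg_at_left_filter; exact: ch.
  - by move=> x _; rewrite derive1E; case: (hd t x).
have Fd (t : R) : is_derive t 1 F (h t L - h t (- L)).
  have [M M0 HM] := bounded_on_rectangle (t - 1) (t + 1) (- L) L cg.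
  have It : `]t - 1, t + 1[%classic t by rewrite /= in_itv /=; lra.
  have d1 x y : partial1of2 f x y = g x y.
    by rewrite partial1of2E; case: (fd x y).
  have intf (x : R) : `]t - 1, t + 1[%classic x ->
      mu.-integrable `[- L, L]%classic (EFin \o f x).
    by move=> _; exact: segment_integrable.
  have derf (x y : R) : `]t - 1, t + 1[%classic x -> `[- L, L]%classic y ->
      derivable (f ^~ y) x 1 by move=> _ _; case: (fd x y).
  have G0 y : 0 <= (fun _ : R => M) y by [].
  have intG : mu.-integrable `[- L, L]%classic (EFin \o (fun _ : R => M)).
    by apply: segment_integrable => ?; exact: cvg_cst.
  have Gub (x y : R) : `]t - 1, t + 1[%classic x -> `[- L, L]%classic y ->
      `|partial1of2 f x y| <= (fun _ : R => M) y.
    rewrite /= !in_itv /= d1 => xI yI; apply: HM => //.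
    by case/andP: xI => x1 x2; apply/andP; split; exact: ltW.
  apply: DeriveDef.
    have := @derivable_under_integral R _ _ mu f `[- L, L] _ t (t - 1) (t + 1)
      It intf derf (fun=> M) G0 intG Gub.
    by apply; exact: measurable_itv.
  rewrite -derive1E.
  rewrite (@differentiation_under_integral R _ _ mu f `[- L, L] _ t (t - 1) (t + 1)
    It intf derf (fun=> M) G0 intG Gub); last exact: measurable_itv.
  rewrite -FTC; apply: eq_Rintegral => y _; exact: d1.
have cF : continuous F by exact: derivable_continuous_R Fd.
have Fd' (x : R) : x \in `]t0, t1[ -> is_derive x 1 F (h x L - h x (- L)).
  by move=> ?; exact: Fd.
have [c cI ->] := MVT t01 Fd' (continuous_subspaceT cF).
rewrite normrM (gtr0_norm (x := t1 - t0)) ?subr_gt0 //.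
rewrite ler_pM2r ?subr_gt0 //.
have [|h1 h2] := hB c; first by move: cI; rewrite in_itv /= => /andP[? ?]; lra.
by rewrite (le_trans (ler_normB _ _)) //; lra.
Qed.

End RectangleTransport.

(** * Calculus of complex and matrix functions of a real variable *)

Section FunctionAlgebras.
Context {R : realType} {T : Type}.
Local Notation C := R[i].

(** Continuous functions and differentiable functions both form such a class.
    Membership of determinants and inverses of matrix functions needs only these
    closure properties, by the formulas of Leibniz and Cramer. *)
Record fun_algebra (P : (T -> C) -> Prop) : Prop := FunAlgebra {
  fa_cst : forall c, P (fun=> c);
  fa_add : forall f g, P f -> P g -> P (fun t => f t + g t);
  fa_mul : forall f g, P f -> P g -> P (fun t => f t * g t);
  fa_inv : forall f, P f -> (forall t, f t != 0) -> P (fun t => (f t)^-1) }.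

Variables (P : (T -> C) -> Prop) (aP : fun_algebra P).

Definition mx_in m n (F : T -> 'M[C]_(m, n)) := forall i j, P (fun t => F t i j).

Lemma fa_ext f g : f =1 g -> P f -> P g.
Proof. by move=> /funext ->. Qed.

Lemma fa_sum (I : Type) (r : seq I) (Q : pred I) (F : I -> T -> C) :
  (forall i, P (F i)) -> P (fun t => \sum_(i <- r | Q i) F i t).
Proof.
move=> PF; elim: r => [|i r IH].
  by apply: fa_ext (fa_cst aP 0) => t; rewrite big_nil.
have [Qi|Qi] := boolP (Q i).
  by apply: fa_ext (fa_add aP (PF i) IH) => t; rewrite big_cons Qi.
by apply: fa_ext IH => t; rewrite big_cons (negPf Qi).
Qed.

Lemma fa_prod (I : Type) (r : seq I) (Q : pred I) (F : I -> T -> C) :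
  (forall i, P (F i)) -> P (fun t => \prod_(i <- r | Q i) F i t).
Proof.
move=> PF; elim: r => [|i r IH].
  by apply: fa_ext (fa_cst aP 1) => t; rewrite big_nil.
have [Qi|Qi] := boolP (Q i).
  by apply: fa_ext (fa_mul aP (PF i) IH) => t; rewrite big_cons Qi.
by apply: fa_ext IH => t; rewrite big_cons (negPf Qi).
Qed.

Lemma mx_in_cst m n (M : 'M[C]_(m, n)) : mx_in (fun=> M).
Proof. by move=> i j; exact: fa_cst. Qed.

Lemma mx_inD m n (F G : T -> 'M[C]_(m, n)) :
  mx_in F -> mx_in G -> mx_in (fun t => F t + G t).
Proof.
by move=> PF PG i j; apply: fa_ext (fa_add aP (PF i j) (PG i j)) => t; rewrite mxE.
Qed.

Lemma mx_inZ m n (f : T -> C) (F : T -> 'M[C]_(m, n)) :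
  P f -> mx_in F -> mx_in (fun t => f t *: F t).
Proof.
by move=> Pf PF i j; apply: fa_ext (fa_mul aP Pf (PF i j)) => t; rewrite mxE.
Qed.

Lemma mx_inB m n (F G : T -> 'M[C]_(m, n)) :
  mx_in F -> mx_in G -> mx_in (fun t => F t - G t).
Proof.
move=> PF PG; have := mx_inD PF (mx_inZ (fa_cst aP (- 1)) PG).
by congr mx_in; apply/funext => t; rewrite scaleN1r.
Qed.

Lemma mx_inM m n p (F : T -> 'M[C]_(m, n)) (G : T -> 'M[C]_(n, p)) :
  mx_in F -> mx_in G -> mx_in (fun t => F t *m G t).
Proof.
move=> PF PG i j; apply: (@fa_ext (fun t => \sum_k F t i k * G t k j)).
  by move=> t; rewrite mxE.
by apply: fa_sum => k; exact: fa_mul.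
Qed.

Lemma mx_in_det n (F : T -> 'M[C]_n) : mx_in F -> P (fun t => \det (F t)).
Proof.
move=> PF; rewrite /determinant; apply: fa_sum => s.
by apply: (fa_mul aP (fa_cst aP _)); exact: fa_prod.
Qed.

Lemma mx_in_inv n (F : T -> 'M[C]_n) : mx_in F ->
  (forall t, F t \in unitmx) -> mx_in (fun t => invmx (F t)).
Proof.
move=> PF uF i j.
apply: (@fa_ext (fun t => (\det (F t))^-1 * ((-1) ^+ (j + i) *
   \det (row' j (col' i (F t)))))).
  by move=> t; rewrite /invmx uF !mxE.
apply: (fa_mul aP).
  apply: (fa_inv aP); first exact: mx_in_det.
  by move=> t; rewrite -unitfE -unitmxE.
apply: (fa_mul aP (fa_cst aP _)); apply: mx_in_det => i' j'.
by apply: fa_ext (PF (lift j i') (lift i j')) => t; rewrite !mxE.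
Qed.

End FunctionAlgebras.

Section ComplexCalculus.
Context {R : realType}.
Local Notation C := R[i].

Definition ccont {T : topologicalType} (f : T -> C) : Prop :=
  continuous (fun t => complex.Re (f t)) /\ continuous (fun t => complex.Im (f t)).

Lemma cReM (a b : C) : complex.Re (a * b) = complex.Re a * complex.Re b - complex.Im a * complex.Im b.
Proof. by case: a b => [? ?] [? ?]. Qed.
Lemma cImM (a b : C) : complex.Im (a * b) = complex.Re a * complex.Im b + complex.Im a * complex.Re b.
Proof. by case: a b => [? ?] [? ?]. Qed.
Lemma cReD (a b : C) : complex.Re (a + b) = complex.Re a + complex.Re b.
Proof. by case: a b => [? ?] [? ?]. Qed.
Lemma cImD (a b : C) : complex.Im (a + b) = complex.Im a + complex.Im b.
Proof. by case: a b => [? ?] [? ?]. Qed.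
Lemma cReV (a : C) : complex.Re (a^-1) =
  complex.Re a / (complex.Re a * complex.Re a + complex.Im a * complex.Im a).
Proof. by case: a => [? ?] /=; rewrite !expr2. Qed.
Lemma cImV (a : C) : complex.Im (a^-1) =
  - complex.Im a / (complex.Re a * complex.Re a + complex.Im a * complex.Im a).
Proof. by case: a => [? ?] /=; rewrite !expr2 mulNr. Qed.
Lemma sqr_nz (a : C) : a != 0 ->
  complex.Re a * complex.Re a + complex.Im a * complex.Im a != 0.
Proof.
case: a => x y /=; rewrite eq_complex /=; apply: contra.
by rewrite -!expr2 paddr_eq0 ?sqr_ge0 // !sqrf_eq0.
Qed.

Lemma ccont_algebra (T : topologicalType) : fun_algebra (@ccont T).
Proof.
split=> [c|f g [f1 f2] [g1 g2]|f g [f1 f2] [g1 g2]|f [f1 f2] f0].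
- by split=> ?; exact: cvg_cst.
- split; under eq_fun do rewrite ?cReD ?cImD; move=> t; apply: cvgD;
  by [exact: f1|exact: g1|exact: f2|exact: g2].
- split; under eq_fun do rewrite ?cReM ?cImM; move=> t.
  + by apply: cvgB; apply: cvgM; by [exact: f1|exact: g1|exact: f2|exact: g2].
  + by apply: cvgD; apply: cvgM; by [exact: f1|exact: g1|exact: f2|exact: g2].
- have c2 : continuous (fun t => (complex.Re (f t) * complex.Re (f t)
      + complex.Im (f t) * complex.Im (f t))^-1).
    move=> t; apply: cvgV; first exact: sqr_nz.
    by apply: cvgD; apply: cvgM; by [exact: f1|exact: f2].
  split; under eq_fun do rewrite ?cReV ?cImV; move=> t; apply: cvgM; try exact: c2.
  + exact: f1.
  + by apply: cvgN; exact: f2.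
Qed.

Definition cderiv (f : R -> C) (t : R) d : Prop :=
  is_derive t 1 (fun s : R => complex.Re (f s)) (complex.Re d) /\
  is_derive t 1 (fun s : R => complex.Im (f s)) (complex.Im d).

Lemma deriv_add (f g : R -> R) (t a b : R) : is_derive t 1 f a ->
  is_derive t 1 g b -> is_derive t 1 (fun s => f s + g s) (a + b).
Proof. by move=> fa gb; exact: (is_deriveD fa gb). Qed.

Lemma deriv_sub (f g : R -> R) (t a b : R) : is_derive t 1 f a ->
  is_derive t 1 g b -> is_derive t 1 (fun s => f s - g s) (a - b).
Proof. by move=> fa gb; exact: (is_deriveB fa gb). Qed.

Lemma deriv_mul (f g : R -> R) (t a b : R) : is_derive t 1 f a ->
  is_derive t 1 g b -> is_derive t 1 (fun s => f s * g s) (a * g t + f t * b).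
Proof.
move=> fa gb; apply: (is_derive_eq (is_deriveM fa gb)).
by rewrite /GRing.scale /= addrC mulrC.
Qed.

Lemma cderiv_cst c t : cderiv (fun=> c) t 0.
Proof. by split; exact: is_derive_cst. Qed.

Lemma cderivD f g t d e : cderiv f t d -> cderiv g t e ->
  cderiv (fun s => f s + g s) t (d + e).
Proof.
move=> [f1 f2] [g1 g2]; split; under eq_fun do rewrite ?cReD ?cImD.
  by rewrite cReD; exact: is_deriveD.
by rewrite cImD; exact: is_deriveD.
Qed.

Lemma cderivM f g t d e : cderiv f t d -> cderiv g t e ->
  cderiv (fun s => f s * g s) t (d * g t + f t * e).
Proof.
move=> [f1 f2] [g1 g2]; split; under eq_fun do rewrite ?cReM ?cImM.
  apply: (is_derive_eq (deriv_sub (deriv_mul f1 g1) (deriv_mul f2 g2))).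
  by rewrite cReD !cReM; ring.
apply: (is_derive_eq (deriv_add (deriv_mul f1 g2) (deriv_mul f2 g1))).
by rewrite cImD !cImM; ring.
Qed.

Lemma cderiv_inv f t d : cderiv f t d -> f t != 0 ->
  exists e, cderiv (fun s => (f s)^-1) t e.
Proof.
move=> [f1 f2] f0.
have q := is_deriveV (f := fun s => complex.Re (f s) * complex.Re (f s) +
  complex.Im (f s) * complex.Im (f s)) (sqr_nz f0)
  (deriv_add (deriv_mul f1 f1) (deriv_mul f2 f2)).
have a := deriv_mul f1 q; have b := deriv_mul (is_deriveN f2) q.
eexists (Complex _ _); split => /=; under eq_fun do rewrite ?cReV ?cImV.
- exact: a.
- exact: b.
Qed.

Definition cdiff (f : R -> C) : Prop := exists d : R -> C, forall t, cderiv f t (d t).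

Lemma cdiff_algebra : fun_algebra cdiff.
Proof.
split=> [c|f g [d fd] [e ge]|f g [d fd] [e ge]|f [d fd] f0].
- by exists (fun=> 0) => t; exact: cderiv_cst.
- by exists (fun t => d t + e t) => t; exact: cderivD.
- by exists (fun t => d t * g t + f t * e t) => t; exact: cderivM.
- have /choice[e ge] : forall t, exists e, cderiv (fun s => (f s)^-1) t e.
    by move=> t; exact: cderiv_inv (fd t) (f0 t).
  by exists e.
Qed.

Lemma cderiv_unique f t d e : cderiv f t d -> cderiv f t e -> d = e.
Proof.
move=> [[_ f1] [_ f2]] [[_ g1] [_ g2]]; apply/eqP; rewrite eq_complex.
by rewrite -f1 -f2 g1 g2 !eqxx.
Qed.

Lemma cdiff_ccont f : cdiff f -> ccont f.
Proof.
move=> [d fd]; split.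
  by apply: (@derivable_continuous_R _ _ (fun t => complex.Re (d t))) => t; case: (fd t).
by apply: (@derivable_continuous_R _ _ (fun t => complex.Im (d t))) => t; case: (fd t).
Qed.

Lemma cderiv_real (f : R -> R) (t d : R) : is_derive t 1 f d ->
  cderiv (fun s => (f s)%:C) t d%:C.
Proof. by move=> fd; split => //=; exact: is_derive_cst. Qed.

Lemma cderiv_conj f t d : cderiv f t d -> cderiv (fun s => conjc (f s)) t (conjc d).
Proof.
move=> [f1 f2]; split.
  by under eq_fun => s do [rewrite (_ : complex.Re (conjc (f s)) = complex.Re (f s));
    last by case: (f s)]; case: d f1 f2.
under eq_fun => s do [rewrite (_ : complex.Im (conjc (f s)) = - complex.Im (f s));
  last by case: (f s)].
have := is_deriveN f2; by case: d f1 f2.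
Qed.

Lemma cderiv_comp (f : R -> C) (z : R -> R) (t : R) d (dz : R) :
  cderiv f (z t) d -> is_derive t 1 z dz -> cderiv (fun s => f (z s)) t (dz%:C * d).
Proof.
move=> [f1 f2] zd; split.
  have -> : complex.Re (dz%:C * d) = complex.Re d * dz by case: (d) => ? ? /=; ring.
  exact: (@is_derive1_comp _ (fun s => complex.Re (f s)) z).
have -> : complex.Im (dz%:C * d) = complex.Im d * dz by case: (d) => ? ? /=; ring.
exact: (@is_derive1_comp _ (fun s => complex.Im (f s)) z).
Qed.

Definition mderiv m n (F : R -> 'M[C]_(m, n)) (t : R) (D : 'M[C]_(m, n)) : Prop :=
  forall i j, cderiv (fun s => F s i j) t (D i j).

Lemma mderiv_cst m n (M : 'M[C]_(m, n)) t : mderiv (fun=> M) t 0.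
Proof. by move=> i j; rewrite mxE; exact: cderiv_cst. Qed.

Lemma mderivD m n (F G : R -> 'M[C]_(m, n)) t D E :
  mderiv F t D -> mderiv G t E -> mderiv (fun s => F s + G s) t (D + E).
Proof.
move=> FD GE i j; rewrite mxE; under eq_fun do rewrite mxE.
exact: cderivD (FD i j) (GE i j).
Qed.

Lemma cderiv_sum (I : Type) (r : seq I) (F : I -> R -> C) (D : I -> C) t :
  (forall i, cderiv (F i) t (D i)) ->
  cderiv (fun s => \sum_(i <- r) F i s) t (\sum_(i <- r) D i).
Proof.
move=> FD; elim: r => [|i r IH].
  by rewrite big_nil; under eq_fun do rewrite big_nil; exact: cderiv_cst.
rewrite big_cons; under eq_fun do rewrite big_cons.
exact: cderivD (FD i) IH.
Qed.

Lemma mderivM m n p (F : R -> 'M[C]_(m, n)) (G : R -> 'M[C]_(n, p)) t D E :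
  mderiv F t D -> mderiv G t E ->
  mderiv (fun s => F s *m G s) t (D *m G t + F t *m E).
Proof.
move=> FD GE i j; rewrite !mxE -big_split /=; under eq_fun do rewrite mxE.
by apply: cderiv_sum => k; exact: cderivM (FD i k) (GE k j).
Qed.

Lemma mderivZ m n f (F : R -> 'M[C]_(m, n)) t d D :
  cderiv f t d -> mderiv F t D ->
  mderiv (fun s => f s *: F s) t (d *: F t + f t *: D).
Proof.
move=> fd FD i j; rewrite !mxE; under eq_fun do rewrite mxE.
exact: cderivM fd (FD i j).
Qed.

Lemma mderiv_comp m n (F : R -> 'M[C]_(m, n)) (z : R -> R) (t : R) D (dz : R) :
  mderiv F (z t) D -> is_derive t 1 z dz ->
  mderiv (fun s => F (z s)) t (dz%:C *: D).
Proof. by move=> FD zd i j; rewrite mxE; exact: cderiv_comp (FD i j) zd. Qed.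

Lemma mderiv_hc m n (F : R -> 'M[C]_(m, n)) t D :
  mderiv F t D -> mderiv (fun s => hc (F s)) t (hc D).
Proof.
move=> FD i j; rewrite !mxE; under eq_fun do rewrite !mxE.
exact: cderiv_conj (FD j i).
Qed.

Lemma mderiv_unique m n (F : R -> 'M[C]_(m, n)) t D E :
  mderiv F t D -> mderiv F t E -> D = E.
Proof.
by move=> FD FE; apply/matrixP => i j; exact: cderiv_unique (FD i j) (FE i j).
Qed.

Lemma mderiv_eq m n (F : R -> 'M[C]_(m, n)) t D E :
  mderiv F t D -> D = E -> mderiv F t E.
Proof. by move=> FD <-. Qed.

Lemma mderiv_mx_in m n (F D : R -> 'M[C]_(m, n)) :
  (forall t, mderiv F t (D t)) -> mx_in cdiff F.
Proof. by move=> FD i j; exists (fun t => D t i j) => t; exact: FD. Qed.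

(** Differentiability comes from Cramer's formula; the value is then
    forced by [F F^-1 = 1]. *)
Lemma mderiv_inv n (F D : R -> 'M[C]_n) : (forall t, mderiv F t (D t)) ->
  (forall t, F t \in unitmx) ->
  forall t, mderiv (fun s => invmx (F s)) t (- (invmx (F t) *m D t *m invmx (F t))).
Proof.
move=> FD uF t.
have /(_ _ _)/cid PI := mx_in_inv cdiff_algebra (mderiv_mx_in FD) uF.
pose E t := \matrix_(i, j) (sval (PI i j) t).
have IE s : mderiv (fun s => invmx (F s)) s (E s).
  by move=> i j; rewrite mxE; exact: (svalP (PI i j) s).
have := mderivM (FD t) (IE t).
have -> : (fun s => F s *m invmx (F s)) = (fun=> 1%:M).
  by apply/funext => s; rewrite mulmxV.
move/(mderiv_unique (mderiv_cst _ _))/eqP; rewrite eq_sym addrC addr_eq0 => /eqP DE.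
apply: mderiv_eq (IE t) _; rewrite -[LHS](mulKmx (uF t)) DE mulmxN mulmxA //.
Qed.

End ComplexCalculus.

(** * Deformation of truncated Mellin integrals *)

Section MellinTransport.
Context {R : realType} {l : nat}.
Local Notation C := R[i].
Notation mu := (@lebesgue_measure R).

Lemma comm_invmx (M A : 'M[C]_l) : M *m A = A *m M ->
  M *m invmx A = invmx A *m M.
Proof.
move=> MA; have [uA|nA] := boolP (A \in unitmx); last by rewrite /invmx (negPf nA).
by rewrite -[LHS](mulKmx uA) (mulmxA A) -MA -!mulmxA mulmxV // mulmx1.
Qed.

Lemma ccont_comp (S T : topologicalType) (f : T -> C) (p : S -> T) :
  ccont f -> continuous p -> ccont (fun z => f (p z)).
Proof.
move=> [f1 f2] cp; split=> z.
  exact: (continuous_comp (cp z) (f1 (p z))).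
exact: (continuous_comp (cp z) (f2 (p z))).
Qed.

Lemma fst_continuous : continuous (@fst R R).
Proof. by move=> z; exact: cvg_fst. Qed.
Lemma snd_continuous : continuous (@snd R R).
Proof. by move=> z; exact: cvg_snd. Qed.

Definition cint (L : R) (f : R -> C) : C :=
  Complex (\int[mu]_(o in `[- L, L]) complex.Re (f o))
          (\int[mu]_(o in `[- L, L]) complex.Im (f o)).

(** Agreement up to O(1/L) as the length [L] of the truncated integrals grows. *)
Definition asym (F G : R -> C) : Prop :=
  exists2 M, 0 <= M & forall L, 0 < L ->
    `|complex.Re (F L) - complex.Re (G L)| <= M / L /\
    `|complex.Im (F L) - complex.Im (G L)| <= M / L.

Lemma ccont_bounded (F : R * R -> C) (a b c d : R) : ccont F ->
  exists2 M, 0 <= M & forall u v, a <= u <= b -> c <= v <= d ->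
    `|complex.Re (F (u, v))| <= M /\ `|complex.Im (F (u, v))| <= M.
Proof.
move=> [F1 F2]; have [M1 M10 H1] := bounded_on_rectangle a b c d F1.
have [M2 M20 H2] := bounded_on_rectangle a b c d F2.
exists (M1 + M2); first exact: addr_ge0.
move=> u v uab vcd; split.
  by rewrite (le_trans (H1 u v uab vcd)) // lerDl.
by rewrite (le_trans (H2 u v uab vcd)) // lerDr.
Qed.

Lemma expR_Nle (a L : R) : 0 < a -> 0 < L -> expR (- (a * L)) <= a^-1 / L.
Proof.
move=> a0 L0; rewrite expRN -invfM lef_pV2 ?posrE ?expR_gt0 ?mulr_gt0 //.
by rewrite (le_trans _ (expR_ge1Dx _)) // lerDr.
Qed.

Variables (W K X1 Y1 : R -> 'M[C]_l) (x : R -> 'rV[C]_l) (y : R -> 'cV[C]_l).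
Variable s : R.
Hypothesis dW : forall t, mderiv W t (K t *m W t).
Hypothesis dx : forall t, mderiv x t (x t *m X1 t).
Hypothesis dy : forall t, mderiv y t (Y1 t *m y t).
Hypothesis cK : mx_in ccont K.
Hypothesis KW : forall t, K t *m W t = W t *m K t.
Hypothesis YW : forall t, Y1 t *m W t = W t *m Y1 t.
Hypothesis XY : forall t, X1 t + Y1 t = s%:C *: K t.
Hypothesis uW : forall t (u : R), 0 <= u -> (u%:C)%:M + W t \in unitmx.
Hypothesis s01 : 0 < s < 1.

Definition resolvent (M : 'M[C]_l) (o : R) : 'M[C]_l := invmx (((expR o)%:C)%:M + M).
(** The integrand of [t^-s u (t + M)^-1 v dt] in the variable [o = log t].
    Its integral over the line is a multiple of [u M^-s v]. *)
Definition mellin_kernel (M : 'M[C]_l) (u : 'rV[C]_l) (v : 'cV[C]_l) (o : R) : C :=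
  (expR ((1 - s) * o))%:C * (u *m resolvent M o *m v) 0 0.

Let Res t o := resolvent (W t) o.
Let rho t o := mellin_kernel (W t) (x t) (y t) o.
Let kap t o := (expR ((1 - s) * o))%:C * (x t *m K t *m Res t o *m y t) 0 0.
Let gg t o := (expR ((1 - s) * o))%:C *
  (x t *m K t *m (s%:C *: Res t o - W t *m Res t o *m Res t o) *m y t) 0 0.

Let comm_shift (M : 'M[C]_l) c t : M *m W t = W t *m M ->
  M *m (c%:M + W t) = (c%:M + W t) *m M.
Proof. by move=> MW; rewrite mulmxDr mulmxDl MW mul_mx_scalar mul_scalar_mx. Qed.

Let KRes t o : K t *m Res t o = Res t o *m K t.
Proof. by apply: comm_invmx; exact: comm_shift. Qed.
Let YRes t o : Y1 t *m Res t o = Res t o *m Y1 t.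
Proof. by apply: comm_invmx; exact: comm_shift. Qed.
Let WRes t o : W t *m Res t o = Res t o *m W t.
Proof. by apply: comm_invmx; exact: comm_shift. Qed.

Let uRes t o : ((expR o)%:C)%:M + W t \in unitmx.
Proof. by apply: uW; exact: expR_ge0. Qed.

Let expRes t o : (expR o)%:C *: Res t o = 1%:M - W t *m Res t o.
Proof.
have := mulmxV (uRes t o); rewrite mulmxDl mul_scalar_mx => <-.
by rewrite addrK.
Qed.

Lemma mderivN m n (F : R -> 'M[C]_(m, n)) t D :
  mderiv F t D -> mderiv (fun s => - F s) t (- D).
Proof.
move=> FD; have := mderivM FD (mderiv_cst (- 1%:M) t).
rewrite mulmx0 addr0 mulmxN mulmx1; congr (mderiv _ _ _).
by apply/funext => z; rewrite mulmxN mulmx1.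
Qed.

Let dRes o t : mderiv (fun t => Res t o) t (- (K t *m W t *m Res t o *m Res t o)).
Proof.
have dA z : mderiv (fun t => ((expR o)%:C)%:M + W t) z (K z *m W z).
  by rewrite -[_ *m _]add0r; apply: mderivD; [exact: mderiv_cst|exact: dW].
apply: mderiv_eq (mderiv_inv dA (fun z => uRes z o) t) _.
by rewrite -/(resolvent _ _) -/(Res t o) mulmxA -KRes -(mulmxA (K t) (Res t o)) -WRes !mulmxA.
Qed.

Let rho_deriv t o : cderiv (fun t => rho t o) t (gg t o).
Proof.
have d1 := mderivM (mderivM (dx t) (dRes o t)) (dy t).
have := cderivM (cderiv_cst (expR ((1 - s) * o))%:C t) (d1 0 0).
rewrite mul0r add0r; congr (cderiv _ _ (_ * _)).
rewrite /gg -/(Res t o); congr (fun_of_matrix _ 0 0).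
have E1 : x t *m Res t o *m (Y1 t *m y t) = x t *m Y1 t *m Res t o *m y t.
  by rewrite !mulmxA -(mulmxA (x t) (Res t o)) -YRes !mulmxA.
have E2 : x t *m X1 t *m Res t o *m y t + x t *m Y1 t *m Res t o *m y t
        = s%:C *: (x t *m K t *m Res t o *m y t).
  by rewrite -!mulmxDl -mulmxDr XY -scalemxAr -!scalemxAl.
rewrite E1 mulmxDl addrAC E2 mulmxBr mulmxBl -scalemxAr -scalemxAl.
by rewrite mulmxN mulNmx !mulmxA.
Qed.

Let dexp (a o : R) : is_derive o 1 (fun o => expR (a * o)) (a * expR (a * o)).
Proof.
have d : is_derive o 1 (fun o : R => a * o) a.
  have := deriv_mul (is_derive_cst a o 1) (is_derive_id o (1 : R)).
  by rewrite mul0r add0r mulr1.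
by rewrite mulrC; exact: (is_derive1_comp (is_derive_expR (a * o)) d).
Qed.

Let kap_deriv t o : cderiv (fun o => kap t o) o (- gg t o).
Proof.
have dA z : mderiv (fun o => ((expR o)%:C)%:M + W t) z (((expR z)%:C)%:M).
  rewrite -[_%:M]addr0; apply: mderivD; last exact: mderiv_cst.
  move=> i j; rewrite mxE; under eq_fun do rewrite mxE.
  case: (i == j); rewrite ?mulr1n ?mulr0n; last exact: cderiv_cst.
  by apply: cderiv_real; exact: is_derive_expR.
have dR : mderiv (fun o => Res t o) o (- (Res t o - W t *m Res t o *m Res t o)).
  apply: mderiv_eq (mderiv_inv dA (fun z => uRes t z) o) _; congr (- _).
  by rewrite -/(resolvent _ _) -/(Res t o) mul_mx_scalar expRes mulmxBl mul1mx.
have d1 := mderivM (mderivM (mderiv_cst (x t *m K t) o) dR) (mderiv_cst (y t) o).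
have := cderivM (cderiv_real (dexp (1 - s) o)) (d1 0 0).
congr (cderiv _ _ _); rewrite /gg /kap mul0mx add0r mulmx0 addr0.
rewrite -/(Res t o).
set a := x t *m K t; set U := Res t o; set Q := W t *m U *m U.
have -> : a *m (- (U - Q)) *m y t = a *m Q *m y t - a *m U *m y t.
  by rewrite mulmxN mulmxBr opprB mulmxBl.
have -> : a *m (s%:C *: U - Q) *m y t = s%:C *: (a *m U *m y t) - a *m Q *m y t.
  by rewrite mulmxBr mulmxBl -scalemxAr -scalemxAl.
rewrite !mxE rmorphM rmorphB /=; ring.
Qed.

Let cW : mx_in ccont W.
Proof. by move=> i j; apply: cdiff_ccont; exact: (mderiv_mx_in dW). Qed.
Let cx : mx_in ccont x.
Proof. by move=> i j; apply: cdiff_ccont; exact: (mderiv_mx_in dx). Qed.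
Let cy : mx_in ccont y.
Proof. by move=> i j; apply: cdiff_ccont; exact: (mderiv_mx_in dy). Qed.

Let lift1 m n (F : R -> 'M[C]_(m, n)) : mx_in ccont F ->
  mx_in ccont (fun z : R * R => F z.1).
Proof. by move=> cF i j; exact: ccont_comp (cF i j) fst_continuous. Qed.

Let ccont_real (f : R -> R) : continuous f -> ccont (fun z : R * R => (f z.2)%:C).
Proof.
move=> cf; split => /=; last by move=> ?; exact: cvg_cst.
move=> z; exact: (continuous_comp (@snd_continuous z) (cf z.2)).
Qed.

Let AL := @ccont_algebra R (R * R)%type.

Let cRes : mx_in ccont (fun z : R * R => Res z.1 z.2).
Proof.
apply: (mx_in_inv AL); last by move=> z; exact: uRes.
apply: (mx_inD AL); last exact: lift1.
move=> i j; apply: (@fa_ext _ _ (@ccont R (R * R)%type)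
  (fun z : R * R => (expR z.2)%:C * (1%:M : 'M[C]_l) i j)).
  by move=> z; rewrite !mxE mulr_natr.
by apply: (fa_mul AL); [apply: ccont_real; exact: continuous_expR|exact: fa_cst AL _].
Qed.

Let cexp (a : R) : continuous (fun o : R => expR (a * o)).
Proof.
by apply: (@derivable_continuous_R _ _ (fun o => a * expR (a * o))) => o; exact: dexp.
Qed.

Let crho : ccont (fun z : R * R => rho z.1 z.2).
Proof.
apply: (fa_mul AL); first exact: (ccont_real (f := fun o => expR ((1 - s) * o))).
apply: (mx_inM AL); last exact: lift1.
by apply: (mx_inM AL); [exact: lift1|exact: cRes].
Qed.

Let cgg : ccont (fun z : R * R => gg z.1 z.2).
Proof.
apply: (fa_mul AL); first exact: (ccont_real (f := fun o => expR ((1 - s) * o))).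
apply: (mx_inM AL); last exact: lift1.
apply: (mx_inM AL).
  by apply: (mx_inM AL); exact: lift1.
apply: (mx_inB AL); first exact: (mx_inZ AL (fa_cst AL _) cRes).
by apply: (mx_inM AL); [apply: (mx_inM AL); [exact: lift1|]|]; exact: cRes.
Qed.

(* Up to the factors exp ((1 - s) o) and exp (- s o), which are small near - oo
   and + oo respectively, kap is B1 at exp (o / 2) and B2 at exp (- o / 2). With squares in place of exp o and exp (- o), the
   inverses exist for every real argument, and compactness bounds B1 and B2. *)
Let B1 (z : R * R) : C :=
  (x z.1 *m K z.1 *m invmx (((z.2 * z.2)%:C)%:M + W z.1) *m y z.1) 0 0.
Let B2 (z : R * R) : C :=
  (x z.1 *m K z.1 *m invmx (1%:M + ((z.2 * z.2)%:C) *: W z.1) *m y z.1) 0 0.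

Let sq_continuous : continuous (fun c : R => c * c).
Proof. by move=> c; apply: cvgM; exact: cvg_id. Qed.

Let uB2 t (c : R) : 1%:M + ((c * c)%:C) *: W t \in unitmx.
Proof.
have [->|c0] := eqVneq c 0; first by rewrite mulr0 scale0r addr0 unitmx1.
have cc0 : (c * c)%:C != 0 :> C by rewrite eq_complex /= eqxx andbT mulf_neq0.
have -> : 1%:M + (c * c)%:C *: W t = (c * c)%:C *: ((((c * c)^-1)%:C)%:M + W t).
  by rewrite scalerDr scale_scalar_mx fmorphV mulfV.
by rewrite unitmxZ ?unitfE // uW // invr_ge0 -expr2 sqr_ge0.
Qed.

Let cB1 : ccont B1.
Proof.
apply: (mx_inM AL); last exact: lift1.
apply: (mx_inM AL); first by apply: (mx_inM AL); exact: lift1.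
apply: (mx_in_inv AL); last by move=> z; apply: uW; rewrite -expr2 sqr_ge0.
apply: (mx_inD AL); last exact: lift1.
move=> i j; apply: (@fa_ext _ _ (@ccont R (R * R)%type)
  (fun z : R * R => (z.2 * z.2)%:C * (1%:M : 'M[C]_l) i j)).
  by move=> z; rewrite !mxE mulr_natr.
apply: (fa_mul AL); last exact: fa_cst AL _.
exact: (ccont_real (f := fun c => c * c)).
Qed.

Let cB2 : ccont B2.
Proof.
apply: (mx_inM AL); last exact: lift1.
apply: (mx_inM AL); first by apply: (mx_inM AL); exact: lift1.
apply: (mx_in_inv AL); last by move=> z; exact: uB2.
apply: (mx_inD AL); first exact: mx_in_cst.
apply: (mx_inZ AL); last exact: lift1.
exact: (ccont_real (f := fun c => c * c)).
Qed.

Let halfsq (o : R) : expR (o / 2) * expR (o / 2) = expR o.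
Proof. by rewrite -expRD; congr expR; lra. Qed.

Let kapB1 t o : kap t o = (expR ((1 - s) * o))%:C * B1 (t, expR (o / 2)).
Proof. by rewrite /kap /B1 /= halfsq. Qed.

Let kapB2 t o : kap t o = (expR (- (s * o)))%:C * B2 (t, expR (- o / 2)).
Proof.
have e0 : (expR o)%:C != 0 :> C.
  by rewrite eq_complex /= eqxx andbT gt_eqF ?expR_gt0.
rewrite /kap /B2 /= halfsq /Res /resolvent.
have -> : ((expR o)%:C)%:M + W t = (expR o)%:C *: (1%:M + (expR (- o))%:C *: W t).
  by rewrite scalerDr scale_scalar_mx mulr1 scalerA -rmorphM -expRD subrr expR0 scale1r.
rewrite invmxZ; last first.
  by rewrite unitmxZ ?unitfE // -(halfsq (- o)) uB2.
rewrite -scalemxAr -scalemxAl mxE mulrA; congr (_ * _).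
rewrite -fmorphV -rmorphM -expRN -expRD; congr ((expR _)%:C); lra.
Qed.

Let Re_real (r : R) (z : C) : complex.Re (r%:C * z) = r * complex.Re z.
Proof. by case: z => a b /=; rewrite mul0r subr0. Qed.
Let Im_real (r : R) (z : C) : complex.Im (r%:C * z) = r * complex.Im z.
Proof. by case: z => a b /=; rewrite mul0r addr0. Qed.

(** Formally [x W^-s y] is conserved, as its derivative is
    [x (X1 + Y1 - s K) W^-s y = 0]. For the truncated integrals, the derivative of the
    integrand along the motion is minus the derivative in [o] of [kap], the
    same integrand with [K] inserted, which decays exponentially at both ends because
    [0 < s < 1]. *)
Lemma mellin_transport t0 t1 : t0 < t1 ->
  asym (fun L => cint L (mellin_kernel (W t1) (x t1) (y t1)))
       (fun L => cint L (mellin_kernel (W t0) (x t0) (y t0))).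
Proof.
move=> t01; have /andP[s0 s1] := s01.
have [M1 M10 H1] := ccont_bounded t0 t1 0 1 cB1.
have [M2 M20 H2] := ccont_bounded t0 t1 0 1 cB2.
pose M := M1 * (1 - s)^-1 + M2 * s^-1.
have s'0 : 0 < 1 - s by lra.
have M0 : 0 <= M by rewrite addr_ge0 // mulr_ge0 // invr_ge0 ltW.
have bnd (L t : R) : 0 < L -> t0 <= t <= t1 ->
    (`|complex.Re (kap t L)| <= M / L /\ `|complex.Re (kap t (- L))| <= M / L) /\
    (`|complex.Im (kap t L)| <= M / L /\ `|complex.Im (kap t (- L))| <= M / L).
  move=> L0 tI.
  have c01 : 0 <= expR (- L / 2) <= 1.
    rewrite expR_ge0 /= -[X in _ <= X]expR0 ler_expR mulNr oppr_le0.
    by rewrite divr_ge0 // ltW.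
  have [h11 h12] := H1 t _ tI c01; have [h21 h22] := H2 t _ tI c01.
  have e1 := expR_Nle s'0 L0; have e2 := expR_Nle s0 L0.
  have b1 (u : R) : `|u| <= M1 -> expR ((1 - s) * - L) * `|u| <= M / L.
    move=> uM; rewrite mulrN.
    rewrite (le_trans (ler_pM _ _ e1 uM)) ?expR_ge0 //.
    rewrite mulrAC ler_pM2r ?invr_gt0 // /M [_^-1 * _]mulrC lerDl.
    by rewrite mulr_ge0 // invr_ge0 ltW.
  have b2 (u : R) : `|u| <= M2 -> expR (- (s * L)) * `|u| <= M / L.
    move=> uM.
    rewrite (le_trans (ler_pM _ _ e2 uM)) ?expR_ge0 //.
    rewrite mulrAC ler_pM2r ?invr_gt0 // /M [_^-1 * _]mulrC lerDr.
    by rewrite mulr_ge0 // invr_ge0 ltW.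
  rewrite (kapB2 t L) (kapB1 t (- L)) !Re_real !Im_real !normrM !(gtr0_norm (expR_gt0 _)).
  by split; split; [exact: b2|exact: b1|exact: b2|exact: b1].
exists (2 * M * (t1 - t0)).
  by rewrite mulr_ge0 ?mulr_ge0 // subr_ge0 ltW.
move=> L L0.
have -> : 2 * M * (t1 - t0) / L = 2 * (M / L) * (t1 - t0) by ring.
split.
- apply: (@rectangle_transport _ (fun t o => complex.Re (rho t o))
    (fun t o => complex.Re (gg t o)) (fun t o => - complex.Re (kap t o))) => //.
  + by move=> t o; case: (rho_deriv t o).
  + move=> t o; have [d _] := kap_deriv t o.
    have := is_deriveN d; rewrite (_ : - complex.Re _ = complex.Re (gg t o)) //.
    by case: (gg t o) => ? ? /=; rewrite opprK.
  + by case: crho.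
  + by case: cgg.
  + by move=> t tI; rewrite !normrN; case: (bnd L t L0 tI).
- apply: (@rectangle_transport _ (fun t o => complex.Im (rho t o))
    (fun t o => complex.Im (gg t o)) (fun t o => - complex.Im (kap t o))) => //.
  + by move=> t o; case: (rho_deriv t o).
  + move=> t o; have [_ d] := kap_deriv t o.
    have := is_deriveN d; rewrite (_ : - complex.Im _ = complex.Im (gg t o)) //.
    by case: (gg t o) => ? ? /=; rewrite opprK.
  + by case: crho.
  + by case: cgg.
  + by move=> t tI; rewrite !normrN; case: (bnd L t L0 tI).
Qed.

End MellinTransport.

(** * Comparison of truncated integrals *)

Section Asymptotics.
Context {R : realType}.
Local Notation C := R[i].
Notation mu := (@lebesgue_measure R).
Implicit Types (F G H : R -> C) (r f : R -> R).

Lemma asym_trans F G H : asym F G -> asym G H -> asym F H.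
Proof.
move=> [M M0 FG] [N N0 GH]; exists (M + N); first exact: addr_ge0.
move=> L L0; have [a b] := FG L L0; have [c d] := GH L L0; rewrite mulrDl; split.
- rewrite -(subrK (complex.Re (G L)) (complex.Re (F L))) -addrA.
  by rewrite (le_trans (ler_normD _ _)) // lerD.
- rewrite -(subrK (complex.Im (G L)) (complex.Im (F L))) -addrA.
  by rewrite (le_trans (ler_normD _ _)) // lerD.
Qed.

Lemma asym_sym F G : asym F G -> asym G F.
Proof.
move=> [M M0 FG]; exists M => // L L0; rewrite distrC.
by rewrite [X in _ /\ X <= _]distrC; exact: FG.
Qed.

Lemma asym_scale (c : C) F G :
  asym F G -> asym (fun L => c * F L) (fun L => c * G L).
Proof.
move=> [M M0 FG]; exists ((`|complex.Re c| + `|complex.Im c|) * M).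
  by rewrite mulr_ge0 // addr_ge0.
move=> L L0; have [a b] := FG L L0.
have bd (u v : R) : `|u| <= M / L -> `|v| <= M / L ->
    `|complex.Re c * u| + `|complex.Im c * v|
      <= (`|complex.Re c| + `|complex.Im c|) * M / L.
  move=> uM vM; rewrite !normrM -mulrA mulrDl.
  by apply: lerD; exact: ler_wpM2l.
rewrite !cReM !cImM; split.
- apply: le_trans (bd _ _ a b).
  apply: le_trans (ler_normB _ _); rewrite !mulrBr opprB.
  by rewrite le_eqVlt; apply/orP; left; apply/eqP; congr `|_|; ring.
- apply: le_trans (bd _ _ b a).
  apply: le_trans (ler_normD _ _); rewrite !mulrBr.
  by rewrite le_eqVlt; apply/orP; left; apply/eqP; congr `|_|; ring.
Qed.

Lemma cint_real r (c : C) L : continuous r ->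
  cint L (fun o => (r o)%:C * c) = (\int[mu]_(o in `[- L, L]) r o)%:C * c.
Proof.
move=> cr; have ir := segment_integrable (- L) L cr.
apply/eqP; rewrite eq_complex cReM cImM /= !mul0r subr0 addr0.
rewrite ![_ * complex.Re c]mulrC ![_ * complex.Im c]mulrC -!RintegralZl //.
apply/andP; split; apply/eqP; apply: eq_Rintegral => o _; rewrite ?cReM ?cImM /=.
  by rewrite mul0r subr0 mulrC.
by rewrite mul0r addr0 mulrC.
Qed.

Lemma cint_scale (c : C) (f : R -> C) L : ccont f ->
  cint L (fun o => c * f o) = c * cint L f.
Proof.
move=> [f1 f2]; have i1 := segment_integrable (- L) L f1.
have i2 := segment_integrable (- L) L f2.
apply/eqP; rewrite eq_complex cReM cImM /=; apply/andP; split; apply/eqP.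
- rewrite -!RintegralZl // -RintegralB //; last 2 first.
  + by apply: segment_integrable => o; apply: cvgM; [exact: cvg_cst|exact: f1].
  + by apply: segment_integrable => o; apply: cvgM; [exact: cvg_cst|exact: f2].
  by apply: eq_Rintegral => o _; rewrite cReM.
- rewrite -!RintegralZl // -RintegralD //; last 2 first.
  + by apply: segment_integrable => o; apply: cvgM; [exact: cvg_cst|exact: f2].
  + by apply: segment_integrable => o; apply: cvgM; [exact: cvg_cst|exact: f1].
  by apply: eq_Rintegral => o _; rewrite cImM.
Qed.

(** The lower bound on [[-1, 1]] serves for all [L >= 1]. *)
Lemma Rintegral_pos r : continuous r -> (forall o, 0 < r o) ->
  exists2 d, 0 < d & forall L, 1 <= L -> d <= \int[mu]_(o in `[- L, L]) r o.
Proof.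
move=> cr rpos.
have [c cI cmin] := EVT_min (a := - 1) (b := 1) ltac:(lra) (continuous_subspaceT cr).
exists (r c) => // L L1.
have ir := fun a b => segment_integrable a b cr.
have step1 : r c <= \int[mu]_(o in `[- 1, 1]) r o.
  have : \int[mu]_(o in `[- 1, 1]) (r c) <= \int[mu]_(o in `[- 1, 1]) r o.
    apply: le_Rintegral; [exact: measurable_itv| |exact: ir|].
      by apply: segment_integrable => ?; exact: cvg_cst.
    by move=> o oI; apply: cmin.
  apply: le_trans; rewrite Rintegral_cst //= lebesgue_measure_itv /= lte_fin.
  rewrite ifT; last lra.
  by rewrite -EFinB /= ler_pMr //; lra.
apply: (le_trans step1); rewrite /Rintegral fine_le ?integrable_fin_num //.
apply: ge0_subset_integral => //=.
- exact: (measurable_int mu (ir (- L) L)).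
- by move=> o _; rewrite lee_fin ltW.
- by move=> z /=; rewrite !in_itv /= => /andP[z1 z2]; apply/andP; split; lra.
Qed.

End Asymptotics.

Section KernelFacts.
Context {R : realType} {l : nat}.
Local Notation C := R[i].
Notation mu := (@lebesgue_measure R).
Variable s : R.

(** The complex exponential of [i t]. *)
Definition ce (t : R) : C := cos t +i* sin t.

Lemma ceD a b : ce (a + b) = ce a * ce b.
Proof. by rewrite /ce cosD sinD; apply/eqP; rewrite eq_complex /=; apply/andP; split; apply/eqP; ring. Qed.

Lemma ce0 : ce 0 = 1.
Proof. by rewrite /ce cos0 sin0. Qed.

Lemma ceN a : ce (- a) * ce a = 1.
Proof. by rewrite -ceD addNr ce0. Qed.

(** The kernel for the matrix 1, see [mellin_kernel1]. *)
Definition weight (o : R) : R := expR ((1 - s) * o) / (1 + expR o).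
Definition cweight (L : R) : R := \int[mu]_(o in `[- L, L]) weight o.

Lemma weight_gt0 o : 0 < weight o.
Proof. by rewrite divr_gt0 ?expR_gt0 // addr_gt0 ?expR_gt0. Qed.

Lemma expR_lin_continuous (a : R) : continuous (fun o : R => expR (a * o)).
Proof.
move=> o; have c : {for o, continuous (fun o : R => a * o)}.
  by apply: cvgM; [exact: cvg_cst|exact: cvg_id].
exact: (continuous_comp c (@continuous_expR R (a * o))).
Qed.

Lemma weight_continuous : continuous weight.
Proof.
move=> o; apply: cvgM; first exact: expR_lin_continuous.
apply: cvgV; first by rewrite gt_eqF // addr_gt0 ?expR_gt0.
by apply: cvgD; [exact: cvg_cst|exact: continuous_expR].
Qed.

Lemma cweight_lb : exists2 d, 0 < d & forall L, 1 <= L -> d <= cweight L.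
Proof. exact: Rintegral_pos weight_continuous weight_gt0. Qed.

(** The integrals of [weight] and of [Im f] stay above positive
    constants, so their proportionality up to O(1/L) forces a strict sign. *)
Lemma asym_sign (m t : R) (f : R -> C) : ccont f ->
  (forall o, 0 < complex.Im (f o)) ->
  asym (fun L => ce t * ((cweight L)%:C * m%:C)) (cint^~ f) -> 0 < m * sin t.
Proof.
move=> [_ cf] fpos [M M0 Ha]; have [d d0 Hd] := Rintegral_pos cf fpos.
have [d' d'0 Hd'] := cweight_lb.
(* Large enough for the error M / L to be below the integral of Im f. *)
pose L := Num.max 1 ((M + 1) / d).
have L1 : 1 <= L by rewrite /L le_max lexx.
have L0 : 0 < L by exact: lt_le_trans L1.
have ML : M / L < d.
  rewrite ltr_pdivrMr // mulrC -ltr_pdivrMr //.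
  rewrite (lt_le_trans _ (_ : (M + 1) / d <= L)) ?le_max ?lexx ?orbT //.
  by rewrite ltr_pM2r ?invr_gt0 //; lra.
have [_] := Ha L L0; rewrite cImM /= !mulr0 !mul0r addr0 subr0 => h.
have : 0 < sin t * (cweight L * m).
  have h1 := Hd L L1; move: h; rewrite ler_norml => /andP[h _].
  by move: h; rewrite /cint /= ?mulr0 ?add0r; lra.
rewrite mulrCA pmulr_rgt0; first by rewrite mulrC.
exact: lt_le_trans (Hd' L L1).
Qed.

Lemma asym_zero (z : C) : asym (fun L => (cweight L)%:C * z) (fun=> 0) -> z = 0.
Proof.
move=> [M M0 Ha]; have [d' d'0 Hd'] := cweight_lb.
have small (u : R) : (forall L, 0 < L -> `|cweight L * u| <= M / L) -> u = 0.
  move=> H; apply/eqP; rewrite -normr_eq0; apply/eqP.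
  apply: le_anti; rewrite normr_ge0 andbT; apply/ler_addgt0Pr => e e0.
  rewrite add0r; pose L := Num.max 1 (M / (e * d')).
  have L1 : 1 <= L by rewrite /L le_max lexx.
  have L0 : 0 < L by exact: lt_le_trans L1.
  rewrite -(ler_pM2l d'0); apply: (@le_trans _ _ (M / L)).
    rewrite (le_trans _ (H L L0)) // normrM ler_wpM2r //.
    by rewrite (le_trans (Hd' L L1)) // ler_norm.
  rewrite ler_pdivrMr // mulrC -ler_pdivrMr ?mulr_gt0 //.
  by rewrite [d' * e]mulrC /L le_max lexx orbT.
case: z Ha => a b Ha; suff [-> ->] : a = 0 /\ b = 0 by [].
by split; apply: small => L L0; have := Ha L L0; rewrite /= !mul0r !subr0 addr0;
  case.
Qed.

Lemma mellin_kernel1 (u : 'rV[C]_l) (v : 'cV[C]_l) o :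
  mellin_kernel s 1%:M u v o = (weight o)%:C * (u *m v) 0 0.
Proof.
rewrite /mellin_kernel /resolvent -raddfD /=.
have e0 : (expR o)%:C + 1 != 0 :> C.
  by rewrite eq_complex /= addr0 eqxx andbT gt_eqF // addr_gt0 ?expR_gt0.
rewrite invmx_scalar mul_mx_scalar -scalemxAl mxE mulrA; congr (_ * _).
rewrite /weight rmorphM fmorphV rmorphD rmorph1 /=; congr (_ / _).
exact: addrC.
Qed.

Lemma mellin_kernelZ (M : 'M[C]_l) (u : 'rV[C]_l) (v : 'cV[C]_l) z o :
  mellin_kernel s M u (z *: v) o = z * mellin_kernel s M u v o.
Proof. by rewrite /mellin_kernel -scalemxAr mxE mulrCA. Qed.

Lemma mellin_kernel_cont (M : 'M[C]_l) (u : 'rV[C]_l) (v : 'cV[C]_l) :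
  (forall r : R, 0 <= r -> (r%:C)%:M + M \in unitmx) ->
  ccont (mellin_kernel s M u v).
Proof.
move=> uM; have AL := @ccont_algebra R R.
have cr (f : R -> R) : continuous f -> ccont (fun z : R => (f z)%:C).
  by move=> cf; split => //= ?; exact: cvg_cst.
apply: (fa_mul AL); first by apply: (cr _ (@expR_lin_continuous (1 - s))).
apply: (mx_inM AL); last exact: mx_in_cst.
apply: (mx_inM AL); first exact: mx_in_cst.
apply: (mx_in_inv AL); last by move=> o; apply: uM; exact: expR_ge0.
apply: (mx_inD AL); last exact: mx_in_cst.
move=> i j; apply: (@fa_ext _ _ (@ccont R R)
  (fun z : R => (expR z)%:C * (1%:M : 'M[C]_l) i j)).
  by move=> z; rewrite !mxE mulr_natr.
by apply: (fa_mul AL); [apply: cr; exact: continuous_expR|exact: fa_cst AL _].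
Qed.

End KernelFacts.

(** * The pencil cos + sin V *)

Lemma form_comb (R : rcfType) l (F V : 'M[R[i]]_l) (z w : R[i]) (u : 'rV_l)
    (c : 'cV_l) :
  (u *m F *m (z%:M + w *: V) *m c) 0 0
  = z * (u *m F *m c) 0 0 + w * (u *m F *m V *m c) 0 0.
Proof.
rewrite mulmxDr mul_mx_scalar -scalemxAr mulmxDl -!scalemxAl [LHS]mxE.
by congr (_ + _); rewrite mxE.
Qed.

Lemma comb_comm (R : rcfType) l (M V : 'M[R[i]]_l) (z w : R[i]) :
  M *m V = V *m M -> M *m (z%:M + w *: V) = (z%:M + w *: V) *m M.
Proof.
move=> MV; rewrite mulmxDr mulmxDl mul_mx_scalar mul_scalar_mx; congr (_ + _).
by rewrite -scalemxAr -scalemxAl MV.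
Qed.

Section Geometry.
Context {R : realType} {l : nat}.
Local Notation C := R[i].
Variables (a b G V : 'M[C]_l).
Hypothesis rV : root_of a b G V.
Local Notation E := (imE G V).
Implicit Types (p q psi phi s u : R) (c : 'cV[C]_l).

Definition dform (c : 'cV[C]_l) : R := complex.Im ((hc c *m E *m V *m c) 0 0).

(** By [imE_dissip], twice this number is the value at [c] of a positive form. *)
Lemma dform_gt0 c : c != 0 -> 0 < dform c.
Proof.
move=> c0; have := pos_hWGW rV c0.
set w := (hc c *m (2^-1 *: (hc (imW V) *m G *m imW V)) *m c) 0 0.
have : (hc c *m (E *m V - hc V *m E) *m c) 0 0 =
    'i%C * w.
  rewrite (imE_dissip rV) -scalemxAr -scalemxAl mxE; congr (_ * _).
have -> : hc c *m (E *m V - hc V *m E) *m c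
   = hc c *m E *m V *m c - hc (hc c *m E *m V *m c).
  rewrite mulmxBr mulmxBl !hcM hcK (imE_hc rV) !mulmxA; congr (_ - _).
have -> : (hc c *m E *m V *m c - hc (hc c *m E *m V *m c)) 0 0
   = (hc c *m E *m V *m c) 0 0 - conjc ((hc c *m E *m V *m c) 0 0).
  by rewrite [LHS]mxE; congr (_ + _); rewrite mxE; congr (- _); rewrite mxE mxE.
rewrite /dform; case: ((hc c *m E *m V *m c) 0 0) => x y /=.
case: w => z w [_ H] /=; rewrite ltcE /= => /andP[_ z0].
by move: H; lra.
Qed.

Lemma E_form_real c : complex.Im ((hc c *m E *m c) 0 0) = 0.
Proof.
have : hc (hc c *m E *m c) = hc c *m E *m c by rewrite !hcM hcK (imE_hc rV) mulmxA.
move/matrixP/(_ 0 0); rewrite mxE [in LHS]mxE.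
by case: ((hc c *m E *m c) 0 0) => x y [] /=; lra.
Qed.

Lemma E_form_gt0 c : c != 0 -> 0 < complex.Re ((hc c *m E *m c) 0 0).
Proof. by move/(imE_pos rV); rewrite ltcE /= => /andP[]. Qed.

Lemma Im_comb (z : C) q c :
  complex.Im ((hc c *m E *m (z%:M + q%:C *: V) *m c) 0 0)
  = complex.Im z * complex.Re ((hc c *m E *m c) 0 0) + q * dform c.
Proof.
by rewrite form_comb cImD !cImM E_form_real mulr0 add0r /= mul0r addr0.
Qed.

Lemma inj_unitmx (M : 'M[C]_l) : (forall c : 'cV_l, M *m c = 0 -> c = 0) ->
  M \in unitmx.
Proof.
move=> inj; rewrite -unitmx_tr -row_free_unit -kermx_eq0; apply/negPn/negP.
case/rowV0Pn => v /sub_kermxP vM; case/eqP; apply: trmx_inj; rewrite trmx0.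
by apply: inj; apply: trmx_inj; rewrite trmx_mul trmxK vM trmx0.
Qed.

(** The imaginary part of [hc c E (z + q V) c] is
    [Im z (hc c E c) + q (dform c)], which has the strict sign of [q]. *)
Lemma comb_unit (z : C) q : q != 0 -> 0 <= complex.Im z * q ->
  z%:M + q%:C *: V \in unitmx.
Proof.
move=> q0 zq; apply: inj_unitmx => c zc; apply/eqP/negPn/negP => c0.
have := Im_comb z q c; rewrite -mulmxA zc mulmx0 mxE /=.
have d0 := dform_gt0 c0; have e0 := E_form_gt0 c0.
set e := complex.Re _ in e0 *; set d := dform c in d0 *; move: q0 zq.
set w := complex.Im z.
rewrite neq_lt => /orP[q0|q0] zq H.
- have w0 : w <= 0 by rewrite -(nmulr_lge0 _ q0).
  have : w * e <= 0 by rewrite mulr_le0_ge0 // ltW.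
  have : q * d < 0 by rewrite nmulr_rlt0.
  lra.
- have w0 : 0 <= w by rewrite -(pmulr_lge0 _ q0).
  have : 0 <= w * e by rewrite mulr_ge0 // ltW.
  have : 0 < q * d by rewrite mulr_gt0.
  lra.
Qed.

(** [Tm], its derivative [Td] and its logarithmic derivative [Nm] are polynomials and
    rational functions of [V], so they all commute. *)
Definition Tm phi : 'M[C]_l := ((cos phi)%:C)%:M + (sin phi)%:C *: V.
Definition Td phi : 'M[C]_l := (- sin phi)%:C%:M + (cos phi)%:C *: V.
(** Locked, lest rewriting with the associativity and linearity of the product
    unfold it. *)
Definition Nm phi : 'M[C]_l := locked (invmx (Tm phi) *m Td phi).

Lemma NmE phi : Nm phi = invmx (Tm phi) *m Td phi.
Proof. by rewrite /Nm -lock. Qed.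

Lemma cos_neq0 phi : sin phi = 0 -> cos phi != 0.
Proof.
move=> s0; apply/eqP => c0; have := cos2Dsin2 phi.
by rewrite s0 c0 expr0n addr0 => /eqP; rewrite eq_sym oner_eq0.
Qed.

Lemma Tm_sin0 phi : sin phi = 0 -> Tm phi = ((cos phi)%:C)%:M.
Proof. by move=> s0; rewrite /Tm s0 scale0r addr0. Qed.

Lemma Tm_unit phi : Tm phi \in unitmx.
Proof.
have [s0|s0] := eqVneq (sin phi) 0.
  rewrite Tm_sin0 // -scalemx1 unitmxZ ?unitmx1 // unitfE eq_complex /= eqxx andbT.
  exact: cos_neq0.
by apply: comb_unit => //=; rewrite mul0r.
Qed.

Lemma ce_neq0 t : ce t != 0 :> C.
Proof.
by apply/eqP => c0; have := ceN t; rewrite c0 mulr0 => /eqP; rewrite eq_sym oner_eq0.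
Qed.

(** Rotating back by [psi] turns the matrix into a combination
    [z + sin phi V] with [Im z = u sin psi]. *)
Lemma shift_unit u psi phi : sin phi != 0 -> 0 <= u -> 0 <= sin psi * sin phi ->
  u%:C%:M + ce (- psi) *: Tm phi \in unitmx.
Proof.
move=> s0 u0 ss.
have -> : u%:C%:M + ce (- psi) *: Tm phi
    = ce (- psi) *: ((u%:C * ce psi + (cos phi)%:C)%:M + (sin phi)%:C *: V).
  rewrite /Tm !scalerDr !scale_scalar_mx mulrDr mulrCA ceN mulr1.
  by rewrite [(_ + _)%:M]raddfD /= addrA.
rewrite unitmxZ ?unitfE ?ce_neq0 //; apply: comb_unit => //=.
by rewrite mul0r !addr0 -mulrA mulr_ge0.
Qed.

Lemma rotated_sin0 phi : sin phi = 0 -> ce (- phi) *: Tm phi = 1%:M.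
Proof.
move=> s0; rewrite Tm_sin0 // scale_scalar_mx.
have -> : (cos phi)%:C = ce phi by rewrite /ce s0.
by rewrite ceN.
Qed.

Lemma diag_shift_unit u phi : 0 <= u -> u%:C%:M + ce (- phi) *: Tm phi \in unitmx.
Proof.
move=> u0; have [s0|s0] := eqVneq (sin phi) 0.
  rewrite rotated_sin0 // -raddfD /= -scalemx1 unitmxZ ?unitmx1 // unitfE.
  by rewrite eq_complex /= addr0 eqxx andbT gt_eqF //; lra.
by apply: shift_unit => //; rewrite -expr2 sqr_ge0.
Qed.

Lemma Tm_Td_comm phi psi : Tm phi *m Td psi = Td psi *m Tm phi.
Proof.
by apply/esym/comb_comm/esym/comb_comm.
Qed.

Lemma Nm_comm phi : Nm phi *m Tm phi = Tm phi *m Nm phi.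
Proof. by rewrite NmE -mulmxA -Tm_Td_comm mulKmx ?Tm_unit // mulKVmx ?Tm_unit. Qed.

Lemma TmNm phi : Tm phi *m Nm phi = Td phi.
Proof. by rewrite NmE mulKVmx ?Tm_unit. Qed.

Lemma NmTm phi : Nm phi *m Tm phi = Td phi.
Proof. by rewrite Nm_comm TmNm. Qed.

Lemma mderiv_Tm phi : mderiv Tm phi (Td phi).
Proof.
apply: mderivD.
  move=> i j; rewrite mxE; under eq_fun do rewrite mxE.
  case: (i == j); rewrite ?mulr1n ?mulr0n; last exact: cderiv_cst.
  exact: cderiv_real (is_derive_cos phi).
have := mderivZ (cderiv_real (is_derive_sin phi)) (mderiv_cst V phi).
by rewrite scaler0 addr0.
Qed.

Lemma mx_cdiff_Td : mx_in cdiff Td.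
Proof.
apply: (@mderiv_mx_in _ _ _ _ (fun phi => - Tm phi)) => phi.
rewrite /Tm opprD; apply: mderivD.
  move=> i j; rewrite !mxE; under eq_fun do rewrite mxE.
  case: (i == j); rewrite ?mulr1n ?mulr0n ?oppr0; last exact: cderiv_cst.
  rewrite -rmorphN; apply: cderiv_real; exact: is_deriveN (is_derive_sin phi).
have := mderivZ (cderiv_real (is_derive_cos phi)) (mderiv_cst V phi).
by rewrite scaler0 addr0 rmorphN scaleNr.
Qed.

Lemma mx_ccont_Nm : mx_in ccont Nm.
Proof.
move=> i j; apply: cdiff_ccont; move: i j.
have -> : Nm = (fun phi => invmx (Tm phi) *m Td phi) by apply/funext => phi; rewrite NmE.
apply: (mx_inM (@cdiff_algebra R)); last exact: mx_cdiff_Td.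
by apply: (mx_in_inv (@cdiff_algebra R)); [exact: mderiv_mx_in mderiv_Tm|exact: Tm_unit].
Qed.

Lemma cderiv_ce (k t : R) : cderiv (fun t => ce (k * t)) t ('i%C * k%:C * ce (k * t)).
Proof.
have d : is_derive t 1 (fun t : R => k * t) k.
  have := deriv_mul (is_derive_cst k t 1) (is_derive_id t (1 : R)).
  by rewrite mul0r add0r mulr1.
split=> /=.
- apply: (is_derive_eq (is_derive1_comp (is_derive_cos (k * t)) d)); ring.
- apply: (is_derive_eq (is_derive1_comp (is_derive_sin (k * t)) d)); ring.
Qed.

End Geometry.

(** * Deformation along the angle and by rotation *)

Section Paths.
Context {R : realType} {l : nat}.
Local Notation C := R[i].
Variables (a b G V : 'M[C]_l).
Hypothesis rV : root_of a b G V.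
Local Notation Tm := (Tm V).
Local Notation Td := (Td V).
Local Notation Nm := (Nm V).

(** Formally [x = x0 Tm^p] and [y = Tm^q y0], so that [x Tm^-s y] is constant. *)
Definition transport (alpha s : R) (x : R -> 'rV[C]_l) (y : R -> 'cV[C]_l) : Prop :=
  exists p q : C, p + q = s%:C /\ forall phi : R, 0 <= phi <= alpha ->
    mderiv x phi (p *: (x phi *m Nm phi)) /\
    mderiv y phi (q *: (Nm phi *m y phi)).

(** The shift of [s] by one, which leaves [x] and the formal invariant
    unchanged. *)
Lemma transport_T alpha s x y : transport alpha s x y ->
  transport alpha (s + 1) x (fun phi => Tm phi *m y phi).
Proof.
move=> [p [q [pq H]]]; exists p, (q + 1); split.
  by rewrite addrA pq rmorphD.
move=> phi /H[dx dy]; split=> //.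
apply: mderiv_eq (mderivM (mderiv_Tm V phi) dy) _.
have -> : Td phi *m y phi = Nm phi *m (Tm phi *m y phi) by rewrite mulmxA (NmTm rV).
have -> : Tm phi *m (q *: (Nm phi *m y phi)) = q *: (Nm phi *m (Tm phi *m y phi)).
  by rewrite -scalemxAr !mulmxA (Nm_comm rV).
by rewrite scalerDl scale1r addrC.
Qed.

Lemma transport_Tinv alpha s x y : transport alpha s x y ->
  transport alpha (s - 1) x (fun phi => invmx (Tm phi) *m y phi).
Proof.
move=> [p [q [pq H]]]; exists p, (q - 1); split.
  by rewrite addrA pq rmorphB.
move=> phi /H[dx dy]; split=> //.
have dI := mderiv_inv (mderiv_Tm V) (Tm_unit rV) phi.
apply: mderiv_eq (mderivM dI dy) _.
have NI : Nm phi *m invmx (Tm phi) = invmx (Tm phi) *m Nm phi.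
  by apply: comm_invmx; exact: Nm_comm rV phi.
rewrite -NmE mulNmx -(mulmxA (Nm phi)) -scalemxAr scalerBl scale1r addrC.
by rewrite (mulmxA (invmx _)) -NI -(mulmxA (Nm phi)).
Qed.

(** A smooth path from [p] (at time 0) to [q] (at time [pi]) which is defined on
    the whole line and stays between the two, since [mellin_transport] has hypotheses
    at all times. *)
Definition zeta (p q t : R) : R := p + (q - p) * ((1 - cos t) / 2).

Lemma zeta0 p q : zeta p q 0 = p.
Proof. by rewrite /zeta cos0 subrr mul0r mulr0 addr0. Qed.

Lemma zetapi p q : zeta p q pi = q.
Proof. by rewrite /zeta cospi opprK -[1 + 1]/(2%:R) divff ?pnatr_eq0 // mulr1 addrC subrK. Qed.

Lemma zeta_sub (p q t : R) : p <= q -> p <= zeta p q t <= q.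
Proof.
move=> pq; have c1 := cos_le1 t; have c2 := cos_geN1 t.
have h0 : 0 <= (1 - cos t) / 2 by lra.
have h1 : (1 - cos t) / 2 <= 1 by lra.
rewrite /zeta lerDl mulr_ge0 ?subr_ge0 //= -lerBrDl ler_piMr // subr_ge0 //.
Qed.

Lemma is_derive_zeta (p q t : R) :
  is_derive t 1 (zeta p q) ((q - p) * (sin t / 2)).
Proof.
have dc (k : R) : is_derive t 1 (fun _ : R => k) (0 : R) by exact: is_derive_cst.
have d1 : is_derive t 1 (fun t : R => 1 - cos t) (sin t).
  have := deriv_sub (dc 1) (is_derive_cos t).
  by rewrite sub0r opprK.
have d2 := deriv_add (dc p) (deriv_mul (dc (q - p)) (deriv_mul d1 (dc 2^-1))).
by apply: (is_derive_eq d2); rewrite mulr0 addr0 mul0r !add0r.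
Qed.

Lemma dzeta_continuous (p q : R) : continuous (fun t : R => (q - p) * (sin t / 2)).
Proof.
move=> t; apply: cvgM; first exact: cvg_cst.
by apply: cvgM; [exact: continuous_sin|exact: cvg_cst].
Qed.

Lemma cderiv_ceN (s t : R) : cderiv (fun t => ce (- (s * t))) t
   (- ('i%C * s%:C) * ce (- (s * t))).
Proof.
have := cderiv_ce (- s) t; rewrite mulNr rmorphN mulrN => d.
by move: d; congr (cderiv _ _ _); apply/funext => z; rewrite mulNr.
Qed.

Lemma cderiv_ce1 (t : R) : cderiv (fun t : R => ce (- t)) t (- 'i%C * ce (- t)).
Proof.
have := cderiv_ceN 1 t; rewrite mulr1 mul1r.
by congr (cderiv _ _ _); apply/funext => u; rewrite mul1r.
Qed.

(** The deformation by [W = ce (- tau) Tm alpha] at a fixed angle. The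
    factor [ce (- (s tau))] of [y] compensates the power [-s] of the scalar
    [ce (- tau)]. *)
Lemma rotation_transport (s alpha tau1 tau2 : R) (x : 'rV[C]_l) (y : 'cV[C]_l) :
  0 < s < 1 -> sin alpha != 0 ->
  (forall t, 0 <= sin (zeta tau1 tau2 t) * sin alpha) ->
  asym (cint^~ (mellin_kernel s (ce (- tau2) *: Tm alpha) x (ce (- (s * tau2)) *: y)))
       (cint^~ (mellin_kernel s (ce (- tau1) *: Tm alpha) x (ce (- (s * tau1)) *: y))).
Proof.
move=> s01 sa ss; set z := zeta tau1 tau2; pose dz t := (tau2 - tau1) * (sin t / 2).
have zd (t : R) : is_derive t 1 z (dz t) by exact: is_derive_zeta.
pose W t := ce (- z t) *: Tm alpha.
pose K t : 'M[C]_l := ((dz t)%:C * - 'i%C)%:M.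
pose Y1 t : 'M[C]_l := ((dz t)%:C * - ('i%C * s%:C))%:M.
have ced (t : R) : cderiv (fun t : R => ce (- (z t))) t ((dz t)%:C * (- 'i%C * ce (- z t))).
  exact: cderiv_comp (cderiv_ce1 (z t)) (zd t).
have P := @mellin_transport R l W K (fun=> 0) Y1 (fun=> x) (fun t => ce (- (s * z t)) *: y) s.
have := P _ _ _ _ _ _ _ _ s01 0 pi (pi_gt0 R).
rewrite /W /z zeta0 zetapi; apply.
- move=> t; have := mderivZ (ced t) (mderiv_cst (Tm alpha) t).
  rewrite scaler0 addr0 /K /W mul_scalar_mx scalerA.
  by rewrite mulrA.
- by move=> t; rewrite mulmx0; exact: mderiv_cst.
- move=> t; have := mderivZ (cderiv_comp (cderiv_ceN s (z t)) (zd t)) (mderiv_cst y t).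
  by rewrite scaler0 addr0 /Y1 mul_scalar_mx scalerA mulrA.
- move=> i j; rewrite /K.
  apply: (@fa_ext _ _ (@ccont R R) (fun t => (dz t)%:C * (- 'i%C * (1%:M : 'M[C]_l) i j))).
    by move=> t; rewrite !mxE mulrA mulr_natr.
  apply: (fa_mul (@ccont_algebra R R)); last exact: fa_cst (@ccont_algebra R R) _.
  by split=> /=; [exact: dzeta_continuous|move=> ?; exact: cvg_cst].
- by move=> t; rewrite /K mul_scalar_mx mul_mx_scalar.
- by move=> t; rewrite /Y1 mul_scalar_mx mul_mx_scalar.
- by move=> t; rewrite add0r /K /Y1 scale_scalar_mx; congr (_%:M); ring.
- by move=> t u u0; apply: (shift_unit rV) => //; exact: ss.
Qed.

(** The deformation by [W = ce (- phi) Tm phi] along the angle. At [phi = 0]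
    it is the identity, where the integral is an explicit multiple of [x y]. *)
Lemma angle_transport (s alpha : R) x y :
  0 < s < 1 -> 0 < alpha -> transport alpha s x y ->
  asym (cint^~ (mellin_kernel s (ce (- alpha) *: Tm alpha) (x alpha)
                  (ce (- (s * alpha)) *: y alpha)))
       (fun L => (cweight s L)%:C * (x 0 *m y 0) 0 0).
Proof.
move=> s01 a0 [p [q [pq H]]]; set z := zeta 0 alpha.
pose dz t := (alpha - 0) * (sin t / 2).
have zd (t : R) : is_derive t 1 z (dz t) by exact: is_derive_zeta.
have zI t : 0 <= z t <= alpha by apply: zeta_sub; exact: ltW.
pose W t := ce (- z t) *: Tm (z t).
pose K t : 'M[C]_l := (dz t)%:C *: (Nm (z t) - 'i%C%:M).
pose X1 t : 'M[C]_l := (dz t)%:C *: (p *: Nm (z t)).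
pose Y1 t : 'M[C]_l := (dz t)%:C *: (q *: Nm (z t) - ('i%C * s%:C)%:M).
have NW t : Nm (z t) *m W t = W t *m Nm (z t).
  by rewrite /W -scalemxAr -scalemxAl (Nm_comm rV).
have E0 L : cint L (mellin_kernel s (ce (- 0) *: Tm 0) (x 0) (ce (- (s * 0)) *: y 0))
   = (cweight s L)%:C * (x 0 *m y 0) 0 0.
  rewrite (rotated_sin0 V (sin0 R)) mulr0 oppr0 ce0 scale1r -cint_real.
    by congr cint; apply/funext => o; rewrite mellin_kernel1.
  exact: weight_continuous.
have P := @mellin_transport R l W K X1 Y1 (x \o z) (fun t => ce (- (s * z t)) *: y (z t)) s.
have := P _ _ _ _ _ _ _ _ s01 0 pi (pi_gt0 R).
rewrite /W /z /= zeta0 zetapi -/z => Q.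
have -> : (fun L => (cweight s L)%:C * (x 0 *m y 0) 0 0) =
  (cint^~ (mellin_kernel s (ce (- 0) *: Tm 0) (x 0) (ce (- (s * 0)) *: y 0))).
  by apply/funext => L; rewrite E0.
apply: Q.
- move=> t; have d := mderivZ (cderiv_ce1 (z t)) (mderiv_Tm V (z t)).
  apply: mderiv_eq (mderiv_comp d (zd t)) _.
  have -> : K t *m W t = (dz t)%:C *: (ce (- z t) *: Td (z t)
      - ('i%C * ce (- z t)) *: Tm (z t)).
    by rewrite /K /W -scalemxAl mulmxBl mul_scalar_mx -scalemxAr (NmTm rV) scalerA.
  by rewrite mulNr scaleNr addrC.
- move=> t; have [dx _] := H _ (zI t); apply: mderiv_eq (mderiv_comp dx (zd t)) _.
  by rewrite /X1 -!scalemxAr.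
- move=> t; have [_ dy] := H _ (zI t).
  apply: mderiv_eq (mderiv_comp (mderivZ (cderiv_ceN s (z t)) dy) (zd t)) _.
  have -> : Y1 t *m (ce (- (s * z t)) *: y (z t)) = (dz t)%:C *:
      (ce (- (s * z t)) *: (q *: (Nm (z t) *m y (z t)))
      - ('i%C * s%:C * ce (- (s * z t))) *: y (z t)).
    rewrite /Y1 -scalemxAl mulmxBl mul_scalar_mx -scalemxAl -scalemxAr.
    by rewrite !scalerA [q * _]mulrC.
  by rewrite mulNr scaleNr addrC.
- move=> i j; rewrite /K.
  have AL := @ccont_algebra R R.
  apply: (mx_inZ AL).
    by split=> /=; [exact: dzeta_continuous|move=> ?; exact: cvg_cst].
  apply: (mx_inB AL); last exact: mx_in_cst.
  move=> i' j'.
  exact: (ccont_comp (f := fun u : R => Nm u i' j') (mx_ccont_Nm rV i' j')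
    (derivable_continuous_R zd)).
- move=> t; rewrite -/(W t) /K; move: (W t) (Nm (z t)) (NW t) => A B AB.
  rewrite -scalemxAl -scalemxAr mulmxBl mulmxBr AB.
  by rewrite mul_scalar_mx mul_mx_scalar.
- move=> t; rewrite -/(W t) /Y1; move: (W t) (Nm (z t)) (NW t) => A B AB.
  rewrite -scalemxAl -scalemxAr mulmxBl mulmxBr -scalemxAl -scalemxAr AB.
  by rewrite mul_scalar_mx mul_mx_scalar.
- move=> t; rewrite /X1 /Y1 /K -scalerDr addrA -scalerDl pq.
  rewrite [RHS]scalerA [s%:C * _]mulrC -[RHS]scalerA; congr (_ *: _).
  by rewrite [RHS]scalerBr scale_scalar_mx [s%:C * _]mulrC.
- by move=> t u u0; exact: (diag_shift_unit rV).
Qed.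

End Paths.

(** * Angles that are multiples of pi *)

Section Trigonometry.
Context {R : realType}.

Lemma sin_int_pi (k : int) : sin (k%:~R * pi) = 0 :> R.
Proof.
have nat_case (n : nat) : sin (n%:R * pi) = 0 :> R.
  elim: n => [|n IH]; first by rewrite mul0r sin0.
  by rewrite -natr1 mulrDl mul1r sinDpi IH oppr0.
case: k => n; first exact: nat_case.
by rewrite NegzE mulrNz mulNr sinN nat_case oppr0.
Qed.

Lemma sin_eq0_int (t : R) : sin t = 0 -> exists k : int, t = k%:~R * pi.
Proof.
move=> st; have p0 := pi_gt0 R; pose k := Num.floor (t / pi); exists k.
have /andP[k1 k2] : k%:~R <= t / pi < (k + 1)%:~R by exact: floor_itv.
pose d := t - k%:~R * pi.
have d0 : 0 <= d by rewrite subr_ge0 -ler_pdivlMr.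
have d1 : d < pi.
  by rewrite ltrBlDr -{1}[pi]mul1r -mulrDl -ltr_pdivrMr // addrC -[1]/(1%:~R) -intrD.
have : sin t = sin d * cos (k%:~R * pi).
  by rewrite -{1}[t](subrK (k%:~R * pi)) -/d sinD sin_int_pi mulr0 addr0.
rewrite st => /esym/eqP; rewrite mulf_eq0 => /orP[/eqP sd|/eqP c0]; last first.
  by have := cos_neq0 (sin_int_pi k); rewrite c0 eqxx.
have [d00|dn0] := eqVneq d 0; first by apply/eqP; rewrite -subr_eq0 -/d d00.
have := @sin_gt0_pi R d; rewrite sd ltxx d1 andbT lt_neqAle eq_sym dn0 d0.
by move/(_ isT).
Qed.

Lemma cos_eqN1_int (t : R) : cos t = -1 -> exists k : int, t = pi + 2 * k%:~R * pi.
Proof.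
move=> ct; have c0 : cos (t / 2) = 0.
  have := cosD (t / 2) (t / 2); have := cos2Dsin2 (t / 2).
  rewrite -splitr ct !expr2 => h1 h2.
  by apply/eqP; rewrite -sqrf_eq0 expr2; apply/eqP; lra.
have [k kE] : exists k : int, t / 2 + pi / 2 = k%:~R * pi.
  by apply: sin_eq0_int; rewrite sinDpihalf.
by exists (k - 1); rewrite intrB; lra.
Qed.

Lemma sin_lt0_pi (t : R) : pi < t < 2 * pi -> sin t < 0.
Proof.
move=> /andP[t1 t2]; have -> : t = (t - pi) + pi by rewrite subrK.
by rewrite sinDpi oppr_lt0 sin_gt0_pi //; apply/andP; split; lra.
Qed.

Lemma sin_le0_pi (t : R) : pi <= t <= 2 * pi -> sin t <= 0.
Proof.
move=> /andP[t1 t2]; have -> : t = (t - pi) + pi by rewrite subrK.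
by rewrite sinDpi oppr_le0 sin_ge0_pi //; apply/andP; split; lra.
Qed.

End Trigonometry.

Section Conclusions.
Context {R : realType} {l : nat}.
Local Notation C := R[i].
Variables (a b G V : 'M[C]_l).
Hypothesis rV : root_of a b G V.
Local Notation Tm := (Tm V).
Local Notation E := (imE G V).
Local Notation transport := (transport V).

(** The product rule; for [s = 0] no power of [Tm] is involved. *)
Lemma transport0_cst alpha x y : 0 <= alpha -> transport alpha 0 x y ->
  (x 0 *m y 0) 0 0 = (x alpha *m y alpha) 0 0.
Proof.
move=> a0 [p [q [pq H]]]; set z := zeta 0 alpha.
have zI t : 0 <= z t <= alpha by exact: zeta_sub.
have d t : cderiv (fun t => (x (z t) *m y (z t)) 0 0) t 0.
  have [dx dy] := H _ (zI t).
  have D := mderiv_comp (mderivM dx dy) (is_derive_zeta 0 alpha t).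
  have : cderiv (fun t => (x (z t) *m y (z t)) 0 0) t
    ((((alpha - 0) * (sin t / 2))%:C *: (p *: (x (z t) *m Nm V (z t)) *m y (z t) +
       x (z t) *m (q *: (Nm V (z t) *m y (z t))))) 0 0) by exact: D.
  rewrite -scalemxAl -scalemxAr mulmxA -scalerDl pq scale0r scaler0 mxE.
  by [].
have -> : x 0 *m y 0 = x (z 0) *m y (z 0) by rewrite /z zeta0.
have -> : x alpha *m y alpha = x (z pi) *m y (z pi) by rewrite /z zetapi.
apply/eqP; rewrite eq_complex; apply/andP; split; apply/eqP.
- apply: (@is_derive_0_is_cst _ (fun t => complex.Re ((x (z t) *m y (z t)) 0 0))).
  by move=> t; case: (d t).
- apply: (@is_derive_0_is_cst _ (fun t => complex.Im ((x (z t) *m y (z t)) 0 0))).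
  by move=> t; case: (d t).
Qed.

Lemma scaled_entry m n (c : C) (M : 'M[C]_(m, n)) i j : (c *: M) i j = c * M i j.
Proof. by rewrite mxE. Qed.

Lemma transport_ext alpha s t x y : s = t -> transport alpha s x y ->
  transport alpha t x y.
Proof. by move=> ->. Qed.

(** The matrix [ce (- alpha) Tm alpha] is 1 here, so for [0 < s < 1] both ends of
    [angle_transport] are multiples of the same real integral. Every other [s] is
    reached by shifts, and the case [s = 0] is [transport0_cst]. *)
Lemma monodromy alpha s x y : 0 < alpha -> sin alpha = 0 -> transport alpha s x y ->
  (x 0 *m y 0) 0 0 = ce (- (s * alpha)) * (x alpha *m y alpha) 0 0.
Proof.
move=> a0 sa.
pose mono s := forall x y, transport alpha s x y ->
  (x 0 *m y 0) 0 0 = ce (- (s * alpha)) * (x alpha *m y alpha) 0 0.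
have cea : ce alpha = (cos alpha)%:C by rewrite /ce sa.
have ceNa : ce (- alpha) = (cos alpha)%:C by rewrite /ce cosN sinN sa oppr0.
have T0 : Tm 0 = 1%:M by rewrite (Tm_sin0 V (sin0 R)) cos0.
have Ta : Tm alpha = ((cos alpha)%:C)%:M by exact: Tm_sin0.
have cc : (cos alpha)%:C * (cos alpha)%:C = 1 :> C by rewrite -{1}ceNa -cea ceN.
have Tai : invmx (Tm alpha) = ((cos alpha)%:C)%:M.
  by rewrite Ta invmx_scalar; congr (_%:M); rewrite -[LHS]mulr1 -cc mulKf // -cea ce_neq0.
have up t : mono t -> mono (t + 1).
  move=> mt x' y' /(transport_Tinv rV) H; move: (mt _ _ (transport_ext (addrK 1 t) H)).
  rewrite T0 invmx1 mul1mx Tai mul_scalar_mx -scalemxAr scaled_entry => ->.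
  have -> : ce (- ((t + 1) * alpha)) = ce (- (t * alpha)) * (cos alpha)%:C.
    by rewrite mulrDl mul1r opprD ceD ceNa.
  by rewrite -mulrA.
have dn t : mono t -> mono (t - 1).
  move=> mt x' y' /(transport_T rV) H; move: (mt _ _ (transport_ext (subrK 1 t) H)).
  rewrite T0 mul1mx Ta mul_scalar_mx -scalemxAr scaled_entry => ->.
  have -> : ce (- ((t - 1) * alpha)) = ce (- (t * alpha)) * (cos alpha)%:C.
    by rewrite mulrBl mul1r opprB addrC ceD cea.
  by rewrite -mulrA.
have base t : 0 <= t < 1 -> mono t.
  move=> /andP[t0 t1] x' y' H; have [tE|tn] := eqVneq t 0.
    rewrite tE mul0r oppr0 ce0 mul1r; apply: transport0_cst; first exact: ltW.
    by rewrite -tE.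
  have t01 : 0 < t < 1 by rewrite lt_neqAle eq_sym tn t0 t1.
  have := angle_transport rV t01 a0 H; rewrite (rotated_sin0 V sa) => As.
  have E1 L : cint L (mellin_kernel t 1%:M (x' alpha) (ce (- (t * alpha)) *: y' alpha))
     = (cweight t L)%:C * (ce (- (t * alpha)) * (x' alpha *m y' alpha) 0 0).
    rewrite -cint_real; last exact: weight_continuous.
    congr cint; apply/funext => o.
    by rewrite mellin_kernel1 -scalemxAr scaled_entry.
  apply/eqP; rewrite -subr_eq0; apply/eqP; apply: (@asym_zero _ t).
  have [M M0 HM] := As; exists M => // L L0; have [h1 h2] := HM L L0.
  rewrite E1 in h1 h2; rewrite mulrBr !subr0 -[X in `|X| <= _ /\ _]opprK.
  split; rewrite -normrN; [move: h1|move: h2];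
    by move: (_ * (x' 0 *m _) 0 0) (_ * (_ * _)) => [u1 u2] [v1 v2] /=; rewrite ?opprD ?opprK // addrC.
have all_int (k : int) t : mono t -> mono (t + k%:~R).
  have natup (n : nat) u : mono u -> mono (u + n%:R).
    elim: n => [|n IH] mu'; first by rewrite addr0.
    by rewrite -natr1 addrA; apply: up; exact: IH.
  have natdn (n : nat) u : mono u -> mono (u - n%:R).
    elim: n => [|n IH] mu'; first by rewrite subr0.
    by rewrite -natr1 opprD addrA; apply: dn; exact: IH.
  by case: k => n mt; [exact: natup|rewrite NegzE mulrNz; exact: natdn].
move=> H; have /andP[k1 k2] := floor_itv s.
have : mono ((s - (Num.floor s)%:~R) + (Num.floor s)%:~R).
  apply: all_int; apply: base; rewrite subr_ge0 k1 /=.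
  by rewrite ltrBlDr addrC -[1]/(1%:~R) -intrD.
by rewrite subrK; apply.
Qed.

End Conclusions.

(** * Signs at the end of the deformation *)

Section Signs.
Context {R : realType} {l : nat}.
Local Notation C := R[i].
Variables (a b G V : 'M[C]_l).
Hypothesis rV : root_of a b G V.
Local Notation Tm := (Tm V).
Local Notation E := (imE G V).
Local Notation transport := (transport V).

Lemma asym_sign_scaled (s k m t : R) (f : R -> C) : ccont f ->
  (forall o, 0 < k * complex.Im (f o)) ->
  asym (fun L => ce t * ((cweight s L)%:C * m%:C)) (cint^~ f) ->
  0 < k * (m * sin t).
Proof.
move=> cf fpos As; rewrite mulrA.
apply: (@asym_sign _ s _ _ (fun o => k%:C * f o)).
- by apply: (fa_mul (@ccont_algebra R R)) => //; exact: fa_cst (@ccont_algebra R R) _.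
- by move=> o; rewrite cImM /= mul0r addr0.
have := asym_scale k%:C As.
have -> : (fun L => k%:C * cint L f) = (cint^~ (fun o => k%:C * f o)).
  by apply/funext => L; rewrite cint_scale.
congr asym; apply/funext => L; rewrite rmorphM /=; ring.
Qed.

Variables (alpha : R) (x : R -> 'rV[C]_l) (c : 'cV[C]_l).
Hypothesis alpha0 : 0 < alpha.
Hypothesis sa : sin alpha != 0.
Hypothesis xa : x alpha = - (hc c *m E).
Hypothesis c0 : c != 0.

Section Target.
Variable tau : R.
Hypothesis st : sin tau = 0.
Hypothesis path : forall t, 0 <= sin (zeta alpha tau t) * sin alpha.

Let ceNt : ce (- tau) = (cos tau)%:C :> C.
Proof. by rewrite /ce cosN sinN st oppr0. Qed.

Let cc : cos tau * cos tau = 1.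
Proof. by have := cos2Dsin2 tau; rewrite st expr0n addr0 expr2. Qed.

Let unitS (u : R) : 0 <= u -> u%:C%:M + (cos tau)%:C *: Tm alpha \in unitmx.
Proof. by move=> u0; rewrite -ceNt; apply: (shift_unit rV) => //; rewrite st mul0r. Qed.

(** Follow the solutions to the end of the angle, then rotate to [tau], where
    the rotated matrix is a real multiple of [Tm alpha]. *)
Lemma end_asym (s : R) y : 0 < s < 1 -> transport alpha s x y ->
  asym (fun L => ce (s * tau) * ((cweight s L)%:C * (x 0 *m y 0) 0 0))
    (cint^~ (mellin_kernel s ((cos tau)%:C *: Tm alpha) (x alpha) (y alpha))).
Proof.
move=> s01 H.
have A1 := angle_transport rV s01 alpha0 H.
have A2 := rotation_transport rV (x alpha) (y alpha) s01 sa path.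
have := asym_scale (ce (s * tau)) (asym_sym (asym_trans A2 A1)).
congr asym; apply/funext => L.
rewrite ceNt.
have -> : mellin_kernel s ((cos tau)%:C *: Tm alpha) (x alpha) (ce (- (s * tau)) *: y alpha)
  = (fun o => ce (- (s * tau)) * mellin_kernel s ((cos tau)%:C *: Tm alpha) (x alpha) (y alpha) o).
  by apply/funext => o; rewrite mellin_kernelZ.
rewrite cint_scale; last exact: mellin_kernel_cont.
by rewrite mulrA [ce _ * ce _]mulrC ceN mul1r.
Qed.

Let Res (o : R) : 'M[C]_l := resolvent ((cos tau)%:C *: Tm alpha) o.

Let Res_form o : exists2 d : R, 0 < d &
  complex.Im ((hc c *m E *m Res o *m c) 0 0) = - (cos tau * sin alpha * d).
Proof.
pose w := Res o *m c.
have uS := unitS (expR_ge0 o).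
have cE : c = (((expR o)%:C)%:M + (cos tau)%:C *: Tm alpha) *m w.
  by rewrite /w /Res /resolvent mulKVmx.
have w0 : w != 0 by apply: contraNneq c0 => w0; rewrite cE w0 mulmx0.
exists (dform G V w); first exact: (dform_gt0 rV).
have -> : hc c *m E *m Res o *m c = hc (hc w *m E *m c).
  by rewrite hcM hcM hcK (imE_hc rV) /w !mulmxA.
have -> : complex.Im ((hc (hc w *m E *m c)) 0 0) = - complex.Im ((hc w *m E *m c) 0 0).
  by rewrite mxE mxE; case: ((hc w *m E *m c) 0 0).
congr (- _); rewrite {1}cE mulmxA.
have -> : ((expR o)%:C)%:M + (cos tau)%:C *: Tm alpha =
    ((expR o + cos tau * cos alpha)%:C)%:M + (cos tau * sin alpha)%:C *: V.
  rewrite rmorphD !rmorphM [(_ + _)%:M]raddfD /= -addrA; congr (_ + _).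
  by rewrite /Tm scalerDr scale_scalar_mx scalerA.
by rewrite (Im_comb rV) /= mul0r add0r.
Qed.

(** The imaginary part of the integrand at the end is that of
    [- hc c E (t + cos tau Tm alpha)^-1 c]. With [w] the resolvent applied to [c] it
    equals [cos tau sin alpha (dform w)]. *)
Lemma sign_direct (s m : R) y : 0 < s < 1 -> transport alpha s x y ->
  y alpha = c -> (x 0 *m y 0) 0 0 = m%:C ->
  0 < cos tau * sin alpha * (m * sin (s * tau)).
Proof.
move=> s01 H yc xy; have As := end_asym s01 H; rewrite xy in As.
apply: asym_sign_scaled As; first exact: mellin_kernel_cont.
move=> o; rewrite /mellin_kernel cImM /= mul0r addr0 xa yc.
have [d d0 dE] := Res_form o.
have -> : complex.Im ((- (hc c *m E) *m Res o *m c) 0 0) = cos tau * sin alpha * d.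
  rewrite !mulNmx -[RHS]opprK -dE mxE.
  by case: ((hc c *m E *m Res o *m c) 0 0).
have k0 : cos tau * sin alpha != 0.
  by rewrite mulf_neq0 //; apply/eqP => h; have := cc; rewrite h mul0r; lra.
rewrite mulrCA mulr_gt0 ?expR_gt0 // mulrA mulr_gt0 // -expr2 lt_def sqr_ge0.
by rewrite sqrf_eq0 k0.
Qed.

(** As in [sign_direct], but with
    [(t + W)^-1 W = 1 - t (t + W)^-1]: the constant term is real, the other one has
    the opposite sign, and [cos tau] now enters as a square. *)
Lemma sign_shifted (s m : R) y : 0 < s < 1 -> transport alpha s x y ->
  y alpha = Tm alpha *m c -> (x 0 *m y 0) 0 0 = m%:C ->
  0 < - sin alpha * (m * sin (s * tau)).
Proof.
move=> s01 H yc xy; have As := end_asym s01 H; rewrite xy in As.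
apply: asym_sign_scaled As; first exact: mellin_kernel_cont.
move=> o; rewrite /mellin_kernel cImM /= mul0r addr0 xa yc.
have [d d0 dE] := Res_form o.
have RT : Res o *m (Tm alpha *m c) =
    (cos tau)%:C *: (c - (expR o)%:C *: (Res o *m c)).
  have uS := unitS (expR_ge0 o).
  rewrite -[LHS]scale1r -[1]/(1%:C) -cc rmorphM -scalerA; congr (_ *: _).
  rewrite [LHS]scalemxAr (scalemxAl _ (Tm alpha)).
  have -> : (cos tau)%:C *: Tm alpha =
     (((expR o)%:C)%:M + (cos tau)%:C *: Tm alpha) - ((expR o)%:C)%:M.
    by rewrite addrC addKr.
  by rewrite mulmxBl mulmxBr mulKmx // mul_scalar_mx scalemxAr.
rewrite -mulmxA RT.
have -> : complex.Im ((- (hc c *m E) *m ((cos tau)%:C *: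
     (c - (expR o)%:C *: (Res o *m c)))) 0 0) = - (expR o * sin alpha * d).
  rewrite -scalemxAr scaled_entry mulNmx mulmxBr opprB -scalemxAr.
  have -> : ((expR o)%:C *: (hc c *m E *m (Res o *m c)) - hc c *m E *m c) 0 0
    = (expR o)%:C * (hc c *m E *m Res o *m c) 0 0 - (hc c *m E *m c) 0 0.
    by rewrite mxE scaled_entry mulmxA; congr (_ + _); rewrite mxE.
  have := E_form_real rV c; move: dE.
  case: ((hc c *m E *m Res o *m c) 0 0) => u1 u2 /= ->.
  case: ((hc c *m E *m c) 0 0) => v1 v2 /= ->.
  rewrite !mul0r !addr0 subr0.
  have -> : cos tau * (expR o * - (cos tau * sin alpha * d)) =
    - ((cos tau * cos tau) * (expR o * sin alpha * d)) by ring.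
  by rewrite cc mul1r.
rewrite mulrN mulrNN mulrCA mulr_gt0 ?expR_gt0 //.
have -> : sin alpha * (expR o * sin alpha * d) = sin alpha ^+ 2 * (expR o * d).
  by ring.
have s2 : 0 < sin alpha ^+ 2 by rewrite lt_def sqrf_eq0 sa sqr_ge0.
exact: mulr_gt0 s2 (mulr_gt0 (expR_gt0 o) d0).
Qed.

End Target.
End Signs.

(** * Consequences for the exponent *)

Section Exponents.
Context {R : realType} {l : nat}.
Local Notation C := R[i].
Variables (a b G V : 'M[C]_l).
Hypothesis rV : root_of a b G V.
Local Notation Tm := (Tm V).
Local Notation E := (imE G V).
Local Notation transport := (transport V).

Variables (alpha s m : R) (x : R -> 'rV[C]_l) (y : R -> 'cV[C]_l) (c : 'cV[C]_l).
Hypothesis alpha0 : 0 < alpha.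
Hypothesis xy : transport alpha s x y.
Hypothesis xa : x alpha = - (hc c *m E).
Hypothesis ya : y alpha = c.
Hypothesis c0 : c != 0.
Hypothesis m0 : (x 0 *m y 0) 0 0 = m%:C.

Let pi0 : 0 < pi :> R. Proof. exact: pi_gt0. Qed.

Lemma zeta_between (p q lo hi t : R) : lo <= p <= hi -> lo <= q <= hi ->
  lo <= zeta p q t <= hi.
Proof.
move=> /andP[p1 p2] /andP[q1 q2].
have c1 := cos_le1 t; have c2 := cos_geN1 t.
set w := (1 - cos t) / 2; have w0 : 0 <= w by rewrite /w; lra.
have w1 : 0 <= 1 - w by rewrite /w; lra.
have -> : zeta p q t = (1 - w) * p + w * q by rewrite /zeta -/w; ring.
apply/andP; split.
  have h1 := ler_wpM2l w1 p1; have h2 := ler_wpM2l w0 q1.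
  by move: h1 h2; lra.
have h1 := ler_wpM2l w1 p2; have h2 := ler_wpM2l w0 q2.
by move: h1 h2; lra.
Qed.

Lemma pairing_s0 : s = 0 -> m < 0.
Proof.
move=> s0; have := transport0_cst (ltW alpha0) (transport_ext s0 xy).
rewrite m0 xa ya mulNmx => mE.
have := E_form_gt0 rV c0; have : m = - complex.Re ((hc c *m E *m c) 0 0).
  have := congr1 (fun z => complex.Re z) mE; rewrite /= => ->; rewrite mxE.
  by case: ((hc c *m E *m c) 0 0).
by move=> ->; rewrite oppr_lt0.
Qed.

(** Here [e] is [hc c E c], which is positive; the statement is the real and
    the imaginary part of [monodromy]. *)
Lemma pairing_mono : sin alpha = 0 ->
  exists2 e : R, 0 < e & m = - (cos (s * alpha) * e) /\ sin (s * alpha) = 0.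
Proof.
move=> sa; have := monodromy rV alpha0 sa xy.
rewrite m0 xa ya mulNmx => mE.
have e0 := E_form_gt0 rV c0; exists (complex.Re ((hc c *m E *m c) 0 0)) => //.
have := E_form_real rV c; move: e0 mE.
have -> : (- (hc c *m E *m c)) 0 0 = - (hc c *m E *m c) 0 0 by rewrite mxE.
case: ((hc c *m E *m c) 0 0) => e1 e2 /= e0 mE e2E.
move: mE; rewrite e2E /ce cosN sinN.
have -> : (cos (s * alpha) -i* sin (s * alpha)) * - (e1 +i* 0)
  = (- (cos (s * alpha) * e1)) +i* (sin (s * alpha) * e1) :> C.
  by apply/eqP; rewrite eq_complex /=; apply/andP; split; apply/eqP; ring.
move=> [-> /esym/eqP]; rewrite mulf_eq0 (gt_eqF e0) orbF => /eqP ->.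
by [].
Qed.

(* A negative s is moved into [0, 1] by one shift. *)
Let yT phi := Tm phi *m y phi.
Let xyT : transport alpha (s + 1) x yT. Proof. exact: (transport_T rV xy). Qed.
Let m0T : (x 0 *m yT 0) 0 0 = m%:C.
Proof. by rewrite /yT (Tm_sin0 V (sin0 R)) cos0 mul1mx. Qed.

(** Rotate to [tau = 0]: then [sin (s tau) = 0], which contradicts
    [sign_direct] if [0 < s < 1] and [sign_shifted] if [-1 < s < 0]. If [s] is 1 or -1,
    a shift leads to the exponent 0, and the real number [m] would equal a pairing
    whose imaginary part is [sin alpha] or its opposite times a value of
    [dform]. *)
Lemma no_exponent_convex : alpha < pi -> -1 <= s <= 1 -> s = 0.
Proof.
move=> api /andP[s1 s2].
have sa0 : 0 < sin alpha by apply: sin_gt0_pi; rewrite alpha0.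
have sa : sin alpha != 0 by rewrite gt_eqF.
have path t : 0 <= sin (zeta alpha 0 t) * sin alpha.
  rewrite mulr_ge0 ?(ltW sa0) // sin_ge0_pi //.
  by apply: zeta_between; rewrite ?lexx ?ltW.
have dcE : hc c *m E *m Tm alpha *m c = hc c *m E *m
    ((cos alpha)%:C%:M + (sin alpha)%:C *: V) *m c by [].
case: (ltgtP s 0) => // sn.
- case: (ltgtP s (-1)) => // [|s1'|sN]; first by lra.
  + have s01 : 0 < s + 1 < 1 by lra.
    have := sign_shifted rV alpha0 sa xa c0 (sin0 R) path s01 xyT _ m0T.
    by rewrite /yT ya => /(_ erefl); rewrite mulr0 sin0 !mulr0 ltxx.
  have := transport0_cst (ltW alpha0) (transport_ext _ xyT).
  rewrite m0T xa /yT ya mulNmx mulmxA => /(_ _)/(congr1 (fun z => complex.Im z)).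
  have -> : complex.Im ((- (hc c *m E *m Tm alpha *m c)) 0 0)
     = - complex.Im ((hc c *m E *m Tm alpha *m c) 0 0).
    by rewrite mxE; case: ((hc c *m E *m Tm alpha *m c) 0 0).
  rewrite dcE (Im_comb rV) /= mul0r add0r.
  have := dform_gt0 rV c0 => d0 H.
  have : 0 < sin alpha * dform G V c by rewrite mulr_gt0.
  have := H; rewrite sN addNr => /(_ erefl); lra.
- case: (ltgtP s 1) => // [s1'||sN]; last 1 first.
  + pose y' phi := invmx (Tm phi) *m y phi.
    have H := transport_Tinv rV xy.
    have m0' : (x 0 *m y' 0) 0 0 = m%:C.
      by rewrite /y' (Tm_sin0 V (sin0 R)) cos0 invmx1 mul1mx.
    have s10 : s - 1 = 0 by rewrite sN subrr.
    have := transport0_cst (ltW alpha0) (transport_ext s10 H).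
    rewrite -/(y' _) m0' xa /y' ya mulNmx.
    move=> /(congr1 (fun z => complex.Im z)).
    pose w := invmx (Tm alpha) *m c.
    have cE : c = Tm alpha *m w by rewrite /w mulKVmx ?(Tm_unit rV).
    have w0 : w != 0 by apply: contraNneq c0 => w0; rewrite cE w0 mulmx0.
    have -> : complex.Im ((- (hc c *m E *m w)) 0 0)
       = complex.Im ((hc w *m E *m c) 0 0).
      have -> : hc c *m E *m w = hc (hc w *m E *m c).
        by rewrite hcM hcM hcK (imE_hc rV) !mulmxA.
      move: (hc w *m E *m c) => Q.
      by rewrite 3!mxE; case: (Q 0 0) => u1 u2 /=; rewrite opprK.
    rewrite {1}cE mulmxA (Im_comb rV) /= mul0r add0r => H0.
    have d0 := dform_gt0 rV w0.
    have : 0 < sin alpha * dform G V w by rewrite mulr_gt0.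
    by rewrite -H0 ltxx.
  + have s01 : 0 < s < 1 by lra.
    have := sign_direct rV alpha0 sa xa c0 (sin0 R) path s01 xy ya m0.
    by rewrite mulr0 sin0 !mulr0 ltxx.
  + lra.
Qed.

(** Compare [tau = pi] and [tau = 2 pi]. If [0 < s <= 1/2],
    [sign_direct] gives opposite signs to [m sin (s pi)] and [m sin (2 s pi)], although
    neither sine is negative. If [-1/2 <= s < 0], [sign_shifted] gives the same sign to
    [m sin ((s + 1) pi)] and [m sin (2 (s + 1) pi)], although the first sine is positive and
    the second one is not. *)
Lemma no_exponent_reentrant : pi < alpha < 2 * pi -> - 2^-1 <= s <= 2^-1 -> s = 0.
Proof.
move=> /andP[a1 a2] /andP[s1 s2].
have sa0 : sin alpha < 0 by apply: sin_lt0_pi; rewrite a1.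
have sa : sin alpha != 0 by rewrite lt_eqF.
have path tau t : pi <= tau <= 2 * pi -> 0 <= sin (zeta alpha tau t) * sin alpha.
  move=> tI; rewrite mulr_le0 ?(ltW sa0) // sin_le0_pi //.
  by apply: zeta_between => //; rewrite !ltW.
have path1 t : 0 <= sin (zeta alpha pi t) * sin alpha by apply: path; lra.
have path2 t : 0 <= sin (zeta alpha (2 * pi) t) * sin alpha by apply: path; lra.
have s2p : sin (2 * pi) = 0 :> R by rewrite mulrC mulr_natr sin2pi.
have c2p : cos (2 * pi) = 1 :> R by rewrite mulrC mulr_natr cos2pi.
case: (ltgtP s 0) => // sn.
- have s01 : 0 < s + 1 < 1 by lra.
  have yTa : yT alpha = Tm alpha *m c by rewrite /yT ya.
  have h1 := sign_shifted rV alpha0 sa xa c0 (sinpi R) path1 s01 xyT yTa m0T.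
  have h2 := sign_shifted rV alpha0 sa xa c0 s2p path2 s01 xyT yTa m0T.
  move: h1 h2; rewrite !(pmulr_rgt0 _ (x := - sin alpha)) ?oppr_gt0 // => h1 h2.
  have sp : 0 < sin ((s + 1) * pi).
    by rewrite sin_gt0_pi // pmulr_rgt0 ?pi0; nra.
  have mp : 0 < m by move: h1; rewrite pmulr_lgt0.
  have := h2; rewrite pmulr_rgt0 // ltNge sin_le0_pi //; nra.
- have s01 : 0 < s < 1 by lra.
  have h1 := sign_direct rV alpha0 sa xa c0 (sinpi R) path1 s01 xy ya m0.
  have h2 := sign_direct rV alpha0 sa xa c0 s2p path2 s01 xy ya m0.
  move: h1 h2; rewrite cospi c2p mulN1r mul1r.
  rewrite (pmulr_rgt0 _ (x := - sin alpha)) ?oppr_gt0 //.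
  rewrite (nmulr_rgt0 _ sa0) => h1 h2.
  have sp : 0 < sin (s * pi).
    by rewrite sin_gt0_pi //; nra.
  have mp : 0 < m by move: h1; rewrite pmulr_lgt0.
  have := h2; rewrite pmulr_rlt0 // ltNge sin_ge0_pi //; nra.
Qed.

End Exponents.

(** * Uniqueness for linear systems *)

Section Gronwall.
Context {R : realType} {l : nat}.
Local Notation C := R[i].

Let sq (z : C) : R := complex.Re z ^+ 2 + complex.Im z ^+ 2.

Let sq_ge0 z : 0 <= sq z.
Proof. by rewrite addr_ge0 ?sqr_ge0. Qed.

Let sq_bound (u w A : C) (M : R) : `|complex.Re A| <= M -> `|complex.Im A| <= M ->
  `|complex.Re (conjc u * (A * w))| <= M * (sq u + sq w).
Proof.
case: u w A => [u1 u2] [w1 w2] [a1 a2] /=; rewrite /sq /= => h1 h2.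
have q (p1 p2 r1 r2 : R) : `|p1 * r1 + p2 * r2| <= (p1 ^+ 2 + p2 ^+ 2 + (r1 ^+ 2 + r2 ^+ 2)) / 2.
  have s1 := sqr_ge0 (p1 - r1); have s2 := sqr_ge0 (p2 - r2).
  have s3 := sqr_ge0 (p1 + r1); have s4 := sqr_ge0 (p2 + r2).
  rewrite ler_norml; apply/andP; split; move: s1 s2 s3 s4; rewrite !expr2; nra.
have -> : u1 * (a1 * w1 - a2 * w2) - - u2 * (a1 * w2 + a2 * w1)
   = a1 * (u1 * w1 + u2 * w2) - a2 * (u1 * w2 + - u2 * w1) by ring.
rewrite (le_trans (ler_normB _ _)) // !normrM.
have q1 := q u1 u2 w1 w2; have q2 := q u1 (- u2) w2 w1.
rewrite sqrrN in q2.
rewrite (_ : u1 ^+ 2 + u2 ^+ 2 + (w2 ^+ 2 + w1 ^+ 2) = u1 ^+ 2 + u2 ^+ 2 + (w1 ^+ 2 + w2 ^+ 2)) in q2; last by ring.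
have k1 := ler_pM (normr_ge0 a1) (normr_ge0 _) h1 q1.
have k2 := ler_pM (normr_ge0 a2) (normr_ge0 _) h2 q2.
by rewrite (le_trans (lerD k1 k2)) // -mulrDr -splitr.
Qed.

Let nrm (y : 'cV[C]_l) : R := \sum_i sq (y i 0).

Let nrmE y : ((hc y *m y) 0 0) = (nrm y)%:C.
Proof.
rewrite mxE rmorph_sum; apply: eq_bigr => i _; rewrite !mxE.
by case: (y i 0) => u v; apply/eqP; rewrite eq_complex /sq /=; apply/andP; split;
  apply/eqP; ring.
Qed.

Let sq_le (y : 'cV[C]_l) i : sq (y i 0) <= nrm y.
Proof. by rewrite /nrm (bigD1 i) //= lerDl sumr_ge0. Qed.

(** Gronwall's argument: for a large constant [K] the function
    [|y|^2 exp (K t)] is nondecreasing, and it vanishes at [alpha]. *)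
Lemma linear_ode_unique (A : R -> 'M[C]_l) (y : R -> 'cV[C]_l) (alpha : R) :
  mx_in ccont A -> 0 <= alpha ->
  (forall t : R, 0 <= t <= alpha -> mderiv y t (A t *m y t)) ->
  y alpha = 0 -> forall t, 0 <= t <= alpha -> y t = 0.
Proof.
move=> cA a0 dy ya.
have [M M0 HM] : exists2 M : R, 0 <= M & forall t i j, 0 <= t <= alpha ->
    `|complex.Re (A t i j)| <= M /\ `|complex.Im (A t i j)| <= M.
  have /(_ _ _)/cid2 B : forall i j, exists2 M : R, 0 <= M & forall t, 0 <= t <= alpha ->
    `|complex.Re (A t i j)| <= M /\ `|complex.Im (A t i j)| <= M.
    move=> i j.
    have [M M0 HM] := ccont_bounded 0 alpha 0 0
      (ccont_comp (cA i j) (@fst_continuous R)).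
    by exists M => // t tI; apply: (HM t 0); rewrite ?lexx.
  exists (\sum_i \sum_j s2val (B i j)).
    by apply: sumr_ge0 => i _; apply: sumr_ge0 => j _; exact: (s2valP (B i j)).
  move=> t i j tI; have [h1 h2] := s2valP' (B i j) t tI.
  have le : s2val (B i j) <= \sum_i \sum_j s2val (B i j).
    rewrite (bigD1 i) //= (bigD1 j) //= -addrA lerDl addr_ge0 //.
      by apply: sumr_ge0 => j' _; exact: (s2valP (B i j')).
    by apply: sumr_ge0 => i' _; apply: sumr_ge0 => j' _; exact: (s2valP (B i' j')).
  by split; [exact: le_trans h1 le|exact: le_trans h2 le].
(* The derivative of |y|^2 is at most K |y|^2 in absolute value. *)
pose K : R := 2 * (\sum_(i < l) \sum_(j < l) (2 * M)).
pose f t := nrm (y t).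
pose f' t := 2 * complex.Re ((hc (y t) *m (A t *m y t)) 0 0).
have fd (t : R) : 0 <= t <= alpha -> is_derive t 1 f (f' t).
  move=> tI; have d := mderivM (mderiv_hc (dy t tI)) (dy t tI).
  have [d1 _] := d 0 0; move: d1.
  have -> : (fun s => complex.Re ((hc (y s) *m y s) 0 0)) = f.
    by apply/funext => z; rewrite nrmE.
  congr (is_derive _ _ _ _).
  have -> : hc (A t *m y t) *m y t = hc (hc (y t) *m (A t *m y t)).
    by rewrite [RHS]hcM hcK.
  rewrite mxE cReD /f' mulr_natl mulr2n; congr (_ + _).
  by rewrite mxE mxE; case: ((hc (y t) *m (A t *m y t)) 0 0).
have f'b t : 0 <= t <= alpha -> `|f' t| <= K * f t.
  move=> tI; rewrite /f' normrM (ger0_norm (x := 2)) // /K -mulrA ler_pM2l //.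
  have -> : (hc (y t) *m (A t *m y t)) 0 0
     = \sum_i \sum_j conjc (y t i 0) * (A t i j * y t j 0).
    rewrite mxE; apply: eq_bigr => i _; rewrite !mxE big_distrr /=.
    by [].
  have ReS (I : Type) (r : seq I) (F : I -> C) :
     complex.Re (\sum_(i <- r) F i) = \sum_(i <- r) complex.Re (F i).
    by elim: r => [|i r IH]; rewrite ?big_nil // !big_cons cReD IH.
  rewrite ReS mulr_suml (le_trans (ler_norm_sum _ _ _)) // ler_sum // => i _.
  rewrite ReS mulr_suml (le_trans (ler_norm_sum _ _ _)) // ler_sum // => j _.
  have [h1 h2] := HM t i j tI; apply: le_trans (sq_bound _ _ h1 h2) _.
  rewrite [2 * M]mulrC -mulrA ler_wpM2l // mulr_natl mulr2n lerD //; exact: sq_le.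
pose g t := f t * expR (K * t).
have gd (t : R) : 0 <= t <= alpha -> is_derive t 1 g ((f' t + K * f t) * expR (K * t)).
  move=> tI.
  have dl : is_derive t 1 (fun t : R => K * t) K.
    have := deriv_mul (is_derive_cst K t 1) (is_derive_id t (1 : R)).
    by rewrite mul0r add0r mulr1.
  have de := is_derive1_comp (is_derive_expR (K * t)) dl.
  by apply: (is_derive_eq (deriv_mul (fd t tI) de)); rewrite /=; ring.
have gcont : {within `[0, alpha], continuous g}.
  apply: derivable_within_continuous => t; rewrite in_itv /= => tI.
  by case: (gd t tI).
have gmono t : 0 <= t <= alpha -> g t <= g alpha.
  move=> /andP[t0 t1].
  apply: (@ger0_derive1_le_cc _ g 0 alpha) => //.
  - move=> z; rewrite in_itv /= => /andP[z0 z1].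
    by case: (gd z) => //; rewrite !ltW.
  - move=> z; rewrite in_itv /= => /andP[z0 z1].
    have zI : 0 <= z <= alpha by rewrite !ltW.
    rewrite derive1E; have [_ ->] := gd z zI.
    rewrite mulr_ge0 ?expR_ge0 //.
    by have := f'b z zI; rewrite ler_norml => /andP[h _]; rewrite -lerBlDr sub0r.
  - by rewrite in_itv /= t0 t1.
  - by rewrite in_itv /= a0 lexx.
move=> t tI; have := gmono t tI.
have -> : g alpha = 0.
  rewrite /g /f /nrm ya big1 ?mul0r // => i _.
  by rewrite mxE /sq /= expr0n addr0.
rewrite pmulr_lle0 ?expR_gt0 // => ft.
apply/matrixP => i j; rewrite mxE ord1.
have : sq (y t i 0) <= 0 by exact: le_trans (sq_le (y t) i) ft.
rewrite /sq; case: (y t i 0) => u v /= h.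
have : u ^+ 2 + v ^+ 2 == 0 by rewrite eq_le h addr_ge0 ?sqr_ge0.
by rewrite paddr_eq0 ?sqr_ge0 // !sqrf_eq0 => /andP[/eqP -> /eqP ->].
Qed.

End Gronwall.

(** * Polar derivatives of homogeneous functions *)

Section PolarDerivatives.
Context {R : realType} {l : nat}.
Local Notation C := R[i].
Implicit Types (F : R -> 'cV[C]_l).

Lemma derive1_is_derive (f : R -> R) (t : R) : derivable f t 1 ->
  is_derive t 1 f ((f^`())%classic t).
Proof. by move=> d; apply: DeriveDef => //; rewrite derive1E. Qed.

Lemma vderiveE F (t : R) D : mderiv F t D -> vderive F t = D.
Proof.
move=> d; apply/matrixP => i j; rewrite mxE !derive1E ord1.
have [[_ ->] [_ ->]] := d i 0; by case: (D i 0).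
Qed.

Lemma vsmooth_mderiv F (t : R) : vsmooth F -> mderiv F t (vderive F t).
Proof.
move=> sF i j; rewrite ord1 mxE; have [d1 d2] := sF i 0%N t.
by split; exact: derive1_is_derive.
Qed.

Lemma vsmooth_mderiv2 F (t : R) : vsmooth F ->
  mderiv (vderive F) t (vderive (vderive F) t).
Proof.
move=> sF i j; rewrite ord1 mxE; have [d1 d2] := sF i 1%N t.
have e1 : (fun s => complex.Re (vderive F s i 0)) =
    ((fun s => complex.Re (F s i 0))^`())%classic by apply/funext => s; rewrite mxE.
have e2 : (fun s => complex.Im (vderive F s i 0)) =
    ((fun s => complex.Im (F s i 0))^`())%classic by apply/funext => s; rewrite mxE.
split; [rewrite e1|rewrite e2]; apply: derive1_is_derive; [exact: d1|exact: d2].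
Qed.

Lemma mderiv_near m n (F G : R -> 'M[C]_(m, n)) (t : R) D :
  (\forall s \near t, F s = G s) -> mderiv F t D -> mderiv G t D.
Proof.
move=> FG d i j; have [d1 d2] := d i j; split.
- by apply: near_eq_is_derive d1; apply: filterS FG => s ->.
- by apply: near_eq_is_derive d2; apply: filterS FG => s ->.
Qed.

Lemma cpowR1 (mu : C) : cpowR 1 mu = 1.
Proof. by rewrite /cpowR ln1 !mulr0 expR0 cos0 sin0 mulr0 mulr1. Qed.

Lemma cpowR_sub1 (r : R) (mu : C) : 0 < r ->
  cpowR r (mu - 1) = (r^-1)%:C * cpowR r mu.
Proof.
move=> r0; case: mu => u w; rewrite /cpowR /= subr0 mulrBl mul1r expRB lnK ?posrE //.
by apply/eqP; rewrite eq_complex /=; apply/andP; split; apply/eqP; ring.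
Qed.

Lemma cderiv_cpowR (r : R) (mu : C) : 0 < r ->
  cderiv (fun s => cpowR s mu) r (mu * cpowR r (mu - 1)).
Proof.
move=> r0; rewrite cpowR_sub1 //; case: mu => u w.
have dl (k : R) : is_derive r 1 (fun s : R => k * ln s) (k * r^-1).
  have dc : is_derive r 1 (fun _ : R => k) (0 : R) by exact: is_derive_cst.
  by apply: (is_derive_eq (deriv_mul dc (is_derive1_ln r0))); rewrite mul0r add0r.
have de := is_derive1_comp (f := expR) (g := fun s : R => u * ln s)
  (is_derive_expR (u * ln r)) (dl u).
have dc := is_derive1_comp (f := @cos R) (g := fun s : R => w * ln s)
  (is_derive_cos (w * ln r)) (dl w).
have ds := is_derive1_comp (f := @sin R) (g := fun s : R => w * ln s)
  (is_derive_sin (w * ln r)) (dl w).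
split; rewrite /cpowR /=.
- by apply: (is_derive_eq (deriv_mul de dc)); rewrite /=; ring.
- by apply: (is_derive_eq (deriv_mul de ds)); rewrite /=; ring.
Qed.

Lemma dr_homogeneous (u : polar_fun) (mu : C) (w : R -> 'cV[C]_l) (r phi : R) :
  (forall r phi, 0 < r -> u r phi = cpowR r mu *: w phi) -> 0 < r ->
  dr u r phi = cpowR r (mu - 1) *: (mu *: w phi).
Proof.
move=> uE r0; apply: vderiveE.
apply: (@mderiv_near _ _ (fun s => cpowR s mu *: w phi)).
  by apply: filterS (lt_nbhsr r0) => s s0; rewrite uE.
have := mderivZ (cderiv_cpowR mu r0) (mderiv_cst (w phi) r).
by rewrite scaler0 addr0 scalerA mulrC.
Qed.

Lemma dphi_homogeneous (u : polar_fun) (mu : C) (w : R -> 'cV[C]_l) (r phi : R) w' :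
  (forall r phi, 0 < r -> u r phi = cpowR r mu *: w phi) -> 0 < r ->
  mderiv w phi w' -> dphi u r phi = cpowR r mu *: w'.
Proof.
move=> uE r0 dw; apply: vderiveE.
have -> : (fun s => u r s) = (fun s => cpowR r mu *: w s).
  by apply/funext => s; rewrite uE.
have := mderivZ (cderiv_cst (cpowR r mu) phi) dw.
by rewrite scale0r add0r.
Qed.

Lemma dx_homogeneous (u : polar_fun) (mu : C) (w w' : R -> 'cV[C]_l) :
  (forall r phi, 0 < r -> u r phi = cpowR r mu *: w phi) ->
  (forall phi, mderiv w phi (w' phi)) ->
  (forall r phi, 0 < r -> dx1 u r phi = cpowR r (mu - 1) *:
     ((mu * (cos phi)%:C) *: w phi - (sin phi)%:C *: w' phi)) /\
  (forall r phi, 0 < r -> dx2 u r phi = cpowR r (mu - 1) *: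
     ((mu * (sin phi)%:C) *: w phi + (cos phi)%:C *: w' phi)).
Proof.
move=> uE dw; split=> r phi r0.
- rewrite /dx1 (dr_homogeneous _ uE r0) (dphi_homogeneous uE r0 (dw phi)).
  rewrite scalerBr !scalerA cpowR_sub1 // rmorphM /=; congr (_ *: _ - _ *: _); ring.
- rewrite /dx2 (dr_homogeneous _ uE r0) (dphi_homogeneous uE r0 (dw phi)).
  rewrite scalerDr !scalerA cpowR_sub1 // rmorphM /=; congr (_ *: _ + _ *: _); ring.
Qed.

End PolarDerivatives.

(** * Reduction of the model problem to two first order systems *)

Section Factorization.
Context {R : realType} {l : nat}.
Local Notation C := R[i].
Local Notation cj := (map_mx conjc).

(** The coefficients are real, so [conj V] solves the same
    quadratic equation as [V]. *)
Lemma root_solvent_conj (a b G V : 'M[C]_l) : root_of a b G V ->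
  G *m cj V *m cj V + 2 *: b *m cj V + a = 0.
Proof.
move=> rV; have := congr1 cj (root_solvent rV).
rewrite !map_mxD !map_mxM cjZ (root_realG rV) (root_realb rV) (root_reala rV).
by rewrite map_mx0 (conjc_nat R 2).
Qed.

(** Here [a1], [a2] are the x1-derivatives and [b1], [b2] the
    x2-derivatives of the two parts of the gradient. By the quadratic equation, the
    defect [e = b1 - V a1], which is [conj V a2 - b2] by compatibility, satisfies
    [G (V - conj V) e = 0]. *)
Lemma solvent_split (a b G V : 'M[C]_l) (a1 a2 b1 b2 : 'cV[C]_l) :
  root_of a b G V ->
  b1 + b2 = V *m a1 + cj V *m a2 ->
  a *m (a1 + a2) + b *m (V *m a1 + cj V *m a2) + b *m (b1 + b2)
    + G *m (V *m b1 + cj V *m b2) = 0 ->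
  b1 = V *m a1 /\ b2 = cj V *m a2.
Proof.
move=> rV cmp; rewrite cmp => sys.
have e2 : b2 - cj V *m a2 = - (b1 - V *m a1).
  apply/eqP; rewrite -addr_eq0 addrACA [b2 + b1]addrC cmp addrC -opprD.
  by rewrite [cj V *m a2 + _]addrC addNr.
have [e eE] : exists e, e = b1 - V *m a1 by exists (b1 - V *m a1).
rewrite -eE in e2.
have b1E : b1 = V *m a1 + e by rewrite eE addrC subrK.
have b2E : b2 = cj V *m a2 - e by rewrite -e2 addrC subrK.
have aE1 : a *m a1 = - (G *m (V *m (V *m a1)) + 2 *: (b *m (V *m a1))).
  apply/eqP; rewrite -addr_eq0 addrC; apply/eqP.
  have := congr1 (mulmx^~ a1) (root_solvent rV); rewrite !mulmxDl mul0mx.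
  by rewrite -!scalemxAl !mulmxA.
have aE2 : a *m a2 = - (G *m (cj V *m (cj V *m a2)) + 2 *: (b *m (cj V *m a2))).
  apply/eqP; rewrite -addr_eq0 addrC; apply/eqP.
  have := congr1 (mulmx^~ a2) (root_solvent_conj rV); rewrite !mulmxDl mul0mx.
  by rewrite -!scalemxAl !mulmxA.
have : G *m (imW V *m e) = 0.
  rewrite -sys (mulmxDr a) aE1 aE2 b1E b2E /imW mulmxBl !mulmxDr !mulmxN.
  move: (G *m (V *m (V *m a1))) (G *m (cj V *m (cj V *m a2))) (b *m (V *m a1)).
  move: (b *m (cj V *m a2)) (G *m (V *m e)) (G *m (cj V *m e)) => X1 X2 X3 X4 X5 X6.
  by apply/matrixP => i j; rewrite !mxE; ring.
move/(congr1 (mulmx (invmx G))); rewrite mulKmx ?(pos_unit (root_posG rV)) // mulmx0.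
move/(congr1 (mulmx (invmx (imW V)))); rewrite mulKmx ?(imW_unit rV) // mulmx0 => e0.
by rewrite b1E b2E e0 addr0 subr0.
Qed.

Lemma Tm_conj (V : 'M[C]_l) (t : R) : cj (Tm (cj V) t) = Tm V t.
Proof.
apply/matrixP => i j; rewrite !mxE; case: (V i j) => x y.
by case: (i == j); apply/eqP; rewrite eq_complex /=; apply/andP; split; apply/eqP; ring.
Qed.

Lemma Td_conj (V : 'M[C]_l) (t : R) : cj (Td (cj V) t) = Td V t.
Proof.
apply/matrixP => i j; rewrite !mxE; case: (V i j) => x y.
by case: (i == j); apply/eqP; rewrite eq_complex /=; apply/andP; split; apply/eqP; ring.
Qed.

Lemma conj_angular (V : 'M[C]_l) (t : R) (mu : C) (w w' : 'cV[C]_l) :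
  Tm (cj V) t *m w' = (mu - 1) *: (Td (cj V) t *m w) ->
  Tm V t *m cj w' = (conjc mu - 1) *: (Td V t *m cj w).
Proof.
move/(congr1 cj); rewrite cjZ !map_mxM Tm_conj Td_conj => ->.
by rewrite rmorphB rmorph1.
Qed.

End Factorization.

Lemma mderiv_tr (R : realType) m n (F : R -> 'M[R[i]]_(m, n)) (t : R) D :
  mderiv F t D -> mderiv (fun s => (F s)^T) t D^T.
Proof. by move=> FD i j; rewrite mxE; under eq_fun do rewrite mxE; exact: FD. Qed.

Lemma mderiv_conj (R : realType) m n (F : R -> 'M[R[i]]_(m, n)) (t : R) D :
  mderiv F t D -> mderiv (fun s => map_mx conjc (F s)) t (map_mx conjc D).
Proof.
move=> FD i j; rewrite mxE; under eq_fun do rewrite mxE.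
exact: cderiv_conj (FD i j).
Qed.

Section RadialReduction.
Context {R : realType} {l : nat}.
Local Notation C := R[i].
Variables (A : mx_triple R l) (alpha : R) (lam : C) (v : R -> 'cV[C]_l).
Hypothesis sol : solves_mixed A alpha lam v.
Hypothesis alpha0 : 0 < alpha.

Local Notation a := (mxC (A11 A)).
Local Notation b := (mxC (A12 A)).
Local Notation G := (mxC (A22 A)).

(** The Cartesian gradient of [r^lam v] is [r^(lam - 1)] times
    [(grad1, grad2)]. *)
Definition grad1 phi : 'cV[C]_l :=
  (lam * (cos phi)%:C) *: v phi - (sin phi)%:C *: vderive v phi.
Definition grad2 phi : 'cV[C]_l :=
  (lam * (sin phi)%:C) *: v phi + (cos phi)%:C *: vderive v phi.
Local Notation p := grad1.
Local Notation q := grad2.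

Definition grad1' (phi : R) : 'cV[C]_l :=
  (lam * (- sin phi)%:C) *: v phi + (lam * (cos phi)%:C) *: vderive v phi
  - ((cos phi)%:C *: vderive v phi + (sin phi)%:C *: vderive (vderive v) phi).
Definition grad2' (phi : R) : 'cV[C]_l :=
  (lam * (cos phi)%:C) *: v phi + (lam * (sin phi)%:C) *: vderive v phi
  + ((- sin phi)%:C *: vderive v phi + (cos phi)%:C *: vderive (vderive v) phi).
Local Notation p' := grad1'.
Local Notation q' := grad2'.

Let sv : vsmooth v. Proof. by case: sol. Qed.

Let dlam (f : R -> R) (t d : R) : is_derive t 1 f d ->
  cderiv (fun s => lam * (f s)%:C) t (lam * d%:C).
Proof.
move=> fd; have := cderivM (cderiv_cst lam t) (cderiv_real fd).
by rewrite mul0r add0r.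
Qed.

Lemma grad1_deriv (phi : R) : mderiv p phi (p' phi).
Proof.
have d1 := mderivZ (dlam (is_derive_cos phi)) (vsmooth_mderiv phi sv).
have d2 := mderivZ (cderiv_real (is_derive_sin phi)) (vsmooth_mderiv2 phi sv).
exact: mderivD d1 (mderivN d2).
Qed.

Lemma grad2_deriv (phi : R) : mderiv q phi (q' phi).
Proof.
have d1 := mderivZ (dlam (is_derive_sin phi)) (vsmooth_mderiv phi sv).
have d2 := mderivZ (cderiv_real (is_derive_cos phi)) (vsmooth_mderiv2 phi sv).
exact: mderivD d1 d2.
Qed.

Let D1 (w w' : 'cV[C]_l) (phi : R) : 'cV[C]_l :=
  ((lam - 1) * (cos phi)%:C) *: w - (sin phi)%:C *: w'.
Let D2 (w w' : 'cV[C]_l) (phi : R) : 'cV[C]_l :=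
  ((lam - 1) * (sin phi)%:C) *: w + (cos phi)%:C *: w'.

Let compat phi : D2 (p phi) (p' phi) phi = D1 (q phi) (q' phi) phi.
Proof.
rewrite /D1 /D2 /grad1 /grad2 /grad1' /grad2'.
move: (v phi) (vderive v phi) (vderive (vderive v) phi) => v0 v1 v2.
by apply/matrixP => i j; rewrite !mxE rmorphN; ring.
Qed.

Let u := homogeneous_fun lam v.

Let uE r phi : 0 < r -> u r phi = cpowR r lam *: v phi.
Proof. by []. Qed.

Let dxu := dx_homogeneous uE (fun phi => vsmooth_mderiv phi sv).

Let dxdx := dx_homogeneous dxu.1 grad1_deriv.
Let dxdy := dx_homogeneous dxu.2 grad2_deriv.

Let system phi : 0 <= phi <= alpha ->
  a *m D1 (p phi) (p' phi) phi + b *m D1 (q phi) (q' phi) phi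
  + b *m D2 (p phi) (p' phi) phi + G *m D2 (q phi) (q' phi) phi = 0.
Proof.
move=> pI; have [_ H _ _] := sol; have := H 1 phi ltr01 pI.
rewrite /elliptic_op !(dxdx.1, dxdx.2, dxdy.1, dxdy.2) ?ltr01 //.
by rewrite cpowR1 !scale1r.
Qed.

Let neumann : b *m p 0 + G *m q 0 = 0.
Proof.
have [_ _ H _] := sol; have := H 1 ltr01.
rewrite /conormal sin0 cos0 oppr0 !scale0r !scale1r !add0r.
by rewrite (dxu.1 _ _ ltr01) (dxu.2 _ _ ltr01) cpowR1 !scale1r.
Qed.

Let dirichlet : v alpha = 0.
Proof.
have [_ _ _ H] := sol; have := H 1 ltr01.
by rewrite /homogeneous_fun cpowR1 scale1r.
Qed.

Variable V : 'M[C]_l.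
Hypothesis rV : root_of a b G V.
Local Notation cj := (map_mx conjc).
Local Notation W := (imW V).
Local Notation E := (imE G V).

(** The solution of [p = P1 + P2], [q = V P1 + conj V P2]. *)
Definition part1 phi : 'cV[C]_l := invmx W *m (q phi - cj V *m p phi).
Definition part2 phi : 'cV[C]_l := p phi - part1 phi.
Local Notation P1 := part1.
Local Notation P2 := part2.

Let uW := imW_unit rV.

Let pE phi : p phi = P1 phi + P2 phi.
Proof. by rewrite /part2 addrC subrK. Qed.

Let qE phi : q phi = V *m P1 phi + cj V *m P2 phi.
Proof.
rewrite /part2 mulmxBr addrCA -mulmxBl -/W /part1 mulKVmx // addrC.
by rewrite subrK.
Qed.

Definition part1' phi : 'cV[C]_l := invmx W *m (q' phi - cj V *m p' phi).
Definition part2' phi : 'cV[C]_l := p' phi - part1' phi.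
Local Notation P1' := part1'.
Local Notation P2' := part2'.

Let dP1 (phi : R) : mderiv P1 phi (P1' phi).
Proof.
have d1 := mderivM (mderiv_cst (cj V) phi) (grad1_deriv phi).
have d2 := mderivM (mderiv_cst (invmx W) phi) (mderivD (grad2_deriv phi) (mderivN d1)).
by apply: mderiv_eq d2 _; rewrite !mul0mx !add0r.
Qed.

Let dP2 (phi : R) : mderiv P2 phi (P2' phi).
Proof. exact: mderivD (grad1_deriv phi) (mderivN (dP1 phi)). Qed.

Let qE' phi : q' phi = V *m P1' phi + cj V *m P2' phi.
Proof.
rewrite /part2' mulmxBr addrCA -mulmxBl -/W /part1' mulKVmx // addrC.
by rewrite subrK.
Qed.

Let pE' phi : p' phi = P1' phi + P2' phi.
Proof. by rewrite /part2' addrC subrK. Qed.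

Let D1D w1 w2 w1' w2' phi : D1 (w1 + w2) (w1' + w2') phi = D1 w1 w1' phi + D1 w2 w2' phi.
Proof. by rewrite /D1 !scalerDr opprD addrACA. Qed.
Let D2D w1 w2 w1' w2' phi : D2 (w1 + w2) (w1' + w2') phi = D2 w1 w1' phi + D2 w2 w2' phi.
Proof. by rewrite /D2 !scalerDr addrACA. Qed.
Let D1M (M : 'M[C]_l) w w' phi : D1 (M *m w) (M *m w') phi = M *m D1 w w' phi.
Proof. by rewrite /D1 mulmxBr -!scalemxAr. Qed.
Let D2M (M : 'M[C]_l) w w' phi : D2 (M *m w) (M *m w') phi = M *m D2 w w' phi.
Proof. by rewrite /D2 mulmxDr -!scalemxAr. Qed.

Let first_order phi : 0 <= phi <= alpha ->
  D2 (P1 phi) (P1' phi) phi = V *m D1 (P1 phi) (P1' phi) phi /\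
  D2 (P2 phi) (P2' phi) phi = cj V *m D1 (P2 phi) (P2' phi) phi.
Proof.
move=> pI; have sys := system pI; have cmp := compat phi.
have eD1p : D1 (p phi) (p' phi) phi = D1 (P1 phi) (P1' phi) phi + D1 (P2 phi) (P2' phi) phi.
  by rewrite (pE phi) (pE' phi); exact: D1D.
have eD2p : D2 (p phi) (p' phi) phi = D2 (P1 phi) (P1' phi) phi + D2 (P2 phi) (P2' phi) phi.
  by rewrite (pE phi) (pE' phi); exact: D2D.
have eD1q : D1 (q phi) (q' phi) phi =
    V *m D1 (P1 phi) (P1' phi) phi + cj V *m D1 (P2 phi) (P2' phi) phi.
  rewrite (qE phi) (qE' phi).
  exact: etrans (D1D (V *m P1 phi) (cj V *m P2 phi) (V *m P1' phi) (cj V *m P2' phi) phi)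
    (congr2 +%R (D1M V (P1 phi) (P1' phi) phi) (D1M (cj V) (P2 phi) (P2' phi) phi)).
have eD2q : D2 (q phi) (q' phi) phi =
    V *m D2 (P1 phi) (P1' phi) phi + cj V *m D2 (P2 phi) (P2' phi) phi.
  rewrite (qE phi) (qE' phi).
  exact: etrans (D2D (V *m P1 phi) (cj V *m P2 phi) (V *m P1' phi) (cj V *m P2' phi) phi)
    (congr2 +%R (D2M V (P1 phi) (P1' phi) phi) (D2M (cj V) (P2 phi) (P2' phi) phi)).
rewrite eD1p eD1q eD2p eD2q in sys; rewrite eD2p eD1q in cmp.
exact: (solvent_split rV cmp sys).
Qed.

(** The compatibility of the second derivatives and the elliptic system are
    two equations for the two parts of the gradient, and [solvent_split] decouples
    them. The second part is conjugated, so that both follow the same pencil. *)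
Lemma radial_parts : exists P Q : R -> 'cV[C]_l,
  [/\ forall phi, p phi = P phi + cj (Q phi),
      forall phi, q phi = V *m P phi + cj (V *m Q phi),
      b *m p 0 + G *m q 0 = 0, v alpha = 0
    & forall phi, 0 <= phi <= alpha -> exists w z : 'cV[C]_l,
        [/\ mderiv P phi w, Tm V phi *m w = (lam - 1) *: (Td V phi *m P phi),
            mderiv Q phi z
          & Tm V phi *m z = (conjc lam - 1) *: (Td V phi *m Q phi)]].
Proof.
exists P1, (fun phi => cj (P2 phi)).
have step (X : 'M[C]_l) w w' phi : D2 w w' phi = X *m D1 w w' phi ->
    Tm X phi *m w' = (lam - 1) *: (Td X phi *m w).
  rewrite /D1 /D2 mulmxBr -!scalemxAr /Tm /Td !mulmxDl !mul_scalar_mx -!scalemxAl.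
  move: (X *m w) (X *m w') => Xw Xw'.
  move=> /(congr1 (fun Y => Y + (sin phi)%:C *: Xw' - ((lam - 1) * (sin phi)%:C) *: w)).
  rewrite subrK [_ *: w + _]addrC addrAC addrK => ->.
  apply/matrixP => i j; rewrite !mxE rmorphN; ring.
split=> [phi|phi|||phi pI].
- by rewrite map_conjK pE.
- by rewrite map_mxM map_conjK qE.
- exact: neumann.
- exact: dirichlet.
have [f1 f2] := first_order pI.
exists (P1' phi), (cj (P2' phi)); split.
- exact: dP1.
- exact: step f1.
- exact: mderiv_conj (dP2 phi).
- exact: conj_angular (step (cj V) _ _ phi f2).
Qed.

End RadialReduction.

(** * The pairing of a solution of the mixed problem *)

Lemma comb_tr (R : rcfType) l (F V : 'M[R[i]]_l) (z w : R[i]) :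
  F *m V = V^T *m F -> (z%:M + w *: V)^T *m F = F *m (z%:M + w *: V).
Proof.
move=> FV; rewrite linearD linearZ /= tr_scalar_mx mulmxDl mulmxDr -scalemxAl -FV.
by rewrite -scalemxAr scalar_mxC.
Qed.

Lemma half_real (R : rcfType) (X p q : R[i]) : 2 * X = p + conjc q ->
  complex.Im p = 0 -> complex.Im q = 0 ->
  X = (2^-1 * complex.Re (p + conjc q))%:C.
Proof.
case: p q => [p1 p2] [q1 q2] /= N p0 q0; rewrite p0 q0 in N.
have -> : X = 2^-1 * (2 * X) by rewrite mulrA mulVf ?mul1r // pnatr_eq0.
have -> : (2^-1 : R[i]) = (2^-1 : R)%:C by rewrite fmorphV rmorph_nat.
by rewrite N; apply/eqP; rewrite eq_complex /=; apply/andP; split; apply/eqP; ring.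
Qed.

Section Angular.
Context {R : realType} {l : nat}.
Local Notation C := R[i].
Local Notation cj := (map_mx conjc).
Variables (a b G V : 'M[C]_l).
Hypothesis rV : root_of a b G V.
Local Notation E := (imE G V).
Local Notation M := (dtnM G V).

Lemma hform_real (H : 'M[C]_l) (c : 'cV[C]_l) : hc H = H ->
  complex.Im ((hc c *m H *m c) 0 0) = 0.
Proof.
move=> hH; have : hc (hc c *m H *m c) = hc c *m H *m c by rewrite !hcM hcK hH mulmxA.
move/matrixP/(_ 0 0); rewrite mxE [in LHS]mxE.
by case: ((hc c *m H *m c) 0 0) => x y [] /=; lra.
Qed.

Lemma pos_form_ge0 (H : 'M[C]_l) (c : 'cV[C]_l) : pos_form H ->
  0 <= complex.Re ((hc c *m H *m c) 0 0).
Proof.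
move=> pH; have [->|/pH] := eqVneq c 0; first by rewrite mulmx0 mxE.
by rewrite ltcE /= => /andP[_ /ltW].
Qed.

Lemma E_Tm t : (Tm V t)^T *m E = E *m Tm V t.
Proof. exact: comb_tr (imE_V rV). Qed.

Lemma E_Td t : (Td V t)^T *m E = E *m Td V t.
Proof. exact: comb_tr (imE_V rV). Qed.

Lemma E_Nm t : (Nm V t)^T *m E = E *m Nm V t.
Proof.
have uT := Tm_unit rV t; apply: (can_inj (mulKmx (_ : (Tm V t)^T \in unitmx))).
  by rewrite unitmx_tr.
by rewrite mulmxA -trmx_mul (NmTm rV) E_Td mulmxA E_Tm -mulmxA (TmNm rV).
Qed.

(** Passing from [P] to [Tm P] turns the exponent [mu - 1] into [mu]. *)
Lemma angular_deriv (P : R -> 'cV[C]_l) (mu : C) (t : R) w : mderiv P t w ->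
  Tm V t *m w = (mu - 1) *: (Td V t *m P t) ->
  mderiv (fun s => Tm V s *m P s) t (mu *: (Nm V t *m (Tm V t *m P t))).
Proof.
move=> dP H; apply: mderiv_eq (mderivM (mderiv_Tm V t) dP) _.
rewrite (mulmxA (Nm V t)) (NmTm rV) H.
by rewrite -{1}[Td V t *m P t]scale1r -scalerDl addrC subrK.
Qed.

Lemma Tm0 : Tm V 0 = 1%:M.
Proof. by rewrite Tm_sin0 ?sin0 // cos0. Qed.

Lemma neumann_dtn : b + G *m V = 'i%C *: M.
Proof.
rewrite /dtnM scalerA.
have -> : 'i%C * (2 * 'i%C)^-1 = 2^-1 :> C.
  by rewrite invfM mulrCA mulfV ?i_neq0 // mulr1.
have -> : G *m V - hc V *m G = 2 *: (b + G *m V).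
  have -> : hc V *m G = - (2 *: b) - G *m V by rewrite -(root_sum rV) addrC addKr.
  by rewrite opprB opprK addrA -mulr2n -scaler_nat addrC scalerDr.
by rewrite scalerA mulVf ?scale1r // pnatr_eq0.
Qed.

Lemma neumann_conj : b + G *m cj V = - ('i%C *: cj M).
Proof.
have := congr1 cj neumann_dtn.
rewrite cjZ map_mxD map_mxM (root_realb rV) (root_realG rV) => ->.
by rewrite -scaleNr; congr (_ *: _); apply/eqP; rewrite eq_complex /= oppr0 !eqxx.
Qed.

(** The Neumann condition reads [M P = conj M conj Q], and
    [M + conj M = 2 E]. So twice the pairing is the sum of the values of two
    hermitian forms. *)
Lemma neumann_pairing (P Q : 'cV[C]_l) :
  b *m (P + cj Q) + G *m (V *m P + cj (V *m Q)) = 0 ->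
  2 * (Q^T *m E *m P) 0 0 = (hc P *m M *m P) 0 0 + conjc ((hc Q *m M *m Q) 0 0).
Proof.
move=> N.
have MPQ : M *m P = cj M *m cj Q.
  have : (b + G *m V) *m P + (b + G *m cj V) *m cj Q = 0.
    by rewrite -N !mulmxDl !mulmxDr map_mxM !mulmxA addrACA.
  rewrite neumann_dtn neumann_conj mulNmx -!scalemxAl -scalerBr.
  move/eqP; rewrite scaler_eq0 (negPf (@i_neq0 R)) /= subr_eq0.
  by move/eqP.
have hcM' : hc (cj M) = cj M by rewrite /hc map_conjK -[LHS]conj_hc (dtnM_hc rV).
have e1 : Q^T = hc (cj Q) by rewrite /hc map_conjK.
have e2 : conjc ((hc Q *m M *m Q) 0 0) = (Q^T *m cj M *m cj Q) 0 0.
  have -> : Q^T *m cj M *m cj Q = cj (hc Q *m M *m Q) by rewrite !map_mxM conj_hc.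
  by rewrite [RHS]mxE.
have e3 : hc P *m M *m P = Q^T *m cj M *m P.
  by rewrite -[in LHS](dtnM_hc rV) -hcM MPQ hcM hcM' e1.
have sum : 2 * (Q^T *m E *m P) 0 0 = (Q^T *m cj M *m P) 0 0 + (Q^T *m cj M *m cj Q) 0 0.
  have -> : 2 * (Q^T *m E *m P) 0 0 = (Q^T *m (2 *: E) *m P) 0 0.
    by rewrite -[in RHS]scalemxAr -[in RHS]scalemxAl [RHS]mxE.
  rewrite -(dtnM_conj rV) mulmxDr mulmxDl [LHS]mxE addrC; congr (_ + _).
  by rewrite -!mulmxA MPQ.
have e4 : (hc P *m M *m P) 0 0 = (Q^T *m cj M *m P) 0 0 by rewrite e3.
exact: etrans sum (congr2 +%R (esym e4) (esym e2)).
Qed.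

Lemma tr_transport (mu : C) (t : R) (z : R -> 'cV[C]_l) :
  mderiv z t (mu *: (Nm V t *m z t)) ->
  mderiv (fun s => (z s)^T *m E) t (mu *: ((z t)^T *m E *m Nm V t)).
Proof.
move=> dz; have := mderivM (mderiv_tr dz) (mderiv_cst E t).
move=> d; apply: mderiv_eq d _.
have -> : (mu *: (Nm V t *m z t))^T = mu *: ((z t)^T *m (Nm V t)^T).
  by rewrite -trmx_mul; apply/matrixP => i j; rewrite !mxE.
by rewrite mulmx0 addr0 -scalemxAl -mulmxA E_Nm mulmxA.
Qed.

Lemma angular_vanish (alpha : R) (P : R -> 'cV[C]_l) (mu : C) : 0 <= alpha ->
  (forall t, 0 <= t <= alpha -> mderiv P t (mu *: (Nm V t *m P t))) ->
  P alpha = 0 -> forall t, 0 <= t <= alpha -> P t = 0.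
Proof.
move=> a0 dP; apply: (linear_ode_unique (A := fun t => mu *: Nm V t)) => //.
  apply: (mx_inZ (ccont_algebra R)); last exact: mx_ccont_Nm rV.
  exact: fa_cst (ccont_algebra R) _.
by move=> t /dP; rewrite scalemxAl.
Qed.

End Angular.

Section Pairing.
Context {R : realType} {l : nat}.
Local Notation C := R[i].
Local Notation cj := (map_mx conjc).
Variables (A : mx_triple R l) (alpha : R) (lam : C) (v : R -> 'cV[C]_l).
Hypothesis sol : solves_mixed A alpha lam v.
Hypothesis alpha0 : 0 < alpha.
Local Notation a := (mxC (A11 A)).
Local Notation b := (mxC (A12 A)).
Local Notation G := (mxC (A22 A)).
Variable V : 'M[C]_l.
Hypothesis rV : root_of a b G V.
Local Notation E := (imE G V).
Local Notation M := (dtnM G V).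

(** Zero gradient means [lam v = 0] and [v' = 0]. The latter suffices, as [v]
    vanishes at [alpha]; this includes [lam = 0]. *)
Lemma mixed_vanish :
  (forall t : R, 0 <= t <= alpha -> grad1 lam v t = 0 /\ grad2 lam v t = 0) ->
  v alpha = 0 -> forall t, 0 <= t <= alpha -> v t = 0.
Proof.
move=> H va; have sv : vsmooth v by case: sol.
have rec t : 0 <= t <= alpha -> lam *: v t = 0 /\ vderive v t = 0.
  move=> /H; rewrite /grad1 /grad2.
  have cs : (cos t)%:C * (cos t)%:C + (sin t)%:C * (sin t)%:C = 1 :> C.
    by rewrite -!rmorphM -rmorphD -!expr2 cos2Dsin2.
  move: (cos t)%:C (sin t)%:C cs => c s cs; move: (v t) (vderive v t) => v0 v1 [g1 g2].
  split.
  - have <- : c *: ((lam * c) *: v0 - s *: v1) + s *: ((lam * s) *: v0 + c *: v1)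
        = lam *: v0.
      rewrite -[in RHS](mulr1 lam) -cs.
      by apply/matrixP => i j; rewrite !mxE; ring.
    by rewrite g1 g2 !scaler0 addr0.
  - have <- : - s *: ((lam * c) *: v0 - s *: v1) + c *: ((lam * s) *: v0 + c *: v1)
        = v1.
      rewrite -[in RHS](scale1r v1) -cs.
      by apply/matrixP => i j; rewrite !mxE; ring.
    by rewrite g1 g2 !scaler0 addr0.
apply: (linear_ode_unique (A := fun=> 0)) => //.
- apply: (mx_in_cst (ccont_algebra R)).
- exact: ltW.
- by move=> t /rec[_ d]; rewrite mul0mx -d; exact: vsmooth_mderiv.
Qed.

(** Take [y = Tm P] and [x = (Tm Q)^T E]. The sum of [Tm P] and the
    conjugate of [Tm Q] is [lam v], so the Dirichlet condition makes them opposite at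
    [alpha]. Were both zero there, they would vanish throughout. *)
Lemma mixed_pairing : (exists2 t : R, 0 <= t <= alpha & v t != 0) ->
  exists x y (c : 'cV[C]_l) (m : R),
  [/\ transport V alpha (2 * complex.Re lam) x y,
      x alpha = - (hc c *m E) /\ y alpha = c, c != 0, (x 0 *m y 0) 0 0 = m%:C
    & pos_form M -> 0 <= m].
Proof.
move=> [t0 t0I vt0]; have [P [Q [pE qE neu dir ode]]] := radial_parts sol rV.
pose y t := Tm V t *m P t; pose z t := Tm V t *m Q t.
have dy t : 0 <= t <= alpha -> mderiv y t (lam *: (Nm V t *m y t)).
  by move=> /ode[w [w' [d e _ _]]]; exact: (angular_deriv rV d e).
have dz t : 0 <= t <= alpha -> mderiv z t (conjc lam *: (Nm V t *m z t)).
  by move=> /ode[w [w' [_ _ d e]]]; exact: (angular_deriv rV d e).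
have yz t : y t + cj (z t) = lam *: v t.
  have -> : lam *: v t = (cos t)%:C *: grad1 lam v t + (sin t)%:C *: grad2 lam v t.
    have cs : (cos t)%:C * (cos t)%:C + (sin t)%:C * (sin t)%:C = 1 :> C.
      by rewrite -!rmorphM -rmorphD -!expr2 cos2Dsin2.
    rewrite /grad1 /grad2 -[in LHS](mulr1 lam) -cs.
    by apply/matrixP => i j; rewrite !mxE; ring.
  rewrite pE qE /y /z /Tm !mulmxDl !mul_scalar_mx -!scalemxAl map_mxD !cjZ !conjc_real.
  move: (P t) (cj (Q t)) (V *m P t) (cj (V *m Q t)) => X1 X2 X3 X4.
  by rewrite !scalerDr addrACA.
have ends : cj (z alpha) = - y alpha.
  by apply/eqP; rewrite -addr_eq0 addrC yz dir scaler0.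
pose m := 2^-1 * complex.Re ((hc (P 0) *m M *m P 0) 0 0 + conjc ((hc (Q 0) *m M *m Q 0) 0 0)).
exists (fun t => (z t)^T *m E), y, (y alpha), m; split.
- exists (conjc lam), lam; split.
    by case: (lam) => p q; apply/eqP; rewrite eq_complex /= addNr eqxx andbT; apply/eqP; ring.
  by move=> t tI; split; [exact: (tr_transport rV (dz t tI))|exact: dy].
- split=> //; have -> : (z alpha)^T = hc (cj (z alpha)) by rewrite /hc map_conjK.
  by rewrite ends hcN mulNmx.
- apply/negP => /eqP ya; case/negP: vt0; apply/eqP.
  have y0 : forall t, 0 <= t <= alpha -> y t = 0 by exact: (angular_vanish rV (ltW alpha0) dy ya).
  have z0 : forall t, 0 <= t <= alpha -> z t = 0.
    apply: (angular_vanish rV (ltW alpha0) dz).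
    by rewrite -[LHS]map_conjK ends ya oppr0 map_mx0.
  apply: mixed_vanish t0I => // t tI.
  have P0 : P t = 0 by rewrite -[LHS](mulKmx (Tm_unit rV t)) -/(y t) y0 // mulmx0.
  have Q0 : Q t = 0 by rewrite -[LHS](mulKmx (Tm_unit rV t)) -/(z t) z0 // mulmx0.
  by rewrite pE qE P0 Q0 !mulmx0 map_mx0 addr0.
- rewrite pE qE in neu; have N := neumann_pairing rV neu.
  rewrite /y /z Tm0 !mul1mx.
  by apply: (half_real N); apply: hform_real; exact: dtnM_hc rV.
- move=> pM; rewrite /m mulr_ge0 ?invr_ge0 ?ler0n //.
  have := pos_form_ge0 (P 0) pM; have := pos_form_ge0 (Q 0) pM.
  case: ((hc (P 0) *m M *m P 0) 0 0) => p1 p2; case: ((hc (Q 0) *m M *m Q 0) 0 0) => q1 q2 /=.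
  by move=> *; rewrite addr_ge0.
Qed.

End Pairing.

(** * Real data and the standard root *)

Section Realification.
Context {R : rcfType}.
Local Notation C := R[i].
Local Notation cj := (map_mx conjc).
Local Notation rc := (map_mx (real_complex R)).

Lemma conj_mxC m n (M : 'M[R]_(m, n)) : cj (rc M) = rc M.
Proof. by apply/matrixP => i j; rewrite !mxE conjc_real. Qed.

Lemma hc_mxC m n (M : 'M[R]_(m, n)) : hc (rc M) = (rc M)^T.
Proof. by rewrite /hc conj_mxC. Qed.

Lemma mxC_split m n (M : 'M[C]_(m, n)) :
  M = rc (map_mx (@complex.Re R) M) + 'i%C *: rc (map_mx (@complex.Im R) M).
Proof.
apply/matrixP => i j; rewrite !mxE; case: (M i j) => x y /=.
by apply/eqP; rewrite eq_complex /=; apply/andP; split; apply/eqP; ring.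
Qed.

Lemma posdef_pos_form l (M : 'M[R]_l) : M^T = M ->
  (forall x : 'cV[R]_l, x != 0 -> 0 < (x^T *m M *m x) 0 0) -> pos_form (rc M).
Proof.
move=> sM pM x x0.
have xE := mxC_split x; move: xE; set u := map_mx _ x; set w := map_mx _ x => xE.
have uw : w^T *m M *m u = u^T *m M *m w.
  have -> : w^T *m M *m u = (u^T *m M *m w)^T by rewrite !trmx_mul trmxK sM mulmxA.
  by apply/matrixP => i j; rewrite mxE !ord1.
have cE (p q : 'cV[R]_l) : (rc p)^T *m rc M *m rc q = rc (p^T *m M *m q).
  by rewrite map_trmx -!map_mxM.
have hx : hc x = (rc u)^T - 'i%C *: (rc w)^T.
  rewrite {1}xE hcD hcZ !hc_mxC -scaleNr; congr (_ + _ *: _).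
  by apply/eqP; rewrite eq_complex /= oppr0 !eqxx.
have val : hc x *m rc M *m x = rc (u^T *m M *m u + w^T *m M *m w)
    + 'i%C *: rc (u^T *m M *m w - w^T *m M *m u).
  rewrite hx {1}xE !mulmxBl !mulmxDr -!scalemxAl -!scalemxAr !cE.
  apply/matrixP => i j; rewrite !mxE.
  set p := \sum_j _; set q := \sum_j _; set r := \sum_j _; set s := \sum_j _.
  by apply/eqP; rewrite eq_complex /=; apply/andP; split; apply/eqP; ring.
have -> : (hc x *m rc M *m x) 0 0
    = ((u^T *m M *m u) 0 0 + (w^T *m M *m w) 0 0)%:C.
  by rewrite val uw subrr map_mx0 scaler0 addr0 mxE; congr (_%:C); rewrite mxE.
have ge0 (p : 'cV[R]_l) : 0 <= (p^T *m M *m p) 0 0.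
  have [->|/pM/ltW //] := eqVneq p 0; by rewrite mulmx0 mxE.
rewrite ltcR; have [u0|/pM u0] := eqVneq u 0; last first.
  by rewrite ltr_pwDl.
rewrite ltr_wpDl // pM //; apply: contraNneq x0 => w0.
by rewrite xE u0 w0 !map_mx0 scaler0 addr0.
Qed.

End Realification.

Section Similarity.
Context {R : rcfType} {l : nat}.
Local Notation C := R[i].

Lemma similar_eigenvalue (S X : 'M[C]_l) z : S \in unitmx ->
  eigenvalue (invmx S *m X *m S) z -> eigenvalue X z.
Proof.
move=> uS /eigenvalueP[u uX u0]; apply/eigenvalueP; exists (u *m invmx S).
  by have := congr1 (mulmx^~ (invmx S)) uX; rewrite !mulmxA mulmxK // -scalemxAl.
apply: contraNneq u0 => /(congr1 (mulmx^~ S)).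
by rewrite mulmxKV // mul0mx => ->.
Qed.

(** Conjugating by the square root [S] of [G] moves the factor [S] from
    both ends of the factorization of the symbol to its middle. *)
Lemma denormalized_root (a b G S W : 'M[C]_l) : S \in unitmx -> hc S = S ->
  real_mx G -> G^T = G -> pos_form G -> real_mx a -> real_mx b -> G = S *m S ->
  a = S *m hc W *m W *m S -> 2 *: b = - (S *m hc W *m S + S *m W *m S) ->
  (forall z, eigenvalue W z -> 0 < complex.Im z) ->
  root_of a b G (invmx S *m W *m S).
Proof.
move=> uS hS rG sG pG ra rb GE aE bE upW.
have hV : hc (invmx S *m W *m S) = S *m hc W *m invmx S.
  by rewrite !hcM hc_inv hS mulmxA.
split; [exact: rG|exact: sG|exact: pG|exact: ra|exact: rb| | |].
- rewrite hV bE opprK addrC; congr (_ + _).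
    by rewrite GE !mulmxA mulmxKV.
  by rewrite GE -!mulmxA mulKVmx.
- rewrite hV GE aE -!mulmxA.
  by rewrite mulKmx // mulKVmx.
- by move=> z /(similar_eigenvalue uS); exact: upW.
Qed.

End Similarity.

Section EllipticRoot.
Context {R : realType}.
Local Notation C := R[i].

Lemma elliptic_root m (A : mx_triple R m.+1) : elliptic A ->
  exists V, root_of (mxC (A11 A)) (mxC (A12 A)) (mxC (A22 A)) V.
Proof.
move=> [s12 p11 p22 ell].
apply: root_exists; rewrite ?map_trmx; try exact: conj_mxC.
- by case: p22 => ->.
- by case: p22 => *; exact: posdef_pos_form.
- by case: p11 => ->.
- by case: p11 => *; exact: posdef_pos_form.
- by rewrite s12.
move=> x; have := ell 1 x; rewrite xpair_eqE oner_eq0 => /(_ isT) d.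
have -> : mxC (A11 A) + (2 * x%:C) *: mxC (A12 A) + x%:C ^+ 2 *: mxC (A22 A)
    = mxC (symbolR A 1 x).
  rewrite /symbolR /mxC !map_mxD !map_mxZ /= expr1n mulr1 scale1r.
  by rewrite rmorphM rmorphXn /= rmorph_nat.
by rewrite /mxC det_map_mx fmorph_eq0.
Qed.

Lemma symbol_expand l (S Wc W : 'M[C]_l) (x1 x2 : C) :
  S *m (x1 *: Wc - x2%:M) *m (x1 *: W - x2%:M) *m S
  = x1 ^+ 2 *: (S *m Wc *m W *m S) - (x1 * x2) *: (S *m Wc *m S + S *m W *m S)
    + x2 ^+ 2 *: (S *m S).
Proof.
rewrite mulmxBr -scalemxAr mul_mx_scalar mulmxBr mul_mx_scalar !mulmxBl -!scalemxAr.
rewrite -!scalemxAl !mulmxBl -!scalemxAl.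
move: (S *m Wc *m W *m S) (S *m S) (S *m Wc *m S) (S *m W *m S) => X1 X2 X3 X4.
by apply/matrixP => i j; rewrite !mxE; ring.
Qed.

(** Evaluation at (1, 0), (0, 1) and (1, 1). *)
Lemma symbol_coef l (a b G S Wc W : 'M[C]_l) :
  (forall x1 x2 : C, x1 ^+ 2 *: a + (2 * x1 * x2) *: b + x2 ^+ 2 *: G =
     S *m (x1 *: Wc - x2%:M) *m (x1 *: W - x2%:M) *m S) ->
  [/\ G = S *m S, a = S *m Wc *m W *m S & 2 *: b = - (S *m Wc *m S + S *m W *m S)].
Proof.
move=> H.
have {H} H x1 x2 := etrans (H x1 x2) (symbol_expand S Wc W x1 x2).
move: (S *m Wc *m W *m S) (S *m S) (S *m Wc *m S + S *m W *m S) H => X1 X2 X3 H.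
have simp := (expr1n, expr0n, mulr0, mul0r, mulr1, scale0r, scale1r, addr0, add0r, subr0, oppr0).
have aE : a = X1 by have := H 1 0; rewrite /= !simp.
have GE : G = X2 by have := H 0 1; rewrite /= !simp.
split=> //; have := H 1 1; rewrite aE GE !simp => /addIr/addrI.
exact.
Qed.

End EllipticRoot.

(** * The contractive condition *)

Section Conjugation.
Context {R : comUnitRingType} {l : nat}.
Implicit Types (S X Y : 'M[R]_l).

Lemma mulmx_subr_mid X Y Z T : X *m Y *m Z - X *m T *m Z = X *m (Y - T) *m Z :> 'M[R]_l.
Proof. by rewrite mulmxBr mulmxBl. Qed.

Lemma mulmx_sq_conj S Y : S \in unitmx -> S *m S *m (invmx S *m Y *m S) = S *m Y *m S.
Proof. by move=> uS; rewrite -!mulmxA mulKVmx. Qed.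

Lemma mulmx_conj_sq S Y : S \in unitmx -> S *m Y *m invmx S *m (S *m S) = S *m Y *m S.
Proof. by move=> uS; rewrite -!mulmxA mulKmx. Qed.

End Conjugation.

Section CommutatorPositivity.
Context {R : rcfType} {l : nat}.
Local Notation C := R[i].
Local Notation cj := (map_mx conjc).
Local Notation k := ((2 * 'i%C)^-1 : C).
Variables (a b G S W B D : 'M[C]_l).
Hypotheses (uS : S \in unitmx) (rS : cj S = S) (sS : S^T = S) (GE : G = S *m S).
Hypotheses (WE : W = B + 'i%C *: D) (rB : cj B = B) (rD : cj D = D).
Local Notation V := (invmx S *m W *m S).
Hypothesis rV : root_of a b G V.

Let cjW : cj W = B - 'i%C *: D.
Proof.
rewrite WE map_mxD cjZ rB rD -scaleNr; congr (_ + _ *: _).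
by apply/eqP; rewrite eq_complex /= oppr0 !eqxx.
Qed.

Let cjV : cj V = invmx S *m cj W *m S.
Proof. by rewrite !map_mxM map_invmx rS. Qed.

Let i2_neq0 : 2 * 'i%C != 0 :> C.
Proof. by rewrite mulf_neq0 ?pnatr_eq0 ?i_neq0. Qed.

Let EE : imE G V = S *m D *m S.
Proof.
have d : W - cj W = (2 * 'i%C) *: D.
  by rewrite cjW WE; apply/matrixP => i j; rewrite !mxE; ring.
have WV : imW V = invmx S *m ((2 * 'i%C) *: D) *m S.
  by rewrite -d -mulmx_subr_mid -cjV.
have GW : G *m imW V = (2 * 'i%C) *: (S *m D *m S).
  rewrite WV GE mulmx_sq_conj //.
  by move: (2 * 'i%C) => c; rewrite -scalemxAr -scalemxAl.
by rewrite /imE GW scalerA mulVf ?scale1r.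
Qed.

Let uD : D \in unitmx.
Proof.
have uE := pos_unit (imE_pos rV); rewrite EE in uE.
by move: uE; rewrite !unitmx_mul uS andbT.
Qed.

Let hS : hc S = S.
Proof.
by rewrite /hc rS. Qed.

Let hcW : hc W = D *m B *m invmx D - 'i%C *: D.
Proof.
have hV : hc V = S *m hc W *m invmx S by rewrite !hcM hc_inv hS mulmxA.
have := imE_Vc rV; rewrite EE cjV hV.
have -> : S *m D *m S *m (invmx S *m cj W *m S) = S *m (D *m cj W) *m S.
  by rewrite -!mulmxA mulKVmx.
have -> : S *m hc W *m invmx S *m (S *m D *m S) = S *m (hc W *m D) *m S.
  by rewrite -!mulmxA mulKmx.
move/(can_inj (mulmxK uS))/(can_inj (mulKmx uS)) => H.
rewrite -[LHS](mulmxK uD) -H cjW mulmxBr mulmxBl; congr (_ - _).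
by rewrite -scalemxAr -scalemxAl mulmxK.
Qed.

(** The identity [E (conj V) = hc V E] becomes [hc W D = D (conj W)], which
    expresses [hc W] by [B] and [D]; so [D^-1 (W - hc W)] is [2i] plus the
    commutator. *)
Lemma dtnM_similar : invmx (imE G V) *m dtnM G V
  = invmx S *m (1%:M + k *: (invmx D *m B - B *m invmx D)) *m S.
Proof.
have uE := pos_unit (imE_pos rV); apply: (can_inj (mulKmx uE)); rewrite mulKVmx // EE.
have -> : S *m D *m S *m (invmx S *m (1%:M + k *: (invmx D *m B - B *m invmx D)) *m S)
   = S *m (k *: (W - hc W)) *m S.
  rewrite -!mulmxA mulKVmx // (mulmxA D); congr (_ *m (_ *m _)).
  have -> : W - hc W = (2 * 'i%C) *: D + (B - D *m B *m invmx D).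
    rewrite hcW WE; move: (D *m B *m invmx D) => X.
    by apply/matrixP => i j; rewrite !mxE; ring.
  rewrite mulmxDr mulmx1 [k *: (_ *: D + _)]scalerDr [k *: (_ *: D)]scalerA mulVf // scale1r; congr (_ + _).
  by rewrite -scalemxAr mulmxBr mulKVmx // mulmxA.
have hV : hc V = S *m hc W *m invmx S by rewrite !hcM hc_inv hS mulmxA.
have GV : G *m V = S *m W *m S by rewrite GE; exact: mulmx_sq_conj.
have VG : hc V *m G = S *m hc W *m S by rewrite hV GE; exact: mulmx_conj_sq.
rewrite /dtnM GV VG mulmx_subr_mid; move: (W - hc W) k => X c.
by rewrite -scalemxAr -scalemxAl.
Qed.

(** By [dtnM_similar] the eigenvalues of [E^-1 M] are [1 + z / 2i], with
    real part [1 + Im z / 2], for the eigenvalues [z] of the commutator. *)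
Lemma commutator_pos :
  (forall z, eigenvalue (invmx D *m B - B *m invmx D) z -> -2 < complex.Im z) ->
  pos_form (dtnM G V).
Proof.
move=> H; apply: (dtnM_pos rV) => y; rewrite dtnM_similar => /(similar_eigenvalue uS).
case/eigenvalueP => u; rewrite mulmxDr mulmx1 -scalemxAr.
set X := invmx D *m B - _ in H *; move=> uX u0.
have /H : eigenvalue X (2 * 'i%C * (y - 1)).
  apply/eigenvalueP; exists u => //.
  have -> : u *m X = (2 * 'i%C) *: (k *: (u *m X)) by rewrite scalerA mulfV // scale1r.
  by rewrite -[RHS]scalerA scalerBl scale1r -uX addrAC subrr add0r.
case: y {uX} => y1 y2 /=; simpc => /=; lra.
Qed.

End CommutatorPositivity.

Section SpectralRadius.
Context {R : realType} {l : nat}.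
Local Notation C := R[i].

(** The supremum is over a bounded set, as the eigenvalues are
    the roots of the characteristic polynomial. *)
Lemma eigenvalue_spectral_radius (M : 'M[C]_l) z : eigenvalue M z ->
  ComplexField.Normc.normc z <= spectral_radius M.
Proof.
move=> ez; rewrite /spectral_radius; apply: ub_le_sup; last by exists z.
(* The sum of the moduli of the roots is a crude upper bound. *)
have [rs Ers] := closed_field_poly_normal (char_poly M).
exists (\sum_(w <- rs) ComplexField.Normc.normc w) => _ [w /= ew <-].
have : w \in rs.
  move: ew; rewrite eigenvalue_root_char Ers rootZ ?lead_coef_eq0 ?char_poly_eq0 //.
    by rewrite root_prod_XsubC.
  by rewrite -size_poly_eq0 size_char_poly.
have n0 (t : C) : 0 <= ComplexField.Normc.normc t.
  by case: t => p q; exact: sqrtr_ge0.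
elim: rs {Ers} => // r rs IH; rewrite inE big_cons => /orP[/eqP ->|/IH H].
  by rewrite lerDl sumr_ge0.
by apply: (le_trans H); rewrite lerDr.
Qed.

Lemma Im_normc (z : C) : - ComplexField.Normc.normc z <= complex.Im z.
Proof.
case: z => p q /=; rewrite lerNl; apply: (le_trans (ler_norm _)).
by rewrite normrN -sqrtr_sqr ler_wsqrtr // lerDr sqr_ge0.
Qed.

End SpectralRadius.

(** * Mixed exponents *)

Local Open Scope ring_scope.

Section Conclusion.
Context {R : realType}.
Local Notation C := R[i].

Lemma contractive_root l (A : mx_triple R l) : elliptic A ->
  contractive_neumann_wellposed A ->
  exists2 V, root_of (mxC (A11 A)) (mxC (A12 A)) (mxC (A22 A)) V &
    pos_form (dtnM (mxC (A22 A)) V).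
Proof.
move=> [s12 [s11 p11] [s22 p22] _] [W [upW [S [[sS pS] SS] fac]] rho].
have [GE aE bE] := symbol_coef fac.
have uS : mxC S \in unitmx by exact/pos_unit/posdef_pos_form.
have hS : hc (mxC S) = mxC S by rewrite hc_mxC map_trmx sS.
have rV : root_of (mxC (A11 A)) (mxC (A12 A)) (mxC (A22 A))
    (invmx (mxC S) *m W *m mxC S).
  apply: denormalized_root uS hS _ _ _ _ _ GE aE bE upW.
  - exact: conj_mxC.
  - by rewrite map_trmx s22.
  - exact: posdef_pos_form.
  - exact: conj_mxC.
  - exact: conj_mxC.
exists (invmx (mxC S) *m W *m mxC S) => //.
apply: (commutator_pos uS (conj_mxC S) _ GE (mxC_split W) (conj_mxC _) (conj_mxC _) rV).
  by rewrite map_trmx sS.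
move=> z ez; apply: lt_le_trans (Im_normc z).
rewrite ltrN2; apply: le_lt_trans rho.
apply: eigenvalue_spectral_radius.
by move: ez; rewrite /commutator_mx /mxC map_mxB !map_mxM map_invmx.
Qed.

Lemma mixed_exponents_pairing l (A : mx_triple R l) V (alpha : R) (lam : C) :
  root_of (mxC (A11 A)) (mxC (A12 A)) (mxC (A22 A)) V -> 0 < alpha ->
  mixed_exponents A alpha lam ->
  exists x y (c : 'cV[C]_l) (m : R),
  [/\ transport V alpha (2 * complex.Re lam) x y,
      x alpha = - (hc c *m imE (mxC (A22 A)) V) /\ y alpha = c, c != 0,
      (x 0 *m y 0) 0 0 = m%:C
    & pos_form (dtnM (mxC (A22 A)) V) -> 0 <= m].
Proof.
move=> rV a0 [v sol [r [phi [r0 pI nz]]]].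
apply: (mixed_pairing sol a0 rV); exists phi => //.
by apply: contraNneq nz => v0; rewrite /homogeneous_fun v0 scaler0.
Qed.

Lemma mixed_exponents0 (A : mx_triple R 0) (alpha : R) (lam : C) :
  ~ mixed_exponents A alpha lam.
Proof. by move=> [v _ [r [phi [_ _]]]]; rewrite [homogeneous_fun _ _ _ _]flatmx0 eqxx. Qed.

Lemma mixed_exponents_root l (A : mx_triple R l) (alpha : R) (lam : C) :
  elliptic A -> mixed_exponents A alpha lam ->
  exists V, root_of (mxC (A11 A)) (mxC (A12 A)) (mxC (A22 A)) V.
Proof.
case: l A => [|l] A ellA; last by move=> _; exact: elliptic_root.
by move/mixed_exponents0.
Qed.

End Conclusion.

Section Main.
Context {R : realType} {l : nat}.
Local Notation C := R[i].
Variables (A : mx_triple R l) (V : 'M[C]_l) (alpha : R) (lam : C).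
Hypothesis rV : root_of (mxC (A11 A)) (mxC (A12 A)) (mxC (A22 A)) V.
Hypothesis alpha0 : 0 < alpha.
Hypothesis mem : mixed_exponents A alpha lam.
Local Notation M := (dtnM (mxC (A22 A)) V).

Lemma convex_Re0 : alpha < pi -> ~ (2^-1 < `|complex.Re lam|) -> complex.Re lam = 0.
Proof.
move=> api /negP; rewrite -leNgt ler_norml => /andP[lo hi].
have [x [y [c [m [xy [xa ya] c0 m0 _]]]]] := mixed_exponents_pairing rV alpha0 mem.
have sI : -1 <= 2 * complex.Re lam <= 1 by apply/andP; split; lra.
have := no_exponent_convex rV alpha0 xy xa ya c0 m0 api sI.
by lra.
Qed.

Lemma reentrant_Re0 : pi < alpha < 2 * pi -> ~ (4^-1 < `|complex.Re lam|) ->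
  complex.Re lam = 0.
Proof.
move=> api /negP; rewrite -leNgt ler_norml => /andP[lo hi].
have [x [y [c [m [xy [xa ya] c0 m0 _]]]]] := mixed_exponents_pairing rV alpha0 mem.
have sI : - 2^-1 <= 2 * complex.Re lam <= 2^-1 by apply/andP; split; lra.
have := no_exponent_reentrant rV alpha0 xy xa ya c0 m0 api sI.
by lra.
Qed.

Lemma contractive_Re_neq0 : pos_form M -> complex.Re lam <> 0.
Proof.
move=> pM re0.
have [x [y [c [m [xy [xa ya] c0 m0 mge]]]]] := mixed_exponents_pairing rV alpha0 mem.
have s0 : 2 * complex.Re lam = 0 by rewrite re0 mulr0.
have := pairing_s0 rV alpha0 xy xa ya c0 m0 s0.
by have := mge pM; lra.
Qed.

Lemma flat_sin : sin alpha = 0 -> sin (2 * complex.Re lam * alpha) = 0.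
Proof.
have [x [y [c [m [xy [xa ya] c0 m0 _]]]]] := mixed_exponents_pairing rV alpha0 mem.
by move=> sa; have [e _ []] := pairing_mono rV alpha0 xy xa ya c0 m0 sa.
Qed.

Lemma flat_contractive : pos_form M -> sin alpha = 0 ->
  cos (2 * complex.Re lam * alpha) = -1.
Proof.
move=> pM sa.
have [x [y [c [m [xy [xa ya] c0 m0 mge]]]]] := mixed_exponents_pairing rV alpha0 mem.
have [e e0 [mE s0]] := pairing_mono rV alpha0 xy xa ya c0 m0 sa.
have := mge pM; rewrite mE oppr_ge0 pmulr_lle0 // => cn.
have := cos2Dsin2 (2 * complex.Re lam * alpha); rewrite s0 expr0n addr0.
by move/eqP; rewrite sqrf_eq1 => /orP[/eqP c1|/eqP //]; move: cn; rewrite c1; lra.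
Qed.

End Main.

Theorem theorem7p2 (R : realType) (l : nat) (A : mx_triple R l)
    (ellA : elliptic A) :
  (contractive_neumann_wellposed A ->
    [/\ forall alpha : R, 0 < alpha < pi ->
          mixed_exponents A alpha `<=` [set lam | 2^-1 < `|cRe lam|],
        mixed_exponents A pi `<=`
          [set lam | exists k : int, cRe lam = 2^-1 + k%:~R],
        forall alpha : R, pi < alpha < 2 * pi ->
          mixed_exponents A alpha `<=` [set lam | 4^-1 < `|cRe lam|]
      & mixed_exponents A (2 * pi) `<=`
          [set lam | exists k : int, cRe lam = 4^-1 + 2^-1 * k%:~R]])
  /\
  [/\ forall alpha : R, 0 < alpha < pi ->
        forall lam, mixed_exponents A alpha lam ->
          ~ (2^-1 < `|cRe lam|) -> cRe lam = 0,
      forall lam, mixed_exponents A pi lam ->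
        ~ (exists k : int, cRe lam = 2^-1 + k%:~R) ->
        exists k : int, cRe lam = 2^-1 * k%:~R,
      forall alpha : R, pi < alpha < 2 * pi ->
        forall lam, mixed_exponents A alpha lam ->
          ~ (4^-1 < `|cRe lam|) -> cRe lam = 0
    & forall lam, mixed_exponents A (2 * pi) lam ->
        ~ (exists k : int, cRe lam = 4^-1 + 2^-1 * k%:~R) ->
        exists k : int, cRe lam = 4^-1 * k%:~R].
Proof.
have pi0 : 0 < pi :> R by exact: pi_gt0.
have tpi0 : 0 < 2 * pi :> R by rewrite mulr_gt0.
have sin2pi : sin (2 * pi) = 0 :> R by rewrite mulr_natl mulr2n sinD sinpi mulr0 mul0r addr0.
split.
  move=> /(contractive_root ellA)[V rV pM]; split.
  - move=> alpha /andP[a0 api] lam mem /=; apply: contrapT => H.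
    exact: contractive_Re_neq0 rV a0 mem pM (convex_Re0 rV a0 mem api H).
  - move=> lam mem /=.
    have [k kE] := cos_eqN1_int (flat_contractive rV pi0 mem pM (sinpi R)).
    exists k; apply: (mulIf (lt0r_neq0 tpi0)); lra.
  - move=> alpha /andP[a1 a2] lam mem /=; apply: contrapT => H.
    have a0 := lt_trans pi0 a1; have aI : pi < alpha < 2 * pi by rewrite a1.
    exact: contractive_Re_neq0 rV a0 mem pM (reentrant_Re0 rV a0 mem aI H).
  - move=> lam mem /=.
    have [k kE] := cos_eqN1_int (flat_contractive rV tpi0 mem pM sin2pi).
    exists k; apply: (mulIf (lt0r_neq0 tpi0)); lra.
split.
- move=> alpha /andP[a0 api] lam mem; have [V rV] := mixed_exponents_root ellA mem.
  exact: convex_Re0 rV a0 mem api.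
- move=> lam mem _; have [V rV] := mixed_exponents_root ellA mem.
  have [k kE] := sin_eq0_int (flat_sin rV pi0 mem (sinpi R)).
  exists k; apply: (mulIf (lt0r_neq0 tpi0)); lra.
- move=> alpha aI lam mem; have [V rV] := mixed_exponents_root ellA mem.
  have a0 : 0 < alpha by case/andP: (aI) => a1 _; exact: lt_trans a1.
  exact: reentrant_Re0 rV a0 mem aI.
- move=> lam mem _; have [V rV] := mixed_exponents_root ellA mem.
  have [k kE] := sin_eq0_int (flat_sin rV tpi0 mem sin2pi).
  exists k; apply: (mulIf (lt0r_neq0 tpi0)); lra.
Qed.
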